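(* Let $G$ be of type $\mathrm G_2$ over an algebraically closed field of characteristic $p$, with simple roots $\alpha$ (short) and $\beta$ (long) and corresponding fundamental weights $\varpi_\alpha,\varpi_\beta$. (i) If $p=2$, the Frobenius contraction $L(\rho)^\phi$ of the simple $G$-module $L(\rho)=\mathrm{St}$ is not semisimple. (ii) If $p\ge 3$ and $\lambda=(p-3)\varpi_\alpha+2\varpi_\beta$, then the Frobenius contraction $(L(\lambda)\otimes\mathrm{St}^{[1]})^\phi\simeq L(\lambda)^\phi\otimes\mathrm{St}$ of the simple $G$-module $L(\lambda)\otimes\mathrm{St}^{[1]}$ is not semisimple.
   Context: Setting. $\Bbbk$ is an algebraically closed field of characteristic $p>0$; $G$ is a simply connected semisimple algebraic group over $\Bbbk$ with a split $\mathbb F_p$-form, and $F:G\to G$ is the associated (geometric) Frobenius endomorphism. $T\subset B$ are a maximal torus and a Borel subgroup, both split over $\mathbb F_p$; $R$ is the root system of $G$ with respect to $T$, $R^+$ the positive system such that the roots of $B$ are $-R^+$, $R^{\mathrm s}$ the set of simple roots, $\Lambda$ the character group of $T$, $\rho=\frac12\sum_{\gamma\in R^+}\gamma$. $G$-modules are rational $G$-modules, tensor products are over $\Bbbk$, and $M_\lambda$ is the $\lambda$-weight space of $M$. $L(\lambda)$ is the simple $G$-module of highest weight $\lambda$, and $\mathrm{St}=L((p-1)\rho)$ is the Steinberg module. $M^{[1]}$ is $M$ with $G$ acting through $F$. $\mathrm{Dist}(H)$ is the algebra of distributions of a group scheme $H$, and $T_1$ is the Frobenius kernel of $T$. Frobenius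 contraction. Let $x_\gamma$ ($\gamma\in R$), $h_\delta$ ($\delta\in R^{\mathrm s}$) be a Chevalley basis of $\mathrm{Lie}(G)$ and $x_\gamma^{(n)}\in\mathrm{Dist}(G)$ the divided powers. Let $\mu_0\in\mathrm{Dist}(T_1)$ be the unique primitive idempotent not annihilated by the counit; it acts on a $G$-module $M$ as the projection onto $\mu_0M=\bigoplus_{\lambda\in\Lambda}M_{p\lambda}$. It is known that there is a $\Bbbk$-algebra homomorphism $\phi:\mathrm{Dist}(G)\to\mu_0\mathrm{Dist}(G)\mu_0$ with $\phi(x_{\pm\gamma}^{(n)})=\mu_0x_{\pm\gamma}^{(pn)}\mu_0$ and $\phi(\binom{h_\gamma}{n})=\mu_0\binom{h_\gamma}{pn}\mu_0$ for $\gamma\in R^{\mathrm s}$, $n\in\mathbb N$; it satisfies $\mathrm{Dist}(F)\circ\phi=\mathrm{id}$. For a $G$-module $M$, the Frobenius contraction $M^\phi$ is the space $\mu_0M$ with $\mathrm{Dist}(G)$ acting through $\phi$; being locally finite it is a $G$-module, and its $\lambda$-weight space is $M_{p\lambda}$. *)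

(* Defs.v *)
From Stdlib Require Import ClassicalEpsilon.
From HB Require Import structures.
From mathcomp Require Import all_boot all_order all_algebra.
From mathcomp Require Export mpoly mxtens.

Set Implicit Arguments.
Unset Strict Implicit.
Unset Printing Implicit Defensive.

Import GRing.Theory.
Local Open Scope ring_scope.

(** * Simple roots and weights

For a group of type G2 the weight lattice is identified with Z x Z by means of
the fundamental weights, so that a weight lam is
(<lam, alpha^vee>, <lam, beta^vee>). *)

Inductive sroot := Ralpha | Rbeta.

Definition weight : Type := (int * int)%type.

Definition varpi_alpha : weight := (1, 0).
Definition varpi_beta : weight := (0, 1).

(* The rows of the Cartan matrix, alpha being short and beta long. *)
Definition alpha : weight := (2%:Z, -1).
Definition beta : weight := (- 3%:Z, 2%:Z).

Definition rho : weight := varpi_alpha + varpi_beta.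

Fact rhoE : rho *+ 2 =
  alpha + beta + (alpha + beta) + (alpha *+ 2 + beta) + (alpha *+ 3 + beta)
  + (alpha *+ 3 + beta *+ 2).
Proof. by []. Qed.

(* The dominance order: lam - mu is a sum of positive roots. *)
Definition weight_le (mu lam : weight) : Prop :=
  exists i j : nat, lam = mu + alpha *+ i + beta *+ j.

(** * The simply connected group of type G2

We take the Chevalley group attached to the 7-dimensional representation of
highest weight varpi_alpha = 2 alpha + beta of the complex Lie algebra of type
G2 and its lattice generated by a highest weight vector. This lattice has a
basis v_0, ..., v_6 of weight vectors, of weights
  2a+b, a+b, a, 0, -a, -a-b, -2a-b      (a = alpha, b = beta),
in which the Chevalley generators x_alpha, x_beta, x_{-alpha}, x_{-beta} act by
  E01 + 2 E23 + E34 + E56,  E12 + E45,  E10 + E32 + 2 E43 + E65,  E21 + E54,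
and the only nonzero divided powers x^(n), n > 1, are x_alpha^(2) = E24 and
x_{-alpha}^(2) = E42. Since these weights span the weight lattice, the group
generated by the one-parameter subgroups x_gamma(t) = sum_n t^n x_gamma^(n) is
the group of k-points of the simply connected semisimple group of type G2 when
k is algebraically closed, and it is closed in GL_7. *)

Section Group.

Context {k : closedFieldType}.

Implicit Types (g h : 'M[k]_7) (s : bool) (gam : sroot).

Let E (i j : nat) : 'M[k]_7 := delta_mx (inord i) (inord j).

(* s = true gives the root gam, s = false the root -gam. *)
Definition xroot gam s (t : k) : 'M[k]_7 :=
  match gam, s with
  | Ralpha, true =>
      1%:M + t *: (E 0 1 + 2%:R *: E 2 3 + E 3 4 + E 5 6) + t ^+ 2 *: E 2 4
  | Ralpha, false =>
      1%:M + t *: (E 1 0 + E 3 2 + 2%:R *: E 4 3 + E 6 5) + t ^+ 2 *: E 4 2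
  | Rbeta, true => 1%:M + t *: (E 1 2 + E 4 5)
  | Rbeta, false => 1%:M + t *: (E 2 1 + E 5 4)
  end.

(* The inverse of xroot gam s t is xroot gam s (- t), so this is a group; it
   contains the subgroups attached to all twelve roots, these being conjugate
   to the ones below under representatives of the Weyl group. *)
Inductive G2 : 'M[k]_7 -> Prop :=
| G2_1 : G2 1%:M
| G2_M g h : G2 g -> G2 h -> G2 (g *m h)
| G2_xroot gam s t : G2 (xroot gam s t).

(* The weights of v_0, ..., v_6. *)
Definition basis_weights : seq weight :=
  [:: varpi_alpha; varpi_alpha - alpha; alpha; 0; - alpha;
      alpha - varpi_alpha; - varpi_alpha].

Definition wchar (lam : weight) (a b : k) : k := a ^ lam.1 * b ^ lam.2.

(* alpha^vee(a) beta^vee(b), for nonzero a and b *)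
Definition torus (a b : k) : 'M[k]_7 :=
  diag_mx (\row_i wchar (nth 0 basis_weights i) a b).

Definition T2 g : Prop := exists a b, [/\ a != 0, b != 0 & g = torus a b].

Definition coroot gam (t : k) : 'M[k]_7 :=
  if gam is Ralpha then torus t 1 else torus 1 t.

(* The Frobenius endomorphism of the split F_p-form. *)
Definition Frob (p : nat) g : 'M[k]_7 := map_mx (fun x => x ^+ p) g.

(* Elements of k[G]; as G lies in SL_7, polynomials in the entries suffice. *)
Definition regular (f : 'M[k]_7 -> k) : Prop :=
  exists P : {mpoly k[7 * 7]},
    forall g, G2 g -> f g = P.@[fun i => mxvec g 0 i].

(** * Finite-dimensional rational modules

A module of dimension n is the space of column vectors of height n, on which g
in G acts by left multiplication by r g. The values of r outside of G are
irrelevant. *)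

Definition rational n (r : 'M[k]_7 -> 'M[k]_n) : Prop :=
  [/\ r 1%:M = 1%:M,
      forall g h, G2 g -> G2 h -> r (g *m h) = r g *m r h &
      forall i j, regular (fun g => r g i j)].

Definition submod n (r : 'M[k]_7 -> 'M[k]_n) (U : {vspace 'cV[k]_n}) : Prop :=
  forall g v, G2 g -> v \in U -> r g *m v \in U.

Definition simple_submod n (r : 'M[k]_7 -> 'M[k]_n) (U : {vspace 'cV[k]_n})
    : Prop :=
  [/\ submod r U, U != 0%VS &
      forall W, submod r W -> (W <= U)%VS -> W = 0%VS \/ W = U].

Definition simple_module n (r : 'M[k]_7 -> 'M[k]_n) : Prop :=
  rational r /\ simple_submod r fullv.

Definition semisimple_module n (r : 'M[k]_7 -> 'M[k]_n) : Prop :=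
  rational r /\
  exists (m : nat) (U : 'I_m -> {vspace 'cV[k]_n}),
    [/\ forall i, simple_submod r (U i),
        (\sum_i U i)%VS = fullv & directv (\sum_i U i)%VS].

Definition isomorphic n1 n2 (r1 : 'M[k]_7 -> 'M[k]_n1)
    (r2 : 'M[k]_7 -> 'M[k]_n2) : Prop :=
  exists (P : 'M[k]_(n2, n1)) (Q : 'M[k]_(n1, n2)),
    [/\ P *m Q = 1%:M, Q *m P = 1%:M &
        forall g, G2 g -> P *m r1 g = r2 g *m P].

Definition tensor n1 n2 (r1 : 'M[k]_7 -> 'M[k]_n1) (r2 : 'M[k]_7 -> 'M[k]_n2)
  : 'M[k]_7 -> 'M[k]_(n1 * n2) := fun g => r1 g *t r2 g.

(* M^[1] *)
Definition twist (p : nat) n (r : 'M[k]_7 -> 'M[k]_n) : 'M[k]_7 -> 'M[k]_n :=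
  fun g => r (Frob p g).

Definition weight_vector n (r : 'M[k]_7 -> 'M[k]_n) (lam : weight)
    (v : 'cV[k]_n) : Prop :=
  forall a b, a != 0 -> b != 0 -> r (torus a b) *m v = wchar lam a b *: v.

Definition highest_weight n (r : 'M[k]_7 -> 'M[k]_n) (lam : weight) : Prop :=
  (exists2 v, v != 0 & weight_vector r lam v) /\
  (forall mu v, v != 0 -> weight_vector r mu v -> weight_le mu lam).

(* r is L(lam), which is determined by lam up to isomorphism. *)
Definition simple_of_weight n (r : 'M[k]_7 -> 'M[k]_n) (lam : weight) : Prop :=
  simple_module r /\ highest_weight r lam.

(** * Distributions

Functionals on k[G] are represented by functionals on all functions on
matrices, of which only the values on regular functions matter; [deq] is
equality as functionals on k[G]. *)

Definition functional := ('M[k]_7 -> k) -> k.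

Implicit Types (mu nu : functional) (phi : functional -> functional).

Definition deq mu nu : Prop := forall f, regular f -> mu f = nu f.

Definition is_linear mu : Prop :=
  forall a f1 f2, regular f1 -> regular f2 ->
    mu (fun g => a * f1 g + f2 g) = a * mu f1 + mu f2.

(* Dist(G): the linear forms on k[G] killing a power of the ideal of the neutral
   element. *)
Definition is_dist mu : Prop :=
  [/\ is_linear mu,
      forall f1 f2, regular f1 -> regular f2 ->
        (forall g, G2 g -> f1 g = f2 g) -> mu f1 = mu f2 &
      exists n : nat, forall f : 'I_n.+1 -> 'M[k]_7 -> k,
        (forall i, regular (f i) /\ f i 1%:M = 0) ->
        mu (fun g => \prod_i f i g) = 0].

Definition dscale (a : k) mu : functional := fun f => a * mu f.
Definition dadd mu nu : functional := fun f => mu f + nu f.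
Definition dzero : functional := fun=> 0.
Definition dunit : functional := fun f => f 1%:M.
Definition dmul mu nu : functional :=
  fun f => mu (fun g => nu (fun h => f (g *m h))).

Definition counit mu : k := mu (fun=> 1).

(* The matrix of the action of mu on a rational module. *)
Definition dact n mu (r : 'M[k]_7 -> 'M[k]_n) : 'M[k]_n :=
  \matrix_(i, j) mu (fun g => r g i j).

(* The polynomial representing a polynomial function. *)
Definition poly_of (f : k -> k) : {poly k} :=
  epsilon (inhabits 0) (fun q => forall t, f t = q.[t]).

(* x_gam^(n) or x_{-gam}^(n), the image under the root homomorphism of the n-th
   element of the basis of Dist(G_a) dual to (t^m)_m. *)
Definition divpow gam s (n : nat) : functional :=
  fun f => (poly_of (fun t => f (xroot gam s t)))`_n.

Definition binz (m : int) (n : nat) : int :=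
  match m with
  | Posz m' => 'C(m', n)%:Z
  | Negz m' => (-1) ^+ n * 'C(m' + n, n)%:Z
  end.

(* (N, q) such that f t = t^-N q(t) for t nonzero *)
Definition laurent_of (f : k -> k) : nat * {poly k} :=
  epsilon (inhabits (0%N, 0))
    (fun Nq => forall t, t != 0 -> f t = t ^- Nq.1 * Nq.2.[t]).

(* binom(h_gam, n), the image under the coroot of the element binom(h, n) of
   Dist(G_m), which maps t^m to binom(m, n) for every integer m. *)
Definition hbinom gam (n : nat) : functional := fun f =>
  let: (N, q) := laurent_of (fun t => f (coroot gam t)) in
  \sum_(i < size q) q`_i * (binz (i%:Z - N%:Z) n)%:~R.

(** * Frobenius contraction *)

(* Dist(T_1): the ideal of T_1 in k[G] is generated by the ideal of T and by
   the image under F^* of the ideal of the neutral element. *)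
Definition is_distT1 (p : nat) mu : Prop :=
  [/\ is_linear mu,
      forall f1 f2, regular f1 -> regular f2 ->
        (forall g, T2 g -> f1 g = f2 g) -> mu f1 = mu f2 &
      forall f1 f2, regular f1 -> regular f2 -> f1 1%:M = 0 ->
        mu (fun g => f1 (Frob p g) * f2 g) = 0].

Definition idempotentT1 p mu : Prop :=
  is_distT1 p mu /\ deq (dmul mu mu) mu.

Definition primitiveT1 p mu : Prop :=
  [/\ idempotentT1 p mu, ~ deq mu dzero &
      forall e1 e2, idempotentT1 p e1 -> idempotentT1 p e2 ->
        deq (dmul e1 e2) dzero -> deq (dmul e2 e1) dzero ->
        deq mu (dadd e1 e2) -> deq e1 dzero \/ deq e2 dzero].

Definition is_mu0 p mu : Prop := primitiveT1 p mu /\ counit mu <> 0.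

(* phi is an algebra homomorphism from Dist(G) to mu0 Dist(G) mu0, the unit of
   the latter being mu0, with the prescribed values on the generators. *)
Record contraction_hom (p : nat) (mu0 : functional) phi : Prop := {
  phi_dist : forall mu, is_dist mu -> is_dist (phi mu);
  phi_corner : forall mu, is_dist mu ->
    deq (phi mu) (dmul mu0 (dmul (phi mu) mu0));
  phi_deq : forall mu nu, is_dist mu -> is_dist nu ->
    deq mu nu -> deq (phi mu) (phi nu);
  phi_linear : forall a mu nu, is_dist mu -> is_dist nu ->
    deq (phi (dadd (dscale a mu) nu)) (dadd (dscale a (phi mu)) (phi nu));
  phi_one : deq (phi dunit) mu0;
  phi_mul : forall mu nu, is_dist mu -> is_dist nu ->
    deq (phi (dmul mu nu)) (dmul (phi mu) (phi nu));
  phi_divpow : forall gam s n,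
    deq (phi (divpow gam s n)) (dmul mu0 (dmul (divpow gam s (p * n)) mu0));
  phi_hbinom : forall gam n,
    deq (phi (hbinom gam n)) (dmul mu0 (dmul (hbinom gam (p * n)) mu0)) }.

(* rN is the contraction M^phi of rM: iota identifies N with mu0 M, and the
   action of Dist(G) on N with its action on mu0 M through phi. *)
Definition contraction (mu0 : functional) phi n m
    (rM : 'M[k]_7 -> 'M[k]_n) (rN : 'M[k]_7 -> 'M[k]_m) : Prop :=
  rational rN /\
  exists iota : 'M[k]_(n, m),
    [/\ injective (fun v : 'cV[k]_m => iota *m v),
        forall u : 'cV[k]_n,
          (exists v : 'cV[k]_m, u = iota *m v) <->
          (exists w : 'cV[k]_n, u = dact mu0 rM *m w) &
        forall mu, is_dist mu ->
          iota *m dact mu rN = dact (phi mu) rM *m iota].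

End Group.

(* Main.v *)
From Stdlib Require Import ClassicalEpsilon FunctionalExtensionality.
Require Import Defs.
From mathcomp Require Import all_boot all_order all_algebra.
From mathcomp Require Import ring zify.

Set Implicit Arguments.
Unset Strict Implicit.
Unset Printing Implicit Defensive.

Import GRing.Theory.
Local Open Scope ring_scope.

(** Only the rank one relations between the four one-parameter subgroups enter:
they yield the commutation rules of the divided powers E^(a), F^(b), and show
that a vector fixed by U^+ generates a submodule all of whose weights lie below
its own (no Bruhat decomposition is needed, since the translates under the
opposite unipotent group span a space which is stable under x_gam(t) for almost
all t, hence for all t). Consequently, if y is a vector of weight mu of a
semisimple module and F_gam^(i) y, i > 0, is fixed by U^+, then it is zero. In
both parts non-semisimplicity is shown by a vector y of the contraction for
which F_alpha y is nonzero and fixed by U^+, because the weight of y is zero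
modulo p on alpha^vee.

Weights and operators of a contraction are read off from the distributions
binom(h_gam, n) and x_gam^(n), mu0 being the projection onto the weights in
p Lambda. The module L (x) St^[1] is simple because every nonzero submodule
contains the highest weight vector, and the same holds for its contragredient. *)

(** In the second part lambda - beta = p varpi_alpha, so that one step down from the highest weight
    vector of L leads into p Lambda; tensoring with the Steinberg module then raises the pairing of
    varpi_alpha with alpha^vee from 1 to p. For p = 2 the weight alpha, with <alpha, alpha^vee> = 2,
    does the same inside St. In the contraction E_alpha F_alpha y = <mu, alpha^vee> y is then zero,
    and the other E_gam^(i) kill F_alpha y because the weights they lead to do not occur. For the
    same reason raising F_alpha y inside the contraction cannot show that it is nonzero. This is
    done in the original module, where F_alpha becomes F_alpha^(p) and more operators are at hand:
    divided powers passing through weights outside p Lambda, and projections of a single tensor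
    factor.

    L and St are given abstractly, by their highest weights. Vanishing is therefore drawn from the
    bound on weights, if necessary after Weyl reflections, and nonvanishing from the return to a
    highest weight vector with a coefficient that is a unit of k. *)

Ltac case7 i := case: i => [|[|[|[|[|[|[|i]]]]]]] //.

(** * Relations between root subgroups, torus and Weyl group representatives as 7 x 7 matrices *)

Section MatrixIdentities.
Variable k : closedFieldType.
Implicit Types (t a b : k).

(* Matrices whose zero entries are marked by [None], so that the products of
   these sparse matrices reduce by computation to short expressions. *)
Definition entry_val (o : option k) : k := if o is Some x then x else 0.

Definition entry_mul (x y : option k) : option k :=
  if x is Some x' then if y is Some y' then Some (x' * y') else None else None.

Definition entry_add (x y : option k) : option k :=
  if x is Some x' then if y is Some y' then Some (x' + y') else x else y.

Definition mat7 (f : nat -> nat -> option k) : 'M[k]_7 :=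
  \matrix_(i, j) entry_val (f i j).

Definition entries_mul (f g : nat -> nat -> option k) (i j : nat) : option k :=
  foldr (fun l => entry_add (entry_mul (f i l) (g l j))) None (iota 0 7).

Lemma mat7M f g : mat7 f *m mat7 g = mat7 (entries_mul f g).
Proof.
have valD x y : entry_val (entry_add x y) = entry_val x + entry_val y.
  by case: x y => [x|] [y|] //=; rewrite ?addr0 ?add0r.
have valM x y : entry_val (entry_mul x y) = entry_val x * entry_val y.
  by case: x y => [x|] [y|] //=; rewrite ?mulr0 ?mul0r.
apply/matrixP => i j; rewrite !mxE /entries_mul.
rewrite (eq_bigr (fun l : 'I_7 => entry_val (entry_mul (f i l) (g l j)))); last first.
  by move=> l _; rewrite !mxE valM.
rewrite -(big_mkord xpredT (fun l => entry_val (entry_mul (f i l) (g l j)))) /index_iota subn0.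
by elim: (iota 0 7) => [|l s IH]; rewrite ?big_nil // big_cons IH /= valD.
Qed.

Lemma eq_mat7 f g : (forall i j, (i < 7)%N -> (j < 7)%N ->
  entry_val (f i j) = entry_val (g i j)) -> mat7 f = mat7 g.
Proof. by move=> fg; apply/matrixP => i j; rewrite !mxE fg. Qed.

Definition xroot_entry (gam : sroot) (s : bool) (t : k) (i j : nat) : option k :=
  if i == j then Some 1 else
  match gam, s, i, j with
  | Ralpha, true, 0, 1 | Ralpha, true, 3, 4 | Ralpha, true, 5, 6 => Some t
  | Ralpha, true, 2, 3 => Some (2%:R * t)
  | Ralpha, true, 2, 4 => Some (t * t)
  | Ralpha, false, 1, 0 | Ralpha, false, 3, 2 | Ralpha, false, 6, 5 => Some t
  | Ralpha, false, 4, 3 => Some (2%:R * t)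
  | Ralpha, false, 4, 2 => Some (t * t)
  | Rbeta, true, 1, 2 | Rbeta, true, 4, 5 => Some t
  | Rbeta, false, 2, 1 | Rbeta, false, 5, 4 => Some t
  | _, _, _, _ => None
  end.

Lemma xroot_mat7 gam (s : bool) t : xroot gam s t = mat7 (xroot_entry gam s t).
Proof.
apply/matrixP => i j; case: gam s => [] []; rewrite /xroot !mxE -!val_eqE /= !inordK //.
all: case: i j => [[|[|[|[|[|[|[|i]]]]]]] Hi] [[|[|[|[|[|[|[|j]]]]]]] Hj] //.
all: rewrite /xroot_entry /=; ring.
Qed.

Definition torus_entry a b (i j : nat) : option k :=
  if i == j then
    Some match i with
    | 0 => a | 1 => a^-1 * b | 2 => a * a * b^-1 | 3 => 1
    | 4 => a^-1 * a^-1 * b | 5 => a * b^-1 | _ => a^-1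
    end
  else None.

Lemma torus_mat7 a b : torus a b = mat7 (torus_entry a b).
Proof.
apply/matrixP => i j; rewrite /torus !mxE.
case: i j => [[|[|[|[|[|[|[|i]]]]]]] Hi] [[|[|[|[|[|[|[|j]]]]]]] Hj] //.
all: rewrite /torus_entry /wchar; cbn -[GRing.zero GRing.one exprz GRing.inv GRing.mul GRing.natmul].
- by rewrite mulr1n expr1z expr0z mulr1.
- by rewrite mulr1n !expr0z mulr1.
- by rewrite mulr1n -[a ^ _]/(a ^- 2) -[b ^ _]/(b ^+ 1) expr1 -exprVn expr2.
- by rewrite mulr1n -[a ^ _]/(a ^- 1) expr0z mulr1 expr1.
Qed.

Definition root_weight (gam : sroot) (s : bool) : weight :=
  let w := if gam is Ralpha then alpha else beta in if s then w else - w.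

(** The character [wchar (root_weight gam s)] with its integer exponents multiplied out, so that
    [torus_xroot] becomes an identity of rational functions in a, b and t. *)
Definition root_char (gam : sroot) (s : bool) a b : k :=
  match gam, s with
  | Ralpha, true => a * a * b^-1
  | Ralpha, false => a^-1 * a^-1 * b
  | Rbeta, true => a^-1 * a^-1 * a^-1 * b * b
  | Rbeta, false => a * a * a * b^-1 * b^-1
  end.

Lemma root_charE gam s a b : wchar (root_weight gam s) a b = root_char gam s a b.
Proof.
have cube (x : k) : x ^+ 3 = x * x * x by rewrite !exprS mulr1 mulrA.
case: gam s => [] [].
- by rewrite /root_char -expr2.
- by rewrite /root_char -expr2 exprVn.
- by rewrite /root_char -cube -mulrA -expr2 exprVn.
- by rewrite /root_char -cube -mulrA -expr2 exprVn.
Qed.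

Lemma torus_xroot gam s a b t : a != 0 -> b != 0 ->
  torus a b *m xroot gam s t =
  xroot gam s (wchar (root_weight gam s) a b * t) *m torus a b.
Proof.
move=> a0 b0; rewrite !torus_mat7 !xroot_mat7 !mat7M root_charE.
apply: eq_mat7 => i j.
case: gam s => [] [].
all: case7 i; case7 j => _ _; rewrite /torus_entry /xroot_entry /root_char //=.
all: by field; rewrite ?a0 ?b0.
Qed.

Lemma xrootD gam s t u : xroot gam s (t + u) = xroot gam s t *m xroot gam s u.
Proof.
rewrite !xroot_mat7 !mat7M.
apply: eq_mat7 => i j.
case: gam s => [] [].
all: case7 i; case7 j => _ _ //=.
all: ring.
Qed.

Lemma xroot0 gam s : xroot gam s 0 = 1%:M :> 'M[k]_7.
Proof.
by case: gam s => [] []; rewrite /xroot ?expr0n ?scale0r !addr0.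
Qed.

Definition other_root gam := if gam is Ralpha then Rbeta else Ralpha.

(** For distinct simple roots gamma and delta no i gamma - j delta with i, j > 0 is a root, so the
    two root subgroups commute. *)
Lemma xroot_comm gam t u :
  xroot gam true t *m xroot (other_root gam) false u =
  xroot (other_root gam) false u *m xroot gam true t.
Proof.
rewrite !xroot_mat7 !mat7M.
apply: eq_mat7 => i j.
case: gam.
all: case7 i; case7 j => _ _ //=.
all: ring.
Qed.

(** The image of the Gauss decomposition in SL_2 of the matrix with rows (1 + t u, t) and (u, 1). *)
Lemma xroot_rank1 gam t u : 1 + t * u != 0 ->
  xroot gam true t *m xroot gam false u =
  xroot gam false (u / (1 + t * u)) *m coroot gam (1 + t * u)
    *m xroot gam true (t / (1 + t * u)).
Proof.
move=> d0; rewrite /coroot; case: gam.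
all: rewrite !torus_mat7 !xroot_mat7 !mat7M.
all: apply: eq_mat7 => i j.
all: case7 i; case7 j => _ _ //=.
all: by field; rewrite ?d0 ?oner_eq0 ?andbT ?d0.
Qed.

(** The image of the matrix of SL_2 with rows (0, 1) and (-1, 0), a representative of the reflection
    in gam. *)
Definition weyl_rep gam : 'M[k]_7 :=
  xroot gam true 1 *m xroot gam false (-1) *m xroot gam true 1.

Lemma torus_weyl_rep_alpha a b : a != 0 -> b != 0 ->
  torus a b *m weyl_rep Ralpha = weyl_rep Ralpha *m torus (a^-1 * b) b.
Proof.
move=> a0 b0; rewrite /weyl_rep.
rewrite !torus_mat7 !xroot_mat7 !mat7M.
apply: eq_mat7 => i j.
case7 i; case7 j => _ _ //=.
all: by field; rewrite ?a0 ?b0.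
Qed.

Lemma torus_weyl_rep_beta a b : a != 0 -> b != 0 ->
  torus a b *m weyl_rep Rbeta = weyl_rep Rbeta *m torus a (a * a * a * b^-1).
Proof.
move=> a0 b0; rewrite /weyl_rep.
rewrite !torus_mat7 !xroot_mat7 !mat7M.
apply: eq_mat7 => i j.
case7 i; case7 j => _ _ //=.
all: by field; rewrite ?a0 ?b0.
Qed.

Lemma torusM a b c d : a != 0 -> b != 0 -> c != 0 -> d != 0 ->
  torus a b *m torus c d = torus (a * c) (b * d).
Proof.
move=> a0 b0 c0 d0; rewrite !torus_mat7 !mat7M.
apply: eq_mat7 => i j; rewrite /torus_entry.
case7 i; case7 j => _ _ //=.
all: by field; rewrite ?a0 ?b0 ?c0 ?d0.
Qed.

Lemma torus1 : torus 1 1 = 1%:M :> 'M[k]_7.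
Proof.
rewrite torus_mat7; apply/matrixP => -[i Hi] [j Hj]; rewrite !mxE -val_eqE /=.
by move: Hi Hj; case7 i; case7 j => _ _ //=; rewrite !invr1 ?mulr1.
Qed.

(* Transposition followed by conjugation with diag (1, 1, 1, 1/2, 1, 1, 1):
   outside characteristic 2 this is an anti-automorphism exchanging the root
   subgroups of gam and - gam. *)
Definition transp_diag : 'rV[k]_7 := \row_i (if i == 3 :> nat then 2%:R^-1 else 1).

Definition transp_inv : 'rV[k]_7 := \row_i (if i == 3 :> nat then 2%:R else 1).

Definition transp (g : 'M[k]_7) : 'M[k]_7 :=
  diag_mx transp_diag *m g^T *m diag_mx transp_inv.

Lemma transpE g i j :
  transp g i j = transp_diag 0 i * g j i * transp_inv 0 j.
Proof.
by rewrite /transp mul_mx_diag mxE mul_diag_mx !mxE.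
Qed.

(** Plain transposition would turn 2 E23 + E34 into 2 E32 + E43 instead of E32 + 2 E43; the entries
    1/2 and 2 at the place 3 correct this. *)
Lemma transp_xroot gam s t : 2%:R != 0 :> k ->
  transp (xroot gam s t) = xroot gam (~~ s) t.
Proof.
move=> two0; apply/matrixP => -[i Hi] [j Hj].
rewrite transpE !xroot_mat7 !mxE /=; case: gam s => [] []; move: Hi Hj.
all: by case7 i; case7 j => _ _ //=; field.
Qed.

Lemma transp_torus a b : 2%:R != 0 :> k -> transp (torus a b) = torus a b.
Proof.
move=> two0; apply/matrixP => -[i Hi] [j Hj].
rewrite transpE !torus_mat7 !mxE /=; move: Hi Hj.
by case7 i; case7 j => _ _ //=; rewrite ?mul1r ?mulr0 ?mul0r ?mulr1 ?mulVf.
Qed.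

Lemma transpM g h : 2%:R != 0 :> k -> transp (g *m h) = transp h *m transp g.
Proof.
move=> two0; rewrite /transp trmx_mul !mulmxA; congr (_ *m _ *m _).
rewrite -!mulmxA; congr (_ *m _); rewrite -[LHS]mulmx1; congr (_ *m _).
rewrite mulmx_diag; apply/matrixP => i j; rewrite !mxE.
by case: (i == 3 :> nat); rewrite ?divff ?mulr1.
Qed.

Lemma transp1 : 2%:R != 0 :> k -> transp 1%:M = 1%:M.
Proof.
move=> two0; rewrite /transp trmx1 mulmx1 mulmx_diag; apply/matrixP => i j.
by rewrite !mxE; case: (i == 3 :> nat); rewrite ?mulVf ?mulr1.
Qed.

End MatrixIdentities.
Arguments weyl_rep {k} gam.

(** * Polynomial and regular functions *)

Section PolynomialFunctions.
Variable k : closedFieldType.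

(** The product r of q with all X - a, a in s, vanishes everywhere. Then r + 1 has no root, so it is
    constant, k being algebraically closed. This is how the infinity of k enters. *)
Lemma poly_eq0_cofinite (q : {poly k}) (s : seq k) :
  (forall t, t \notin s -> q.[t] = 0) -> q = 0.
Proof.
move=> q0; pose r := q * \prod_(a <- s) ('X - a%:P).
have r0 t : r.[t] = 0.
  rewrite hornerM; have [ts|ts] := boolP (t \in s); last by rewrite q0 ?mul0r.
  by rewrite horner_prod (big_rem t) //= hornerXsubC subrr mul0r mulr0.
have /size_poly1P[c _ rc] : size (r + 1) == 1.
  apply/negP => /negP/closed_rootP[x /rootP].
  by rewrite hornerD r0 hornerC add0r; apply/eqP; exact: oner_neq0.
have rE : r = 0.
  have : r = (c - 1)%:P by rewrite rmorphB /= -rc addrK.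
  by move=> rE; move: (r0 0); rewrite rE hornerC => ->.
apply/eqP; move/eqP: rE; rewrite mulf_eq0 => /orP[//|].
by rewrite prodf_seq_eq0 => /hasP[a _ /=]; rewrite polyXsubC_eq0.
Qed.

Lemma poly_ofE (f : k -> k) q : (forall t, f t = q.[t]) -> poly_of f = q.
Proof.
move=> fq; apply/eqP; rewrite -subr_eq0; apply/eqP.
have ex : exists q', forall t, f t = q'.[t] by exists q.
apply: (@poly_eq0_cofinite _ [::]) => t _.
by rewrite hornerD hornerN -fq -(epsilon_spec (inhabits 0) _ ex) subrr.
Qed.

Lemma mx_poly_eq0 m n N (A : nat -> 'M[k]_(m, n)) (s : seq k) :
  (forall t, t \notin s -> \sum_(i < N) t ^+ i *: A i = 0) ->
  forall i, (i < N)%N -> A i = 0.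
Proof.
move=> A0 i iN; apply/matrixP => a b; rewrite mxE.
have q0 : \poly_(i < N) A i a b = 0.
  apply: (@poly_eq0_cofinite _ s) => t ts.
  move/matrixP/(_ a b): (A0 t ts); rewrite horner_poly summxE mxE => E.
  by rewrite -[RHS]E; apply: eq_bigr => l _; rewrite mxE mulrC.
by move/polyP/(_ i): q0; rewrite coef_poly iN coef0.
Qed.

(** Allows comparing coefficients of t: relations between the x_gam(t), valid for almost all t,
    become relations between divided powers. *)
Lemma mx_poly_inj m n N M (A B : nat -> 'M[k]_(m, n)) (s : seq k) :
  (forall i, (N <= i)%N -> A i = 0) -> (forall i, (M <= i)%N -> B i = 0) ->
  (forall t, t \notin s ->
     \sum_(i < N) t ^+ i *: A i = \sum_(i < M) t ^+ i *: B i) ->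
  forall i, A i = B i.
Proof.
move=> AN BM AB i; apply/eqP; rewrite -subr_eq0; apply/eqP.
have ext K L (C : nat -> 'M[k]_(m, n)) t : (forall i, (K <= i)%N -> C i = 0) ->
    (K <= L)%N -> \sum_(i < L) t ^+ i *: C i = \sum_(i < K) t ^+ i *: C i.
  move=> CK KL; rewrite -(big_mkord xpredT (fun i => t ^+ i *: C i)) (big_cat_nat (n := K)) //=.
  rewrite big_mkord [X in _ + X]big1_seq ?addr0 // => j.
  by rewrite mem_index_iota /= => /andP[Kj _]; rewrite CK // scaler0.
pose K := (maxn i.+1 (maxn N M)).
apply: (@mx_poly_eq0 m n K (fun i => A i - B i) s); last by rewrite leq_maxl.
move=> t ts; under eq_bigr do rewrite scalerBr.
have [NK MK] : (N <= K)%N /\ (M <= K)%N.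
  by rewrite /K !leq_max !leqnn !orbT.
by rewrite sumrB (ext N K) // (ext M K) // AB // subrr.
Qed.

End PolynomialFunctions.

Section Regular.
Variable k : closedFieldType.
Implicit Types (f g : 'M[k]_7 -> k).

(** The first hypothesis makes Q insensitive to values outside G; what remains is an induction on
    the polynomial representing f. *)
Lemma regular_ind (Q : ('M[k]_7 -> k) -> Prop) :
  (forall f g, (forall x, G2 x -> f x = g x) -> Q f -> Q g) ->
  (forall c, Q (fun=> c)) ->
  (forall f g, Q f -> Q g -> Q (fun x => f x + g x)) ->
  (forall f g, Q f -> Q g -> Q (fun x => f x * g x)) ->
  (forall i j, Q (fun x => x i j)) ->
  forall f, regular f -> Q f.
Proof.
move=> Qext Qc QD QM Qij f [P fP].
apply: (Qext (fun x => P.@[fun i => mxvec x 0 i])) => [x /fP ->//|].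
have Qsum (I : Type) (s : seq I) (F : I -> 'M[k]_7 -> k) :
    (forall i, Q (F i)) -> Q (fun x => \sum_(i <- s) F i x).
  move=> QF; elim: s => [|i s IH].
    by apply: Qext (Qc 0) => x _; rewrite big_nil.
  by apply: Qext (QD _ _ (QF i) IH) => x _; rewrite big_cons.
have Qprod (I : Type) (s : seq I) (F : I -> 'M[k]_7 -> k) :
    (forall i, Q (F i)) -> Q (fun x => \prod_(i <- s) F i x).
  move=> QF; elim: s => [|i s IH].
    by apply: Qext (Qc 1) => x _; rewrite big_nil.
  by apply: Qext (QM _ _ (QF i) IH) => x _; rewrite big_cons.
pose F x := \sum_(m <- msupp P) P@_m * \prod_i mxvec x 0 i ^+ m i.
apply: (Qext F) => [x _|]; first by rewrite mevalE.
apply: (Qsum) => m; apply: (QM); first exact: Qc.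
apply: (Qprod) => i.
have Qi : Q (fun x => mxvec x 0 i).
  by case/mxvec_indexP: i => i j; apply: Qext (Qij i j) => x _; rewrite mxvecE.
elim: (m i) => [|n IH]; first by apply: Qext (Qc 1) => x _; rewrite expr0.
by apply: Qext (QM _ _ Qi IH) => x _; rewrite exprS.
Qed.

Lemma regular_ext f g : (forall x, G2 x -> f x = g x) -> regular f -> regular g.
Proof. by move=> fg [P fP]; exists P => x Gx; rewrite -fg // fP. Qed.

Lemma regular_const c : regular (fun=> c : k).
Proof. by exists c%:MP => x _; rewrite mevalC. Qed.

Lemma regularD f g : regular f -> regular g -> regular (fun x => f x + g x).
Proof.
by move=> [P fP] [Q gQ]; exists (P + Q) => x Gx; rewrite mevalD -fP -?gQ.
Qed.

Lemma regularM f g : regular f -> regular g -> regular (fun x => f x * g x).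
Proof.
by move=> [P fP] [Q gQ]; exists (P * Q) => x Gx; rewrite mevalM -fP -?gQ.
Qed.

Lemma regular_entry i j : regular (fun x : 'M[k]_7 => x i j).
Proof. by exists 'X_(mxvec_index i j) => x _; rewrite mevalXU mxvecE. Qed.

Lemma regularZ c f : regular f -> regular (fun x => c * f x).
Proof. by move=> ?; apply: regularM => //; exact: regular_const. Qed.

Lemma regular_sum (I : Type) (s : seq I) (F : I -> 'M[k]_7 -> k) :
  (forall i, regular (F i)) -> regular (fun x => \sum_(i <- s) F i x).
Proof.
move=> rF; elim: s => [|i s IH].
  by apply: regular_ext (regular_const 0) => x _; rewrite big_nil.
by apply: regular_ext (regularD (rF i) IH) => x _; rewrite big_cons.
Qed.

Lemma regularX f n : regular f -> regular (fun x => f x ^+ n).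
Proof.
move=> rf; elim: n => [|n IH].
  by apply: regular_ext (regular_const 1) => x _; rewrite expr0.
by apply: regular_ext (regularM rf IH) => x _; rewrite exprS.
Qed.

(** The comultiplication of k[G]. It is what makes the inner function of [dmul] regular again
    ([regular_dmul]). *)
Lemma regular_comul f : regular f ->
  exists (I : finType) (u v : I -> 'M[k]_7 -> k),
  [/\ forall i, regular (u i), forall i, regular (v i) &
      forall x y, G2 x -> G2 y -> f (x *m y) = \sum_i u i x * v i y].
Proof.
elim/regular_ind => {f} [f g fg|c|f g|f g|i j].
- move=> [I [u [v [ru rv fE]]]]; exists I, u, v; split=> // x y Gx Gy.
  by rewrite -fg ?fE //; exact: G2_M.
- exists unit, (fun _ _ => c), (fun _ _ => 1); split=> [_|_|x y _ _].
  + exact: regular_const.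
  + exact: regular_const.
  + by rewrite (big_pred1 tt) ?mulr1 // => -[].
- move=> [I [u [v [ru rv fE]]]] [J [u' [v' [ru' rv' gE]]]].
  exists (I + J)%type, (fun i => match i with inl i => u i | inr i => u' i end),
    (fun i => match i with inl i => v i | inr i => v' i end).
  split=> [[]|[]|x y Gx Gy] //.
  by rewrite fE // gE // big_sumType.
- move=> [I [u [v [ru rv fE]]]] [J [u' [v' [ru' rv' gE]]]].
  exists (I * J)%type, (fun i x => u i.1 x * u' i.2 x), (fun i x => v i.1 x * v' i.2 x).
  split=> [i|i|x y Gx Gy]; try exact: regularM.
  rewrite fE // gE // big_distrlr pair_big /=.
  by apply: eq_bigr => ij _; rewrite mulrACA.
- exists 'I_7, (fun l x => x i l), (fun l x => x l j).
  split=> [l|l|x y _ _]; try exact: regular_entry.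
  by rewrite mxE.
Qed.

Lemma regular_shift f x : regular f -> G2 x -> regular (fun y => f (x *m y)).
Proof.
move=> /regular_comul[I [u [v [ru rv fE]]]] Gx.
apply: (@regular_ext (fun y => \sum_i u i x * v i y)) => [y Gy|].
  by rewrite fE.
by apply: regular_sum => i; apply: regularZ.
Qed.

Lemma regular_xroot f gam s : regular f ->
  exists q : {poly k}, forall t, f (xroot gam s t) = q.[t].
Proof.
elim/regular_ind => {f} [f g fg [q fE]|c|f g [q fE] [r gE]|f g [q fE] [r gE]|i j].
- by exists q => t; rewrite -fg ?fE //; exact: G2_xroot.
- by exists c%:P => t; rewrite hornerC.
- by exists (q + r) => t; rewrite hornerD fE gE.
- by exists (q * r) => t; rewrite hornerM fE gE.
suff [q qE] : exists q : {poly k}, forall t, entry_val (xroot_entry gam s t i j) = q.[t].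
  by exists q => t; rewrite xroot_mat7 mxE.
case: gam s => [] []; case: i j => [i Hi] [j Hj] /=; rewrite /xroot_entry.
all: move: Hi Hj; do ?[case: i => [|i] //=]; do ?[case: j => [|j] //=] => _ _.
all: try by [exists 0 => t; rewrite horner0 | exists 1 => t; rewrite hornerE
  | exists 'X => t; rewrite hornerE | exists (2%:R *: 'X) => t; rewrite !hornerE
  | exists ('X * 'X) => t; rewrite !hornerE].
Qed.

End Regular.

(** * Characters of the torus *)

Section Characters.
Variable k : closedFieldType.
Implicit Types (a b t : k) (mu nu : weight) (l : seq (k * weight)) (f g : 'M[k]_7 -> k).

Lemma wcharD mu nu a b : a != 0 -> b != 0 ->
  wchar (mu + nu) a b = wchar mu a b * wchar nu a b.
Proof.
move=> a0 b0; rewrite /wchar /= !expfzDr //; exact: mulrACA.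
Qed.

Lemma wchar0 a b : wchar 0 a b = 1.
Proof. by rewrite /wchar !expr0z mulr1. Qed.

Lemma wchar_neq0 mu a b : a != 0 -> b != 0 -> wchar mu a b != 0.
Proof. by move=> a0 b0; rewrite /wchar mulf_neq0 // expfz_neq0. Qed.

Lemma wcharMn mu n a b : wchar (mu *+ n) a b = wchar mu (a ^+ n) (b ^+ n).
Proof.
have E : mu *+ n = (mu.1 *+ n, mu.2 *+ n).
  by elim: n => [|n IH]; rewrite ?mulr0n // !mulrS IH.
have X (x : k) (m : int) : x ^ (m *+ n) = (x ^+ n) ^ m.
  by rewrite -mulr_natl natz exprnP exprz_exp.
by rewrite E; congr (_ * _); exact: X.
Qed.

(** With the parameters 1 and t - 1 the rank one relation has exactly [coroot gam t] in the middle,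
    and can be solved for it. *)
Lemma G2_coroot gam t : t != 0 -> G2 (coroot gam t).
Proof.
move=> t0; have E := @xroot_rank1 k gam 1 (t - 1); rewrite mul1r addrC subrK in E.
have -> : coroot gam t = xroot gam false (- ((t - 1) / t)) *m
    (xroot gam true 1 *m xroot gam false (t - 1)) *m xroot gam true (- (1 / t)).
  rewrite E // !mulmxA -xrootD addNr xroot0 mul1mx -mulmxA -xrootD addrN xroot0.
  by rewrite mulmx1.
by do !apply: G2_M; exact: G2_xroot.
Qed.

Lemma G2_torus a b : a != 0 -> b != 0 -> G2 (torus a b).
Proof.
move=> a0 b0; have -> : torus a b = torus a 1 *m torus 1 b.
  by rewrite torusM ?oner_neq0 // mulr1 mul1r.
by apply: G2_M; [exact: (@G2_coroot Ralpha) | exact: (@G2_coroot Rbeta)].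
Qed.

(** Multiplication by a large power of a turns the relation into a polynomial identity. Exponents
    may be repeated in l, whence the sum over all entries with exponent i. *)
Lemma int_char_indep (l : seq (k * int)) :
  (forall a, a != 0 -> \sum_(x <- l) x.1 * a ^ x.2 = 0) ->
  forall i : int, \sum_(x <- l) x.1 * (x.2 == i)%:R = 0.
Proof.
move=> l0 i.
have [N [iN lN]] : exists N : nat, 0 <= i + N%:Z /\ forall x, x \in l -> 0 <= (x.2 : int) + N%:Z.
  elim: {l0} l => [|x l [N [iN lN]]]; first by exists `|i|%N; split=> //; lia.
  exists (N + `|x.2|)%N; split; first by lia.
  move=> y; rewrite inE => /orP[/eqP -> | /lN].
    by case: (x) => /= _ z; lia.
  by case: (x) => /= _ z; case: y => /= _ w; lia.
have q0 : \sum_(x <- l) x.1 *: 'X^(absz (x.2 + N%:Z)) = 0 :> {poly k}.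
  apply: (@poly_eq0_cofinite _ _ [:: 0]) => a; rewrite inE => a0.
  have -> : 0 = \sum_(x <- l) a ^+ N * (x.1 * a ^ x.2) by rewrite -mulr_sumr l0 ?mulr0.
  rewrite horner_sum big_seq [RHS]big_seq; apply: eq_bigr => x /lN xN.
  by rewrite hornerZ hornerXn mulrCA [a ^+ N]exprnP -expfzDr // exprnP gez0_abs // addrC.
move/polyP/(_ (absz (i + N%:Z))): q0; rewrite coef0 coef_sum => q0.
rewrite -[RHS]q0 big_seq [RHS]big_seq; apply: eq_bigr => x /lN xN.
rewrite coefZ coefXn; congr (_ * (_ : bool)%:R).
by case: x xN => /= _ z; lia.
Qed.

Definition laurent (F : k -> k -> k) l := forall a b, a != 0 -> b != 0 ->
  F a b = \sum_(x <- l) x.1 * wchar x.2 a b.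

(** The value, on the Laurent polynomial listed by l, of the linear form on k[T] sending each
    character lam to m lam. Since l need not be reduced, independence of the list is a statement of
    its own, [lsum_inj]. *)
Definition lsum (m : weight -> k) l : k := \sum_(x <- l) x.1 * m x.2.

(** Independence of characters in one variable, applied to a and then to b, settles the indicator
    function of a single weight; a general m is a combination of these on the finitely many weights
    of l. *)
Lemma lsum_eq0 l : laurent (fun _ _ => 0) l -> forall m, lsum m l = 0.
Proof.
move=> l0.
have delta0 mu : lsum (fun nu => (nu == mu)%:R) l = 0.
  pose l1 := [seq (x.1 * (x.2.1 == mu.1)%:R, x.2.2) | x <- l].
  have H1 b : b != 0 -> \sum_(x <- [seq (x.1 * b ^ x.2.2, x.2.1) | x <- l])
      x.1 * (x.2 == mu.1)%:R = 0.
    move=> b0; apply: int_char_indep => a a0.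
    rewrite big_map /= [RHS](l0 a b) //; apply: eq_bigr => x _.
    by rewrite /wchar mulrAC mulrA.
  have H2 : \sum_(x <- l1) x.1 * (x.2 == mu.2)%:R = 0.
    apply: int_char_indep => b b0; rewrite -[RHS](H1 b b0) !big_map /=.
    by apply: eq_bigr => x _; rewrite mulrAC.
  rewrite -[RHS]H2 /lsum big_map; apply: eq_bigr => -[c [x1 x2]] _ /=.
  rewrite -mulrA -natrM mulnb; congr (_ * (_ : bool)%:R).
move=> m; rewrite /lsum.
have -> : \sum_(x <- l) x.1 * m x.2 =
    \sum_(mu <- undup [seq x.2 | x <- l]) m mu * lsum (fun nu => (nu == mu)%:R) l.
  under [RHS]eq_bigr do rewrite /lsum mulr_sumr.
  rewrite exchange_big /=; rewrite big_seq [RHS]big_seq; apply: eq_bigr => x xl.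
  rewrite (bigD1_seq x.2) ?undup_uniq ?mem_undup ?map_f //= eqxx mulr1 mulrC.
  rewrite big1 ?addr0 // => mu; rewrite eq_sym => /negbTE ->.
  by rewrite mulr0 mulr0.
by rewrite big1 // => mu _; rewrite delta0 mulr0.
Qed.

Lemma laurentD F G l l' : laurent F l -> laurent G l' ->
  laurent (fun a b => F a b + G a b) (l ++ l').
Proof. by move=> Fl Gl a b a0 b0; rewrite big_cat /= -Fl -?Gl. Qed.

Definition lscale (c : k) l := [seq (c * x.1, x.2) | x <- l].

Lemma laurentZ c F l : laurent F l -> laurent (fun a b => c * F a b) (lscale c l).
Proof.
move=> Fl a b a0 b0; rewrite big_map Fl // mulr_sumr.
by apply: eq_bigr => x _; rewrite mulrA.
Qed.

Definition lmul l l' := [seq (x.1 * y.1, x.2 + y.2) | x <- l, y <- l'].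

Lemma laurentM F G l l' : laurent F l -> laurent G l' ->
  laurent (fun a b => F a b * G a b) (lmul l l').
Proof.
move=> Fl Gl a b a0 b0; rewrite Fl // Gl // big_allpairs_dep mulr_suml.
apply: eq_bigr => x _; rewrite mulr_sumr; apply: eq_bigr => y _ /=.
by rewrite wcharD // mulrACA.
Qed.

Lemma lsum_cat m l l' : lsum m (l ++ l') = lsum m l + lsum m l'.
Proof. by rewrite /lsum big_cat. Qed.

Lemma lsumZ m c l : lsum m (lscale c l) = c * lsum m l.
Proof.
by rewrite /lsum big_map mulr_sumr; apply: eq_bigr => x _; rewrite mulrA.
Qed.

Lemma lsum_inj F l l' m : laurent F l -> laurent F l' -> lsum m l = lsum m l'.
Proof.
move=> Fl Fl'; apply/eqP; rewrite -subr_eq0 -mulN1r -lsumZ -lsum_cat; apply/eqP.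
apply: lsum_eq0 => a b a0 b0.
by rewrite -(laurentD Fl (laurentZ (-1) Fl')) // mulN1r subrr.
Qed.

Lemma laurent_char c mu : laurent (fun a b => c * wchar mu a b) [:: (c, mu)].
Proof. by move=> a b _ _; rewrite big_seq1. Qed.

Lemma regular_torus f : regular f -> exists l, laurent (fun a b => f (torus a b)) l.
Proof.
elim/regular_ind => {f} [f g fg [l fl]|c|f g [l fl] [l' gl]|f g [l fl] [l' gl]|i j].
- by exists l => a b a0 b0; rewrite -fg ?fl //; exact: G2_torus.
- by exists [:: (c, 0)] => a b a0 b0; rewrite big_seq1 wchar0 mulr1.
- by exists (l ++ l'); exact: laurentD.
- by exists (lmul l l'); exact: laurentM.
- exists [:: ((i == j)%:R, nth 0 basis_weights i)] => a b a0 b0.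
  by rewrite big_seq1 !mxE /= mulr_natl.
Qed.

(** The weights of v_0 and v_6 are varpi_alpha and its negative, those of v_0, v_1 add up to
    varpi_beta and those of v_5, v_6 to its negative. So suitable products of diagonal entries
    restrict to any given character. *)
Lemma regular_wchar mu : exists f,
  regular f /\ forall a b, a != 0 -> b != 0 -> f (torus a b) = wchar mu a b.
Proof.
pose e (i : nat) (x : 'M[k]_7) := x (inord i) (inord i).
have eE i a b : (i < 7)%N -> e i (torus a b) = wchar (nth 0 basis_weights i) a b.
  by move=> i7; rewrite /e !mxE eqxx inordK.
have re i : regular (e i) by exact: regular_entry.
pose u (n : int) x := if n is Posz n then e 0%N x ^+ n else e 6 x ^+ `|n|%N.
pose v (n : int) x := if n is Posz n then (e 0%N x * e 1%N x) ^+ n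
  else (e 5 x * e 6 x) ^+ `|n|%N.
have rX g n : regular g -> regular (fun x => g x ^+ n) by move=> ?; exact: regularX.
exists (fun x => u mu.1 x * v mu.2 x); split.
  apply: regularM; [case: mu.1 | case: mu.2] => n /=; apply: regularX => //; exact: regularM.
move=> a b a0 b0; rewrite /wchar; congr (_ * _).
  have H0 : e 0%N (torus a b) = a by rewrite eE // -[LHS]/(a ^+ 1 * 1) mulr1 expr1.
  have H6 : e 6 (torus a b) = a^-1 by rewrite eE // -[LHS]/(a ^- 1 * 1) mulr1 expr1.
  by case: mu.1 => n; rewrite /u ?H0 ?H6 // exprVn.
have H1 : e 0%N (torus a b) * e 1%N (torus a b) = b.
  by rewrite !eE // -wcharD // -[LHS]/(1 * b ^+ 1) mul1r expr1.
have H2 : e 5 (torus a b) * e 6 (torus a b) = b^-1.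
  by rewrite !eE // -wcharD // -[LHS]/(1 * b ^- 1) mul1r expr1.
by case: mu.2 => n; rewrite /v ?H1 ?H2 // exprVn.
Qed.

End Characters.

(** * Weights and divided powers as operators on a rational module *)

Section Functionals.
Variable k : closedFieldType.
Implicit Types (a b t : k) (mu nu : @functional k) (lam eta : weight).
Implicit Types (l : seq (k * weight)) (f : 'M[k]_7 -> k) (m : weight -> k).

Definition linear_on_G2 mu := is_linear mu /\
  forall f1 f2, regular f1 -> regular f2 ->
    (forall g, G2 g -> f1 g = f2 g) -> mu f1 = mu f2.

Lemma linear_on_G2_sum mu (I : finType) (c : I -> k) (F : I -> 'M[k]_7 -> k) :
  linear_on_G2 mu -> (forall i, regular (F i)) ->
  mu (fun x => \sum_i c i * F i x) = \sum_i c i * mu (F i).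
Proof.
move=> [mu_lin mu_ext] rF.
have mu0 : mu (fun=> 0) = 0.
  have := mu_lin 1 _ _ (regular_const (0 : k)) (regular_const 0).
  rewrite [X in _ = X + _]mul1r => E; apply: (@addrI _ (mu (fun=> 0))); rewrite addr0 -[LHS]E.
  apply: mu_ext => [||x _]; rewrite ?mulr0 ?addr0 //; exact: regular_const.
elim: (index_enum I) => [|i s IH].
  rewrite big_nil -[RHS]mu0; apply: mu_ext => [||x _]; rewrite ?big_nil //.
    by apply: regular_sum => i; apply: regularZ.
  exact: regular_const.
have rs : regular (fun x => \sum_(i <- s) c i * F i x).
  by apply: regular_sum => j; apply: regularZ.
rewrite big_cons -IH -mu_lin //; apply: mu_ext => [||x _]; last by rewrite big_cons.
  by apply: regular_sum => j; apply: regularZ.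
by apply: regularD => //; apply: regularZ.
Qed.

(* The functional on k[T] with value m lam on the character lam. *)
Definition wfun m : @functional k := fun f =>
  lsum m (epsilon (inhabits [::]) (laurent (fun a b => f (torus a b)))).

Lemma wfunE m f l : laurent (fun a b => f (torus a b)) l -> wfun m f = lsum m l.
Proof.
move=> fl.
exact: (lsum_inj m (epsilon_spec (inhabits [::]) _ (ex_intro _ l fl)) fl).
Qed.

Lemma wfun_linear m : is_linear (wfun m).
Proof.
move=> c f1 f2 /regular_torus[l1 f1l] /regular_torus[l2 f2l].
have E := laurentD (laurentZ c f1l) f2l.
by rewrite (wfunE _ E) (wfunE _ f1l) (wfunE _ f2l) lsum_cat lsumZ.
Qed.

Lemma wfun_T2 m f1 f2 : regular f1 -> regular f2 ->
  (forall g, T2 g -> f1 g = f2 g) -> wfun m f1 = wfun m f2.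
Proof.
move=> /regular_torus[l1 f1l] /regular_torus[l2 f2l] E.
rewrite (wfunE _ f1l) (wfunE _ f2l); apply: lsum_inj f1l _ => a b a0 b0.
by rewrite E ?f2l //; exists a, b.
Qed.

Lemma T2_G2 (g : 'M[k]_7) : T2 g -> G2 g.
Proof. by move=> [a [b [a0 b0 ->]]]; exact: G2_torus. Qed.

Lemma wfun_on_G2 m : linear_on_G2 (wfun m).
Proof.
split; first exact: wfun_linear.
by move=> f1 f2 r1 r2 E; apply: wfun_T2 => // g /T2_G2; exact: E.
Qed.

Lemma divpowE f gam s n q : (forall t, f (xroot gam s t) = q.[t]) ->
  divpow gam s n f = q`_n.
Proof. by move=> fq; rewrite /divpow (poly_ofE fq). Qed.

(** A function vanishing at 1 restricts to a polynomial in t divisible by t, so a product of n + 1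
    of them has no term in t^n. *)
Lemma divpow_dist gam s n : is_dist (@divpow k gam s n).
Proof.
split.
- move=> c f1 f2 /(regular_xroot gam s)[q1 f1q] /(regular_xroot gam s)[q2 f2q].
  rewrite (@divpowE _ _ _ _ (c *: q1 + q2)) => [|t]; last first.
    by rewrite hornerD hornerZ f1q f2q.
  by rewrite (divpowE _ f1q) (divpowE _ f2q) coefD coefZ.
- move=> f1 f2 /(regular_xroot gam s)[q1 f1q] /(regular_xroot gam s)[q2 f2q] E.
  rewrite (divpowE _ f1q) (@divpowE _ _ _ _ q1) // => t.
  by rewrite -E ?f1q //; exact: G2_xroot.
exists n => f rf.
have [q qE] : exists q : 'I_n.+1 -> {poly k}, forall i, forall t,
    f i (xroot gam s t) = ('X * q i).[t].
  apply: (@fin_all_exists _ (fun=> {poly k})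
    (fun i qi => forall t, f i (xroot gam s t) = ('X * qi).[t])) => i.
  have [ri fi1] := rf i; have [q qE] := regular_xroot gam s ri.
  have /factor_theorem[q' q'E] : root q 0 by rewrite rootE -qE xroot0 fi1.
  by exists q' => t; rewrite qE q'E subr0 mulrC.
rewrite (@divpowE _ _ _ _ (\prod_i ('X * q i))) => [|t].
  rewrite big_split /= prodr_const card_ord coefXnM ltnSn //.
by rewrite horner_prod; apply: eq_bigr => i _; rewrite qE.
Qed.

Lemma dist_on_G2 mu : is_dist mu -> linear_on_G2 mu.
Proof. by case. Qed.

End Functionals.

Section Representations.
Variables (k : closedFieldType) (n : nat) (r : 'M[k]_7 -> 'M[k]_n).
Hypothesis rP : rational r.
Implicit Types (a b t : k) (mu nu : @functional k) (lam eta : weight).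
Implicit Types (y : 'cV[k]_n).

Lemma rep1 : r 1%:M = 1%:M. Proof. by case: rP. Qed.

Lemma repM g h : G2 g -> G2 h -> r (g *m h) = r g *m r h.
Proof. by case: rP => _ + _; apply. Qed.

Lemma rep_regular i j : regular (fun g => r g i j).
Proof. by case: rP => _ _; apply. Qed.

Lemma rep_shift_regular g i j : G2 g -> regular (fun h => r (g *m h) i j).
Proof. by move=> Gg; apply: (regular_shift (f := fun h => r h i j)) => //; exact: rep_regular. Qed.

Lemma dact_deq mu nu : deq mu nu -> dact mu r = dact nu r.
Proof. by move=> E; apply/matrixP => i j; rewrite !mxE E //; exact: rep_regular. Qed.

(** The translation by g makes the notion stable under [dmul], whose inner functional is evaluated
    on such translates. *)
Definition acts_by mu (A : 'M[k]_n) := forall g, G2 g -> forall i j,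
  mu (fun h => r (g *m h) i j) = (r g *m A) i j.

Lemma acts_by_dact mu : linear_on_G2 mu -> acts_by mu (dact mu r).
Proof.
move=> muP g Gg i j; rewrite mxE.
transitivity (mu (fun h => \sum_l r g i l * r h l j)).
  apply: (proj2 muP) => [||h Gh]; first exact: rep_shift_regular.
    by apply: regular_sum => l; apply: regularZ; exact: rep_regular.
  by rewrite repM // mxE.
rewrite linear_on_G2_sum // => [|l]; last exact: rep_regular.
by apply: eq_bigr => l _; rewrite mxE.
Qed.

Lemma acts_byE mu A : acts_by mu A -> dact mu r = A.
Proof.
move=> muA; apply/matrixP => i j; rewrite mxE.
have := muA 1%:M G2_1 i j; rewrite rep1 mul1mx => <-; congr mu.
by apply: functional_extensionality => g; rewrite mul1mx.
Qed.

Lemma acts_by_dmul mu nu A B : linear_on_G2 mu -> acts_by mu A -> acts_by nu B ->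
  acts_by (dmul mu nu) (A *m B).
Proof.
move=> muP muA nuB g Gg i j; rewrite /dmul.
have E h : G2 h -> nu (fun h' => r (g *m (h *m h')) i j) = (r (g *m h) *m B) i j.
  move=> Gh; rewrite -nuB; last exact: G2_M.
  by congr nu; apply: functional_extensionality => h'; rewrite mulmxA.
have rsum : regular (fun h => \sum_l B l j * r (g *m h) i l).
  by apply: regular_sum => l; apply: regularZ; exact: rep_shift_regular.
transitivity (mu (fun h => \sum_l B l j * r (g *m h) i l)).
  apply: (proj2 muP) => // [|h Gh].
    apply: regular_ext rsum => h Gh; rewrite E // mxE.
    by apply: eq_bigr => l _; rewrite mulrC.
  by rewrite E // mxE; apply: eq_bigr => l _; rewrite mulrC.
rewrite linear_on_G2_sum // => [|l]; last exact: rep_shift_regular.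
rewrite mulmxA [RHS]mxE; apply: eq_bigr => l _.
by rewrite mulrC muA.
Qed.

Definition wact (m : weight -> k) : 'M[k]_n := dact (wfun m) r.

(** Each coordinate of r(torus) y has two expansions in characters, one from the matrix entries and
    one from the weight of y; the linear form given by m takes the same value on both. *)
Lemma wact_weight m lam y : weight_vector r lam y -> wact m *m y = m lam *: y.
Proof.
move=> yP; apply/matrixP => i z; rewrite (ord1 z) {z} !mxE.
have [l lP] : exists l : 'I_n -> seq (k * weight), forall j,
    laurent (fun a b => r (torus a b) i j) (l j).
  apply: (@fin_all_exists _ (fun=> seq (k * weight))
    (fun j l => laurent (fun a b => r (torus a b) i j) l)) => j.
  by apply: (@regular_torus _ (fun g => r g i j)); exact: rep_regular.
pose L := flatten [seq lscale (y j 0) (l j) | j <- index_enum 'I_n].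
have LE a b : a != 0 -> b != 0 ->
    \sum_j r (torus a b) i j * y j 0 = \sum_(x <- L) x.1 * wchar x.2 a b.
  move=> a0 b0; rewrite /L; elim: (index_enum _) => [|j s IH] /=; first by rewrite !big_nil.
  rewrite big_cons big_cat /= IH -(laurentZ _ (lP j)) // mulrC //.
have Ll : laurent (fun a b => y i 0 * wchar lam a b) L.
  move=> a b a0 b0; rewrite -LE //.
  by have /matrixP/(_ i 0) := yP a b a0 b0; rewrite !mxE mulrC.
transitivity (lsum m [:: (y i 0, lam)]); last by rewrite /lsum big_seq1 mulrC.
rewrite -(lsum_inj m Ll (@laurent_char k (y i 0) lam)).
rewrite /L /lsum; elim: (index_enum _) => [|j s IH] /=; first by rewrite !big_nil.
rewrite big_cons big_cat /= IH -/(lsum m (lscale _ _)) lsumZ mxE (wfunE _ (lP j)) mulrC //.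
Qed.

Definition wproj lam : 'M[k]_n := wact (fun eta => (eta == lam)%:R).

(** Translation by an element of the torus multiplies the coefficient of each character eta by the
    value of eta, and only the coefficient of lam is counted. *)
Lemma wproj_weight lam y : weight_vector r lam (wproj lam *m y).
Proof.
move=> a b a0 b0; rewrite mulmxA scalemxAl; congr (_ *m _).
apply/matrixP => i j; have Gab := G2_torus a0 b0.
rewrite -(acts_by_dact (wfun_on_G2 _)) // !mxE.
have [l lP] := regular_torus (rep_regular i j).
rewrite (@wfunE _ _ _ [seq (x.1 * wchar x.2 a b, x.2) | x <- l]) => [|c d c0 d0].
  rewrite (wfunE _ lP) /lsum big_map mulr_sumr; apply: eq_bigr => -[c eta] _ /=.
  by case: eqP => [->|]; rewrite ?mulr0 ?mulr1 // mulrC.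
rewrite torusM // lP ?mulf_neq0 // big_map; apply: eq_bigr => x _ /=.
by rewrite -mulrA; congr (_ * _); rewrite /wchar !exprzMl ?unitfE // mulrACA.
Qed.

(** S collects the characters occurring in the entries of r on the torus; evaluation at the neutral
    element shows that the projections add up to 1. *)
Lemma wproj_sum : exists S : seq weight,
  [/\ uniq S, forall lam, lam \notin S -> wproj lam = 0 & \sum_(lam <- S) wproj lam = 1%:M].
Proof.
have [l lP] : exists l : 'I_n * 'I_n -> seq (k * weight), forall ij,
    laurent (fun a b => r (torus a b) ij.1 ij.2) (l ij).
  apply: (@fin_all_exists _ (fun=> seq (k * weight))
    (fun ij l => laurent (fun a b => r (torus a b) ij.1 ij.2) l)) => ij.
  by apply: (@regular_torus _ (fun g => r g ij.1 ij.2)); exact: rep_regular.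
pose S := undup (flatten [seq [seq x.2 | x <- l ij] | ij <- enum {: 'I_n * 'I_n}]).
have SP i j x : x \in l (i, j) -> x.2 \in S.
  move=> xl; rewrite mem_undup; apply/flatten_mapP.
  by exists (i, j); rewrite ?mem_enum ?map_f.
have projE lam i j : wproj lam i j = \sum_(x <- l (i, j)) x.1 * (x.2 == lam)%:R.
  by rewrite mxE (wfunE _ (lP (i, j))).
exists S; split=> [|lam lamS|]; first exact: undup_uniq.
  apply/matrixP => i j; rewrite projE big_seq big1 ?mxE // => x /SP xS.
  by case: eqP xS lamS => [->|]; rewrite ?mulr0 // => ->.
apply/matrixP => i j; rewrite summxE; under eq_bigr do rewrite projE.
have := lP (i, j) 1 1 (oner_neq0 _) (oner_neq0 _).
rewrite /= torus1 rep1 => ->; rewrite exchange_big big_seq [RHS]big_seq.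
apply: eq_bigr => x /SP xS; rewrite /wchar !exp1rz !mulr1.
rewrite (bigD1_seq x.2) ?undup_uniq //= eqxx mulr1 big1 ?addr0 // => eta.
by rewrite eq_sym => /negbTE ->; rewrite mulr0.
Qed.

Lemma weight_decomp y : exists S : seq weight, y = \sum_(lam <- S) wproj lam *m y.
Proof.
have [S [_ _ S1]] := wproj_sum; exists S.
by rewrite -mulmx_suml S1 mul1mx.
Qed.

Lemma eq_on_weights p (A B : 'M[k]_(p, n)) :
  (forall lam y, weight_vector r lam y -> A *m y = B *m y) -> A = B.
Proof.
move=> AB; have [S [_ _ S1]] := wproj_sum.
rewrite -[A]mulmx1 -[B]mulmx1 -S1 !mulmx_sumr; apply: eq_bigr => lam _.
apply/matrixP => i j; have := AB lam _ (wproj_weight lam (delta_mx j 0)).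
rewrite !mulmxA => /matrixP/(_ i 0).
have E (C : 'M[k]_(p, n)) : (C *m (delta_mx j 0 : 'cV_n)) i 0 = C i j.
  by rewrite -colE mxE.
by rewrite !E.
Qed.

Lemma weight_vectorP lam y : weight_vector r lam y <-> wproj lam *m y = y.
Proof.
split=> [yP|<-]; last exact: wproj_weight.
by rewrite /wproj (wact_weight _ yP) eqxx scale1r.
Qed.

Lemma wproj_diff lam eta y : weight_vector r eta y -> eta != lam -> wproj lam *m y = 0.
Proof. by move=> yP /negbTE ne; rewrite /wproj (wact_weight _ yP) ne scale0r. Qed.

Lemma wproj_only lam y : (forall eta, eta != lam -> wproj eta *m y = 0) -> wproj lam *m y = y.
Proof.
move=> y0; have [S [uS S0 S1]] := wproj_sum.
rewrite -[RHS]mul1mx -S1 mulmx_suml.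
have [lS|lS] := boolP (lam \in S); first by rewrite (bigD1_seq lam) //= big1 ?addr0.
rewrite S0 // mul0mx big1_seq // => eta /andP[_ etaS]; apply: y0.
by apply: contraNneq lS => <-.
Qed.

Lemma wproj_eq0 y : (forall lam, wproj lam *m y = 0) -> y = 0.
Proof.
by move=> y0; have [S ->] := weight_decomp y; rewrite big1.
Qed.

Lemma weight_vectorZ lam c y : weight_vector r lam y -> weight_vector r lam (c *: y).
Proof. by move=> yP a b a0 b0; rewrite -scalemxAr yP // !scalerA mulrC. Qed.

Lemma weight_unique lam eta y : weight_vector r lam y -> weight_vector r eta y ->
  y != 0 -> lam = eta.
Proof.
move=> yl ye y0; apply/eqP; apply: contraNT y0 => ne.
by move/weight_vectorP: ye => <-; rewrite (wproj_diff yl ne).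
Qed.

Definition dpow gam s i : 'M[k]_n := dact (divpow gam s i) r.

Lemma rep_xroot gam s : exists N,
  (forall i, (N <= i)%N -> dpow gam s i = 0) /\
  forall t, r (xroot gam s t) = \sum_(i < N) t ^+ i *: dpow gam s i.
Proof.
have [q qP] : exists q : 'I_n * 'I_n -> {poly k}, forall ij,
    forall t, r (xroot gam s t) ij.1 ij.2 = (q ij).[t].
  apply: (@fin_all_exists _ (fun=> {poly k})
    (fun ij q => forall t, r (xroot gam s t) ij.1 ij.2 = q.[t])) => ij.
  by apply: (@regular_xroot _ (fun g => r g ij.1 ij.2)); exact: rep_regular.
have DE i j l : dpow gam s l i j = (q (i, j))`_l.
  by rewrite mxE (divpowE _ (qP (i, j))).
pose N := (\max_ij size (q ij))%N.
have qN ij : (size (q ij) <= N)%N by exact: leq_bigmax.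
exists N; split=> [i Ni|t].
  by apply/matrixP => a b; rewrite DE mxE nth_default // (leq_trans (qN _)).
apply/matrixP => a b; rewrite (qP (a, b)) (horner_coef_wide _ (qN _)) summxE.
by apply: eq_bigr => i _; rewrite mxE DE mulrC.
Qed.

End Representations.

Definition pairing (gam : sroot) (mu : weight) : int :=
  if gam is Ralpha then mu.1 else mu.2.

(** The reflection mu - <mu, gam^vee> gam in the coordinates given by the fundamental weights. *)
Definition refl (gam : sroot) (mu : weight) : weight :=
  if gam is Ralpha then (- mu.1, mu.1 + mu.2) else (mu.1 + mu.2 *+ 3, - mu.2).

Lemma int_mulrn (m : int) i : m *+ i = m * i%:Z.
Proof. by rewrite -mulr_natr natz. Qed.

Lemma weight_mulrn (mu : weight) i : mu *+ i = (mu.1 * i%:Z, mu.2 * i%:Z).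
Proof.
rewrite -!int_mulrn; elim: i => [|i IH]; first by rewrite !mulr0n.
by rewrite !mulrS IH.
Qed.

Lemma root_weight_inj gam s i j :
  root_weight gam s *+ i = root_weight gam s *+ j -> i = j.
Proof.
rewrite !weight_mulrn => -[+ _].
by case: gam s => [] [] /=; lia.
Qed.

(** * Commutation rules of the divided powers *)

Section Operators.
Variables (k : closedFieldType) (n : nat) (r : 'M[k]_7 -> 'M[k]_n).
Hypothesis rP : rational r.
Implicit Types (a b t : k) (lam eta mu : weight) (y : 'cV[k]_n).
Implicit Types (gam : sroot) (s : bool).

Local Notation E gam := (dpow r gam true).
Local Notation F gam := (dpow r gam false).

Lemma sum_widen p q (C : nat -> 'M[k]_(p, q)) K L t :
  (forall i, (K <= i)%N -> C i = 0) -> (K <= L)%N ->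
  \sum_(i < L) t ^+ i *: C i = \sum_(i < K) t ^+ i *: C i.
Proof.
move=> CK KL; rewrite -(big_mkord xpredT (fun i => t ^+ i *: C i)) (big_cat_nat (n := K)) //=.
rewrite big_mkord [X in _ + X]big1_seq ?addr0 // => j.
by rewrite mem_index_iota /= => /andP[Kj _]; rewrite CK // scaler0.
Qed.

Lemma rep_xroot_wide gam s : exists N,
  (forall i, (N <= i)%N -> dpow r gam s i = 0) /\
  forall M t, (N <= M)%N -> r (xroot gam s t) = \sum_(i < M) t ^+ i *: dpow r gam s i.
Proof.
have [N [DN XN]] := rep_xroot rP gam s; exists N; split=> // M t NM.
by rewrite (sum_widen _ DN NM).
Qed.

Lemma dpow0 gam s : dpow r gam s 0 = 1%:M.
Proof.
have [N [DN XN]] := rep_xroot_wide gam s.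
have := XN N.+1 0 (leqnSn _); rewrite xroot0 (rep1 rP) // big_ord_recl expr0 scale1r.
by rewrite big1 ?addr0 // => i _; rewrite exprS mul0r scale0r.
Qed.

Lemma xroot_fixed gam s y : (forall i, (0 < i)%N -> dpow r gam s i *m y = 0) ->
  forall t, r (xroot gam s t) *m y = y.
Proof.
move=> y0 t; have [N [DN XN]] := rep_xroot_wide gam s.
rewrite (XN N.+1) // mulmx_suml big_ord_recl expr0 scale1r dpow0 mul1mx.
by rewrite big1 ?addr0 // => i _; rewrite -scalemxAl y0 // scaler0.
Qed.

Lemma fixed_dpow gam s y : (forall t, r (xroot gam s t) *m y = y) ->
  forall i, (0 < i)%N -> dpow r gam s i *m y = 0.
Proof.
move=> fix_y i i0; have [N [DN XN]] := rep_xroot_wide gam s.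
have H := @mx_poly_inj k n 1 N 1 (fun i => dpow r gam s i *m y)
  (fun i => if i is 0 then y else 0) [::].
rewrite H => [|j|j|t _]; first by case: i i0.
- by move=> /DN ->; rewrite mul0mx.
- by case: j.
- rewrite big_ord_recl big_ord0 addr0 expr0 scale1r -[RHS](fix_y t) (XN N t) //.
  by rewrite mulmx_suml; apply: eq_bigr => l _; rewrite scalemxAl.
Qed.

Lemma wchar_mulrn mu i a b : a != 0 -> b != 0 -> wchar (mu *+ i) a b = wchar mu a b ^+ i.
Proof.
move=> a0 b0; elim: i => [|i IH]; first by rewrite mulr0n wchar0 expr0.
by rewrite mulrS wcharD // IH exprS.
Qed.

(** Compares the coefficients of t^i in [torus_xroot], where conjugation by the torus rescales t by
    the root. *)
Lemma dpow_weight gam s i mu y : weight_vector r mu y ->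
  weight_vector r (mu + root_weight gam s *+ i) (dpow r gam s i *m y).
Proof.
move=> yP a b a0 b0; have [N [DN XN]] := rep_xroot_wide gam s.
have Gab := G2_torus a0 b0.
pose chi := wchar (root_weight gam s) a b.
have H := @mx_poly_inj k n 1 N N (fun i => r (torus a b) *m (dpow r gam s i *m y))
  (fun i => (wchar mu a b * chi ^+ i) *: (dpow r gam s i *m y)) [::].
rewrite H => [|j|j|t _].
- by rewrite wcharD // wchar_mulrn.
- by move=> /DN ->; rewrite mul0mx mulmx0.
- by move=> /DN ->; rewrite mul0mx scaler0.
transitivity (r (torus a b *m xroot gam s t) *m y).
  rewrite (repM rP) //; last exact: G2_xroot.
  rewrite (XN N) // -mulmxA mulmx_suml mulmx_sumr; apply: eq_bigr => j _.
  by rewrite -scalemxAl -scalemxAr.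
rewrite torus_xroot // (repM rP) //; last exact: G2_xroot.
rewrite -mulmxA yP // -scalemxAr (XN N) // mulmx_suml scaler_sumr.
apply: eq_bigr => j _; rewrite -scalemxAl !scalerA exprMn -/chi; congr (_ *: _).
by ring.
Qed.

Lemma dpow_comm gam i j :
  E gam i *m F (other_root gam) j = F (other_root gam) j *m E gam i.
Proof.
have [N [DN XN]] := rep_xroot_wide gam true.
have [M [D'M XM]] := rep_xroot_wide (other_root gam) false.
have H u : E gam i *m r (xroot (other_root gam) false u) =
           r (xroot (other_root gam) false u) *m E gam i.
  apply: (@mx_poly_inj k n n N N (fun i => E gam i *m r (xroot (other_root gam) false u))
    (fun i => r (xroot (other_root gam) false u) *m E gam i) [::]) => [l|l|t _].
  - by move=> /DN ->; rewrite mul0mx.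
  - by move=> /DN ->; rewrite mulmx0.
  have := xroot_comm gam t u.
  move=> /(congr1 r); rewrite !(repM rP); do ?exact: G2_xroot.
  rewrite (XN N) // mulmx_suml mulmx_sumr => H.
  under eq_bigr do rewrite scalemxAl; rewrite H; apply: eq_bigr => l _.
  by rewrite scalemxAr.
have H2 := @mx_poly_inj k n n M M (fun j => E gam i *m F (other_root gam) j)
    (fun j => F (other_root gam) j *m E gam i) [::].
apply: H2 => [l|l|t _].
- by move=> /D'M ->; rewrite mulmx0.
- by move=> /D'M ->; rewrite mul0mx.
have := H t; rewrite (XM M) // mulmx_suml mulmx_sumr => {}H.
under eq_bigr do rewrite scalemxAr; rewrite H; apply: eq_bigr => l _.
by rewrite scalemxAl.
Qed.

(** Differentiate x(t + u) = x(t) x(u) with respect to t at t = 0, and compare the coefficients of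
    u^i. *)
Lemma dpow1M gam s i : dpow r gam s 1 *m dpow r gam s i = i.+1%:R *: dpow r gam s i.+1.
Proof.
apply/matrixP => a b.
have [P PE] : exists P : 'I_n -> {poly k}, forall c t, r (xroot gam s t) c b = (P c).[t].
  apply: (@fin_all_exists _ (fun=> {poly k})
    (fun c q => forall t, r (xroot gam s t) c b = q.[t])) => c.
  by apply: (@regular_xroot _ (fun g => r g c b)); exact: rep_regular.
have DE c l : dpow r gam s l c b = (P c)`_l by rewrite mxE (divpowE _ (PE c)).
have H : \sum_c dpow r gam s 1 a c *: P c = (P a)^`().
  apply/eqP; rewrite -subr_eq0; apply/eqP; apply: (@poly_eq0_cofinite _ _ [::]) => u _.
  apply/eqP; rewrite hornerD hornerN subr_eq0; apply/eqP.
  have [q qE] : exists q : 'I_n -> {poly k}, forall c t, r (xroot gam s t) a c = (q c).[t].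
    apply: (@fin_all_exists _ (fun=> {poly k})
      (fun c q => forall t, r (xroot gam s t) a c = q.[t])) => c.
    by apply: (@regular_xroot _ (fun g => r g a c)); exact: rep_regular.
  have qP : \sum_c (P c).[u] *: q c = P a \Po ('X + u%:P).
    apply/eqP; rewrite -subr_eq0; apply/eqP; apply: (@poly_eq0_cofinite _ _ [::]) => t _.
    apply/eqP; rewrite hornerD hornerN subr_eq0; apply/eqP.
    rewrite horner_comp !hornerE -PE xrootD (repM rP); try exact: G2_xroot.
    rewrite mxE horner_sum; apply: eq_bigr => c _.
    by rewrite hornerZ -PE -qE mulrC.
  have := congr1 (fun p => p^`().[0]) qP.
  rewrite deriv_comp derivD derivX derivC addr0 mulr1 horner_comp !hornerE => <-.
  rewrite linear_sum !horner_sum; apply: eq_bigr => c _.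
  rewrite /= derivZ !hornerZ mulrC horner_coef0 coef_deriv mulr1n; congr (_ * _).
  by rewrite mxE (divpowE _ (qE c)).
move/polyP/(_ i): H; rewrite coef_deriv coef_sum !mxE (divpowE _ (PE a)) mulr_natl => <-.
by apply: eq_bigr => c _; rewrite coefZ DE.
Qed.

Lemma dpow_fact gam s y i : dpow r gam s 1 *m y = 0 -> (0 < i)%N ->
  i`!%:R *: (dpow r gam s i *m y) = 0.
Proof.
move=> y0; case: i => // i _; elim: i => [|i IH]; first by rewrite y0 scaler0.
rewrite factS mulnC natrM -scalerA scalemxAl -dpow1M -mulmxA scalemxAr.
by rewrite IH mulmx0.
Qed.

Lemma rep_xrootV gam s t : r (xroot gam s (- t)) *m r (xroot gam s t) = 1%:M.
Proof.
by rewrite -(repM rP); [rewrite -xrootD addNr xroot0 (rep1 rP) | exact: G2_xroot | exact: G2_xroot].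
Qed.

Lemma coroot_weight gam t mu y : t != 0 -> weight_vector r mu y ->
  r (coroot gam t) *m y = t ^ pairing gam mu *: y.
Proof.
move=> t0 yP; rewrite /coroot.
by case: gam => /=; rewrite yP ?oner_neq0 // /wchar exp1rz ?mulr1 ?mul1r.
Qed.

Lemma pairing_root gam mu i : pairing gam (mu + root_weight gam true *+ i) =
  pairing gam mu + (i.*2)%:Z.
Proof.
by rewrite weight_mulrn; case: gam; rewrite /pairing /=; lia.
Qed.

(* Comparing the coefficients in
   x_gam(t) x_-gam(1) y = x_-gam(1/(1+t)) gam^vee(1+t) x_gam(t/(1+t)) y,
   after projection to the weight space of E^(a) F^(b) y. *)
Lemma dpow_EF gam mu y (a b e : nat) : weight_vector r mu y ->
  pairing gam mu + a%:Z = e%:Z + b%:Z ->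
  E gam a *m (F gam b *m y) =
  \sum_(j < a.+1) 'C(e, j)%:R *:
     (if (j <= b)%N then F gam (b - j) *m (E gam (a - j) *m y) else 0).
Proof.
move=> yP eE; have [N [EN XEN]] := rep_xroot_wide gam true.
have [M [FM XFM]] := rep_xroot_wide gam false.
(* The weight of E^(a) F^(b) y. Among the E^(i) F^(l) y it singles out those with l = i + b - a; the
   case distinctions in [U] and [V] guard this subtraction of natural numbers. *)
pose nu := mu + root_weight gam true *+ a + root_weight gam false *+ b.
pose U i := if (a <= i + b)%N then E gam i *m (F gam (i + b - a) *m y) else 0.
pose V i := if (a <= i + b)%N then F gam (i + b - a) *m (E gam i *m y) else 0.
have gN : root_weight gam false = - root_weight gam true by [].
have nuE i l : (mu + root_weight gam true *+ i + root_weight gam false *+ l == nu) =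
    (i + b == l + a)%N.
  rewrite /nu !gN !mulNrn -!addrA (inj_eq (addrI mu)).
  rewrite subr_eq -addrA [_ *- b + _]addrC addrA -subr_eq opprK -!mulrnDr.
  apply/eqP/eqP => [/root_weight_inj|]; first by rewrite [(l + a)%N]addnC.
  by rewrite [(l + a)%N]addnC => ->.
have UE i : wproj r nu *m (E gam i *m (r (xroot gam false 1) *m y)) = U i.
  rewrite (XFM (M + i + b)%N) ?mulmx_suml ?mulmx_sumr; last by rewrite -addnA leq_addr.
  have W l : weight_vector r (mu + root_weight gam true *+ i + root_weight gam false *+ l)
      (E gam i *m (F gam l *m y)).
    by rewrite addrAC; apply: dpow_weight; exact: dpow_weight.
  rewrite /U; case: ifP => ai; last first.
    rewrite big1 // => l _; rewrite expr1n scale1r (wproj_diff rP (W l)) // nuE.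
    by apply: contraFneq ai => il; rewrite il leq_addl.
  have lt : (i + b - a < M + i + b)%N \/ (M <= i + b - a)%N by lia.
  have off l : (l != i + b - a)%N -> wproj r nu *m (E gam i *m (F gam l *m y)) = 0.
    move=> l_ne; rewrite (wproj_diff rP (W l)) // nuE.
    by apply: contra l_ne => /eqP H; apply/eqP; lia.
  have on : wproj r nu *m (E gam i *m (F gam (i + b - a) *m y)) =
      E gam i *m (F gam (i + b - a) *m y).
    apply/weight_vectorP => //; have := W (i + b - a)%N.
    by have /eqP -> : mu + root_weight gam true *+ i + root_weight gam false *+ (i + b - a) == nu
      by rewrite nuE subnK.
  case: lt => lt.
    rewrite (bigD1 (Ordinal lt)) //= expr1n scale1r on big1 ?addr0 // => l.
    by rewrite -val_eqE /= expr1n scale1r; exact: off.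
  rewrite (FM _ lt) mul0mx mulmx0 big1 // => l _; rewrite expr1n scale1r.
  have [->|] := eqVneq (l : nat) (i + b - a)%N; last exact: off.
  by rewrite (FM _ lt) mul0mx !mulmx0.
have VE i u : wproj r nu *m (r (xroot gam false u) *m (E gam i *m y)) =
    u ^+ (i + b - a) *: V i.
  rewrite (XFM (M + i + b)%N) ?mulmx_suml ?mulmx_sumr; last by rewrite -addnA leq_addr.
  have W l : weight_vector r (mu + root_weight gam true *+ i + root_weight gam false *+ l)
      (F gam l *m (E gam i *m y)).
    by apply: dpow_weight; exact: dpow_weight.
  rewrite /V; case: ifP => ai; last first.
    rewrite scaler0 big1 // => l _; rewrite -scalemxAl -scalemxAr (wproj_diff rP (W l)) ?scaler0 // nuE.
    by apply: contraFneq ai => il; rewrite il leq_addl.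
  have lt : (i + b - a < M + i + b)%N \/ (M <= i + b - a)%N by lia.
  have off l : (l != i + b - a)%N -> wproj r nu *m (F gam l *m (E gam i *m y)) = 0.
    move=> l_ne; rewrite (wproj_diff rP (W l)) // nuE.
    by apply: contra l_ne => /eqP H; apply/eqP; lia.
  have on : wproj r nu *m (F gam (i + b - a) *m (E gam i *m y)) =
      F gam (i + b - a) *m (E gam i *m y).
    apply/weight_vectorP => //; have := W (i + b - a)%N.
    by have /eqP -> : mu + root_weight gam true *+ i + root_weight gam false *+ (i + b - a) == nu
      by rewrite nuE subnK.
  case: lt => lt.
    rewrite (bigD1 (Ordinal lt)) //= -scalemxAl -scalemxAr on big1 ?addr0 // => l.
    by rewrite -val_eqE /= -scalemxAl -scalemxAr => /off ->; rewrite scaler0.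
  rewrite (FM _ lt) mul0mx scaler0 big1 // => l _; rewrite -scalemxAl -scalemxAr.
  have [->|/off ->] := eqVneq (l : nat) (i + b - a)%N; last by rewrite scaler0.
  by rewrite (FM _ lt) mul0mx mulmx0 scaler0.
have UV t : t \notin [:: -1] ->
    \sum_(i < N) t ^+ i *: U i = (1 + t) ^+ e *: \sum_(i < N) t ^+ i *: V i.
  rewrite inE => t1.
  have d0 : 1 + t != 0 by rewrite addrC -[1]opprK subr_eq0.
  have R1 := xroot_rank1 gam (t := t) (u := 1); rewrite !mulr1 in R1.
  have {R1} := congr1 (fun g => wproj r nu *m (r g *m y)) (R1 d0).
  have GX s u : G2 (xroot gam s u) by exact: G2_xroot.
  have GH := G2_coroot gam d0.
  rewrite !(repM rP) //; last exact: G2_M.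
  rewrite -!mulmxA (XEN N _ (leqnn _)) mulmx_suml mulmx_sumr => L.
  transitivity (\sum_(i < N) wproj r nu *m ((t ^+ i *: E gam i) *m (r (xroot gam false 1) *m y))).
    by apply: eq_bigr => i _; rewrite -scalemxAl -scalemxAr UE.
  rewrite {}L (XEN N _ (leqnn _)) mulmx_suml !mulmx_sumr scaler_sumr; apply: eq_bigr => i _.
  rewrite -scalemxAl -!scalemxAr (coroot_weight _ d0 (dpow_weight gam true i yP)).
  rewrite -!scalemxAr VE !scalerA pairing_root.
  have [ai|ai] := leqP a (i + b)%N; last by rewrite /V leqNgt ai !scaler0.
  congr (_ *: _); rewrite expr_div_n div1r exprVn.
  (* The three factors stem from the parameter t/(1+t), the coroot and the parameter 1/(1+t). Their
     exponents -i, <mu, gam^vee> + 2 i and -(i + b - a) add up to e, whatever i is. *)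
  have -> : (1 + t) ^+ e =
      (1 + t) ^- i * (1 + t) ^ (pairing gam mu + i.*2) * (1 + t) ^- (i + b - a).
    by rewrite !exprnN -!expfzDr // exprnP; congr (_ ^ _); lia.
  by rewrite [RHS]mulrC !mulrA.
(* The coefficient of t^a in [UV]; as e is a natural number, (1 + t)^e is a polynomial with binomial
   coefficients. *)
have UVa : U a = \sum_(j < a.+1) 'C(e, j)%:R *: V (a - j)%N.
  apply/matrixP => c z; rewrite (ord1 z) {z}.
  pose PU := \poly_(i < N) U i c 0; pose PV := \poly_(i < N) V i c 0.
  have PUE i : PU`_i = U i c 0.
    rewrite coef_poly; case: ltnP => // /EN Ei; rewrite /U Ei mul0mx.
    by case: ifP; rewrite mxE.
  have PVE i : PV`_i = V i c 0.
    rewrite coef_poly; case: ltnP => // /EN Ei; rewrite /V Ei mul0mx mulmx0.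
    by case: ifP; rewrite mxE.
  have binE : ('X + 1) ^+ e = \poly_(i < e.+1) 'C(e, i)%:R :> {poly k}.
    rewrite exprD1n poly_def; apply: eq_bigr => i _.
    by rewrite scaler_nat.
  have PUV : PU = ('X + 1) ^+ e * PV.
    apply/eqP; rewrite -subr_eq0; apply/eqP; apply: (@poly_eq0_cofinite _ _ [:: -1]) => t t1.
    have ev (W : nat -> 'cV[k]_n) : (\poly_(i < N) W i c 0).[t] =
        (\sum_(i < N) t ^+ i *: W i) c 0.
      by rewrite horner_poly summxE; apply: eq_bigr => i _; rewrite mxE mulrC.
    rewrite hornerD hornerN hornerM !ev UV // mxE horner_exp !hornerE.
    by rewrite [t + 1]addrC subrr.
  rewrite -PUE PUV coefM summxE; apply: eq_bigr => j _.
  rewrite PVE mxE binE coef_poly ltnS; case: leqP => // /bin_small ->.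
  by rewrite mul0r.
have : U a = E gam a *m (F gam b *m y) by rewrite /U leq_addr addKn.
move=> <-; rewrite UVa; apply: eq_bigr => j _; congr (_ *: _); rewrite /V.
have ja : (j <= a)%N by rewrite -ltnS.
have -> : (a <= a - j + b)%N = (j <= b)%N by lia.
by have -> : (a - j + b - a = b - j)%N by lia.
Qed.
End Operators.

(** * Submodules generated by primitive vectors *)

Lemma weight_leP mu lam : weight_le mu lam <-> exists i j : nat,
  lam.1 = mu.1 + 2%:Z * i%:Z - 3%:Z * j%:Z /\ lam.2 = mu.2 - i%:Z + 2%:Z * j%:Z.
Proof.
split=> -[i [j]].
  by rewrite !weight_mulrn => ->; exists i, j; split; rewrite /=; lia.
case: lam mu => [l1 l2] [m1 m2] [/= -> ->]; exists i, j.
by rewrite !weight_mulrn; congr (_, _); rewrite /=; lia.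
Qed.

Lemma weight_le_trans mu nu lam : weight_le mu nu -> weight_le nu lam -> weight_le mu lam.
Proof.
move=> /weight_leP[i [j [H1 H2]]] /weight_leP[i' [j' [H3 H4]]].
by apply/weight_leP; exists (i + i')%N, (j + j')%N; split; lia.
Qed.

Lemma weight_le_anti mu lam : weight_le mu lam -> weight_le lam mu -> mu = lam.
Proof.
move=> /weight_leP[i [j [H1 H2]]] /weight_leP[i' [j' [H3 H4]]].
by case: mu lam H1 H2 H3 H4 => [m1 m2] [l1 l2] /= *; congr (_, _); lia.
Qed.

Lemma weight_le_refl mu : weight_le mu mu.
Proof. by exists 0%N, 0%N; rewrite !mulr0n !addr0. Qed.

Lemma weight_le_root mu gam i : weight_le mu (mu + root_weight gam true *+ i).
Proof.
case: gam; first by exists i, 0%N; rewrite mulr0n addr0.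
by exists 0%N, i; rewrite mulr0n addr0.
Qed.

Lemma weight_lt_root mu gam i : (0 < i)%N -> ~ weight_le (mu + root_weight gam true *+ i) mu.
Proof.
move=> i0 H; have := weight_le_anti (weight_le_root mu gam i) H.
by rewrite -[LHS]addr0 => /addrI /esym /(@root_weight_inj _ _ i 0) E; rewrite E in i0.
Qed.

(** The linear form equal to 1 on both simple roots: 3 * 2 - 5 = 1 and - 3 * 3 + 5 * 2 = 1. *)
Definition height (mu : weight) : int := 3%:Z * mu.1 + 5%:Z * mu.2.

Lemma height_root mu gam i : height (mu + root_weight gam true *+ i) = height mu + i%:Z.
Proof.
by rewrite weight_mulrn /height; case: gam => /=; lia.
Qed.

Lemma root_weightN gam : root_weight gam false = - root_weight gam true.
Proof. by []. Qed.

Section Spans.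
Variables (k : fieldType) (n : nat).
Implicit Types (W : {vspace 'cV[k]_n}) (y : 'cV[k]_n).

(** The span of a possibly infinite set is that of a finite subset whose span has maximal dimension;
    classical logic decides which dimensions occur. *)
Lemma span_pred (P : 'cV[k]_n -> Prop) : exists V : {vspace 'cV[k]_n},
  (forall y, P y -> y \in V) /\
  (forall y, y \in V -> exists2 s : seq 'cV[k]_n, (forall z, z \in s -> P z) & y \in <<s>>%VS).
Proof.
pose Q d := exists2 s : seq 'cV[k]_n, (forall z, z \in s -> P z) & \dim <<s>>%VS = d.
pose q d : bool := excluded_middle_informative (Q d).
have qP d : reflect (Q d) (q d) by rewrite /q; case: excluded_middle_informative => ?; constructor.
have ex : exists d, q d by exists 0%N; apply/qP; exists [::]; rewrite // span_nil dimv0.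
have bnd d : q d -> (d <= \dim {: 'cV[k]_n})%N by move=> /qP[s _ <-]; rewrite dimvS ?subvf.
case: (ex_maxnP ex bnd) => d /qP[s sP sd] max_d.
exists <<s>>%VS; split=> [y Py|y ys]; last by exists s.
have : (<<s>> <= <<y :: s>>)%VS by apply: sub_span => z zs; rewrite inE zs orbT.
move=> sub; have /eqP E : <<s>>%VS == <<y :: s>>%VS.
  rewrite eqEdim sub sd; apply: max_d; apply/qP; exists (y :: s) => // z.
  by rewrite inE => /orP[/eqP -> //|/sP].
by rewrite E memv_span ?mem_head.
Qed.

Lemma span_ind (P : 'cV[k]_n -> Prop) (s : seq 'cV[k]_n) :
  P 0 -> (forall c y z, P y -> P z -> P (c *: y + z)) ->
  (forall y, y \in s -> P y) -> forall y, y \in <<s>>%VS -> P y.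
Proof.
move=> P0 PD Ps y ys; have /coord_span -> : y \in <<in_tuple s>>%VS by [].
elim: (index_enum _) => [|i r IH]; first by rewrite big_nil.
by rewrite big_cons; apply: PD => //; apply: Ps; rewrite mem_nth.
Qed.

Lemma memv_projE W y : (y \in W) = (projv W y == y).
Proof. by apply/idP/eqP => [/projv_id //|<-]; rewrite memv_proj. Qed.

End Spans.

Section SubModules.
Variables (k : closedFieldType) (n : nat) (r : 'M[k]_7 -> 'M[k]_n).
Hypothesis rP : rational r.
Implicit Types (a b t : k) (lam eta mu : weight) (y : 'cV[k]_n).
Implicit Types (gam : sroot) (s : bool) (W V : {vspace 'cV[k]_n}).

Local Notation E gam := (dpow r gam true).
Local Notation F gam := (dpow r gam false).

(** Membership in W is the vanishing of the linear map [projv W] - 1, so the coefficients of a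
    polynomial curve that lies in W for almost all t lie in W. *)
Lemma memv_curve W (C : nat -> 'cV[k]_n) N (s : seq k) :
  (forall t, t \notin s -> \sum_(i < N) t ^+ i *: C i \in W) ->
  forall i, (i < N)%N -> C i \in W.
Proof.
move=> CW i iN; rewrite memv_projE -subr_eq0; apply/eqP.
apply: (@mx_poly_eq0 k n 1 N (fun i => projv W (C i) - C i) s) => // t /CW.
rewrite memv_projE -subr_eq0 linear_sum -sumrB => /eqP H.
by rewrite -[RHS]H; apply: eq_bigr => j _; rewrite linearZ scalerBr.
Qed.

Lemma wchar_coeff_eq0 p q (S : seq weight) (C : weight -> 'M[k]_(p, q)) : uniq S ->
  (forall a b, a != 0 -> b != 0 -> \sum_(lam <- S) wchar lam a b *: C lam = 0) ->
  forall lam, lam \in S -> C lam = 0.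
Proof.
move=> uS S0 lam lamS; apply/matrixP => i j; rewrite mxE.
have L : laurent (fun _ _ => 0) [seq (C eta i j, eta) | eta <- S].
  move=> a b a0 b0; have /matrixP/(_ i j) := S0 a b a0 b0.
  rewrite summxE mxE big_map => H; rewrite -[LHS]H; apply: eq_bigr => eta _.
  by rewrite mxE mulrC.
have := lsum_eq0 L (fun eta => (eta == lam)%:R).
rewrite /lsum big_map (bigD1_seq lam) //= eqxx mulr1 big1 ?addr0 // => eta /negbTE ->.
by rewrite mulr0.
Qed.

Lemma submod_gen W :
  (forall gam s t y, y \in W -> r (xroot gam s t) *m y \in W) -> submod r W.
Proof.
move=> WX g y Gg; elim: Gg y => [|g1 g2 G1 IH1 G2' IH2|gam s t] y yW.
- by rewrite rep1 // mul1mx.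
- by rewrite repM // -mulmxA; apply: IH1; exact: IH2.
- exact: WX.
Qed.

Lemma submod_dpow W gam s i y : submod r W -> y \in W -> dpow r gam s i *m y \in W.
Proof.
move=> WG yW; have [N [DN XN]] := rep_xroot_wide rP gam s.
have [iN|Ni] := ltnP i N; last by rewrite DN // mul0mx mem0v.
apply: (@memv_curve W (fun i => dpow r gam s i *m y) N [::]) => // t _.
have -> : \sum_(i < N) t ^+ i *: (dpow r gam s i *m y) = r (xroot gam s t) *m y.
  by rewrite (XN N) // mulmx_suml; apply: eq_bigr => j _; rewrite scalemxAl.
by apply: WG => //; exact: G2_xroot.
Qed.

Lemma torus_decomp (S : seq weight) a b : a != 0 -> b != 0 ->
  \sum_(lam <- S) wproj r lam = 1%:M ->
  r (torus a b) = \sum_(lam <- S) wchar lam a b *: wproj r lam.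
Proof.
move=> a0 b0 S1; rewrite -[LHS]mulmx1 -S1 mulmx_sumr; apply: eq_bigr => lam _.
apply/matrixP => i j.
have /matrixP/(_ i 0) := @wproj_weight _ _ _ rP lam (delta_mx j 0) a b a0 b0.
by rewrite mulmxA scalemxAl -!colE !mxE.
Qed.

Lemma torus_stable_wproj W lam y :
  (forall a b, a != 0 -> b != 0 -> r (torus a b) *m y \in W) -> wproj r lam *m y \in W.
Proof.
move=> Wy; have [S [uS S0 S1]] := wproj_sum rP.
have [lamS|/S0 ->] := boolP (lam \in S); last by rewrite mul0mx mem0v.
rewrite memv_projE -subr_eq0; apply/eqP.
apply: (@wchar_coeff_eq0 n 1 S (fun eta => projv W (wproj r eta *m y) - wproj r eta *m y)) => //.
move=> a b a0 b0; have := Wy a b a0 b0.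
rewrite (torus_decomp a0 b0 S1) mulmx_suml memv_projE -subr_eq0 linear_sum -sumrB => /eqP H.
by rewrite -[RHS]H; apply: eq_bigr => j _; rewrite -scalemxAl linearZ scalerBr.
Qed.

Lemma submod_wproj W lam y : submod r W -> y \in W -> wproj r lam *m y \in W.
Proof.
move=> WG yW; apply: torus_stable_wproj => a b a0 b0.
by apply: WG => //; exact: G2_torus.
Qed.

Lemma wproj_dpow lam gam s i :
  wproj r (lam + root_weight gam s *+ i) *m dpow r gam s i = dpow r gam s i *m wproj r lam.
Proof.
apply: (eq_on_weights rP) => eta y yP; rewrite -!mulmxA.
have yP' := dpow_weight rP gam s i yP.
have [eq|ne] := eqVneq eta lam.
  rewrite eq in yP yP'; rewrite (proj1 (weight_vectorP rP _ _) yP).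
  by rewrite (proj1 (weight_vectorP rP _ _) yP').
rewrite (wproj_diff rP yP) // mulmx0 (wproj_diff rP yP') //.
by apply: contra ne => /eqP/addIr/eqP.
Qed.

Definition upper_fixed y := forall gam t, r (xroot gam true t) *m y = y.

Lemma upper_fixedP y :
  upper_fixed y <-> forall gam i, (0 < i)%N -> E gam i *m y = 0.
Proof.
split=> H gam; first exact: (fixed_dpow rP (H gam)).
exact: (xroot_fixed rP (H gam)).
Qed.

Lemma upper_fixed_wproj lam y : upper_fixed y -> upper_fixed (wproj r lam *m y).
Proof.
move=> /upper_fixedP yU; apply/upper_fixedP => gam i i0.
by rewrite mulmxA -wproj_dpow -mulmxA yU // mulmx0.
Qed.

(** Scalars are included so that, for a weight vector u, this set of translates is stable under the
    torus. *)
Inductive lower_orbit (u : 'cV[k]_n) : 'cV[k]_n -> Prop :=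
| lower_orbit_base : lower_orbit u u
| lower_orbit_scale c y : lower_orbit u y -> lower_orbit u (c *: y)
| lower_orbit_xroot gam t y :
    lower_orbit u y -> lower_orbit u (r (xroot gam false t) *m y).

Lemma lower_orbit_torus mu u y a b : a != 0 -> b != 0 -> weight_vector r mu u ->
  lower_orbit u y -> lower_orbit u (r (torus a b) *m y).
Proof.
move=> a0 b0 uP; elim=> [|c {}y _ IH|gam t {}y _ IH].
- by rewrite uP //; apply: lower_orbit_scale; exact: lower_orbit_base.
- by rewrite -scalemxAr; exact: lower_orbit_scale.
rewrite mulmxA -repM //; [|exact: G2_torus|exact: G2_xroot].
rewrite torus_xroot // repM //; [|exact: G2_xroot|exact: G2_torus].
by rewrite -mulmxA; exact: lower_orbit_xroot.
Qed.

Lemma highest_weight_span mu u : weight_vector r mu u -> upper_fixed u ->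
  exists V, [/\ submod r V, u \in V, forall W, submod r W -> u \in W -> (V <= W)%VS &
    forall nu y, y \in V -> weight_vector r nu y -> y != 0 ->
      weight_le nu mu /\ (nu = mu -> exists c, y = c *: u)].
Proof.
move=> uP uU; have [V [VP PV]] := span_pred (lower_orbit u).
have stab (A : 'M[k]_n) : (forall y, lower_orbit u y -> A *m y \in V) ->
    forall y, y \in V -> A *m y \in V.
  move=> AV y /PV[s sP ys].
  apply: (@span_ind _ _ (fun z => A *m z \in V) s _ _ _ y ys) => [|c {ys}y z yV zV|z /sP]; last exact: AV.
    by rewrite mulmx0 mem0v.
  by rewrite mulmxDr -scalemxAr memvD // memvZ.
have lowV gam t y : y \in V -> r (xroot gam false t) *m y \in V.
  by apply: stab => {}y uy; apply: VP; exact: lower_orbit_xroot.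
have torV gam t y : t != 0 -> y \in V -> r (coroot gam t) *m y \in V.
  move=> t0; apply: stab => {}y uy; apply: VP.
  by case: gam; apply: (lower_orbit_torus _ _ uP) => //; exact: oner_neq0.
have upO y : lower_orbit u y -> forall gam t, r (xroot gam true t) *m y \in V.
  elim=> [|c {}y _ IH|del x {}y _ IH] gam t.
  - by rewrite uU; apply: VP; exact: lower_orbit_base.
  - by rewrite -scalemxAr memvZ.
  have GX g s x' : G2 (xroot g s x' : 'M[k]_7) by exact: G2_xroot.
  (* The excluded value is the one where 1 + t' x vanishes. For x = 0 it reads t' = 0, which does no
     harm, since [memv_curve] allows finitely many exceptions; the coefficients then lie in V, and
     with them the curve at every t. *)
  have good t' : t' \notin [:: - x^-1] ->
      r (xroot gam true t') *m (r (xroot del false x) *m y) \in V.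
    rewrite inE => t'x; rewrite mulmxA -repM //.
    have [-> | ->] : del = gam \/ del = other_root gam by case: (del) (gam) => [] []; [left|right|right|left].
      have d0 : 1 + t' * x != 0.
        have [->|x0] := eqVneq x 0; first by rewrite mulr0 addr0 oner_neq0.
        apply: contra t'x; rewrite addrC addr_eq0 => /eqP H.
        by rewrite -[t'](mulfK x0) H mulN1r.
      rewrite xroot_rank1 // !repM //; last by apply: G2_M => //; exact: G2_coroot.
        by rewrite -!mulmxA; apply: lowV; apply: torV => //; exact: IH.
      exact: G2_coroot.
    by rewrite xroot_comm repM // -mulmxA; apply: lowV; exact: IH.
  have [N [DN XN]] := rep_xroot_wide rP gam true.
  rewrite (XN N) // mulmx_suml; apply: memv_suml => i _; rewrite -scalemxAl memvZ //.
  apply: (@memv_curve V (fun i => E gam i *m (r (xroot del false x) *m y)) N [:: - x^-1]) => // t' t'x.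
  have -> : \sum_(i < N) t' ^+ i *: (E gam i *m (r (xroot del false x) *m y)) =
      r (xroot gam true t') *m (r (xroot del false x) *m y).
    by rewrite (XN N) // mulmx_suml; apply: eq_bigr => j _; rewrite scalemxAl.
  exact: good.
have VG : submod r V.
  apply: submod_gen => gam [] t y; last exact: lowV.
  by apply: stab => {}y uy; exact: upO.
exists V; split=> // [|W WG uW|nu y yV yP y0].
- by apply: VP; exact: lower_orbit_base.
- apply/subvP => y /PV[s sP ys].
  apply: (@span_ind _ _ (fun z => z \in W) s _ _ _ y ys) => [|c {ys}y z yW zW|z /sP]; first exact: mem0v.
    by rewrite memvD // memvZ.
  elim=> [//|c {}y' _ IH|gam t {}y' _ IH]; first by rewrite memvZ.
  by apply: WG => //; exact: G2_xroot.
(* An invariant of the generators of V: the eta-component of x_(-gam)(t) z only involves the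
   components of z at eta + i gam, and for eta = mu all of these with i > 0 vanish. *)
pose Q y := (forall nu, ~ weight_le nu mu -> wproj r nu *m y = 0) /\
  exists c, wproj r mu *m y = c *: u.
have Qy : Q y.
  have [s sP ys] := PV _ yV.
  apply: (@span_ind _ _ Q s _ _ _ y ys) => [|c y1 y2 [Q1 [c1 E1]] [Q2 [c2 E2]]|z /sP].
  - by split=> [*|]; [rewrite mulmx0|exists 0; rewrite mulmx0 scale0r].
  - split=> [eta ne|]; first by rewrite mulmxDr -scalemxAr Q1 // Q2 // scaler0 addr0.
    by exists (c * c1 + c2); rewrite mulmxDr -scalemxAr E1 E2 scalerA scalerDl.
  elim=> [|c {}z _ [Q1 [c1 E1]]|gam t {}z _ [Q1 [c1 E1]]].
  - split=> [eta ne|]; last by exists 1; rewrite scale1r; apply/weight_vectorP.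
    apply: (wproj_diff rP uP); apply/eqP => H; apply: ne; rewrite -H; exact: weight_le_refl.
  - split=> [eta ne|]; first by rewrite -scalemxAr Q1 // scaler0.
    by exists (c * c1); rewrite -scalemxAr E1 scalerA.
  have [N [DN XN]] := rep_xroot_wide rP gam false.
  have EX eta : wproj r eta *m (r (xroot gam false t) *m z) =
      \sum_(i < N.+1) t ^+ i *: (F gam i *m (wproj r (eta + root_weight gam true *+ i) *m z)).
    rewrite (XN N.+1) // mulmx_suml mulmx_sumr; apply: eq_bigr => i _.
    rewrite -scalemxAl -scalemxAr !mulmxA -wproj_dpow.
    by rewrite root_weightN mulNrn addrK.
  split=> [eta ne|].
    rewrite EX big1 // => i _; rewrite Q1 ?mulmx0 ?scaler0 // => H; apply: ne.
    exact: weight_le_trans (weight_le_root _ _ _) H.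
  exists c1; rewrite EX big_ord_recl expr0 scale1r dpow0 // mul1mx mulr0n addr0 E1.
  rewrite big1 ?addr0 // => i _; rewrite Q1 ?mulmx0 ?scaler0 //.
  exact: weight_lt_root.
case: Qy => Q1 [c E1]; have yE := proj1 (weight_vectorP rP _ _) yP.
split=> [|eq_nu]; last by exists c; rewrite -E1 -eq_nu yE.
by apply: NNPP => /Q1; rewrite yE; move/eqP: y0.
Qed.

End SubModules.

(** * Highest weight vectors in semisimple and simple modules *)

Section SimpleModules.
Variables (k : closedFieldType) (n : nat) (r : 'M[k]_7 -> 'M[k]_n).
Hypothesis rP : rational r.
Implicit Types (a b t : k) (lam eta mu : weight) (y x v w : 'cV[k]_n).
Implicit Types (gam : sroot) (s : bool) (W V : {vspace 'cV[k]_n}).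

Local Notation E gam := (dpow r gam true).
Local Notation F gam := (dpow r gam false).

(* Some component of y in a simple summand generates a submodule which contains
   the nonzero component of F^(i) y and only has weights below it, so it cannot
   contain the component of y. *)
Lemma semisimple_descent gam i mu y : semisimple_module r -> weight_vector r mu y ->
  (0 < i)%N -> upper_fixed r (F gam i *m y) -> F gam i *m y = 0.
Proof.
move=> [_ [m [U [Usimple Ufull Udir]]]] yP i0 uU.
have [z zU yE] : exists2 z : 'I_m -> 'cV[k]_n, (forall j, z j \in U j) & y = \sum_j z j.
  have : y \in (\sum_j U j)%VS by rewrite Ufull memvf.
  by move=> /memv_sumP[z zU ->]; exists z => // j; apply: zU.
have subU j : submod r (U j) by have [] := Usimple j.
pose w j := wproj r mu *m z j.
have wU j : w j \in U j by apply: submod_wproj.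
have yEw : y = \sum_j w j.
  by rewrite -mulmx_sumr -yE (proj1 (weight_vectorP rP _ _) yP).
rewrite yEw mulmx_sumr big1 // => j _.
(* The sum of the [U j] is direct, so each component of a U^+-fixed vector is U^+-fixed. *)
have fixw : upper_fixed r (F gam i *m w j).
  move=> del t.
  have FU j' : F gam i *m w j' \in U j' by apply: submod_dpow.
  have XU j' : r (xroot del true t) *m (F gam i *m w j') \in U j'.
    by apply: subU => //; exact: G2_xroot.
  have /directv_sum_unique D := Udir.
  have eqs : \sum_j' r (xroot del true t) *m (F gam i *m w j') = \sum_j' F gam i *m w j'.
    have FE : \sum_j' F gam i *m w j' = F gam i *m y by rewrite yEw mulmx_sumr.
    by rewrite -mulmx_sumr FE uU.
  have := D (fun j' => r (xroot del true t) *m (F gam i *m w j'))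
    (fun j' => F gam i *m w j') (fun j' _ => XU j') (fun j' _ => FU j').
  by rewrite eqs eqxx => /esym /forall_inP /(_ j isT) /eqP.
have wP : weight_vector r mu (w j) by exact: wproj_weight.
have [V [VG uV Vmin Vw]] := highest_weight_span rP (dpow_weight rP gam false i wP) fixw.
have [u0|u0] := eqVneq (F gam i *m w j) 0; first by [].
have VU : (V <= U j)%VS by apply: Vmin => //; apply: submod_dpow.
have V0 : V != 0%VS by apply: contra u0 => /eqP V0; move: uV; rewrite V0 memv0.
have [_ _ /(_ V VG VU)[V00|VE]] := Usimple j; first by rewrite V00 eqxx in V0.
have [w0|w0] := eqVneq (w j) 0; first by rewrite w0 mulmx0.
have [|H _] := Vw mu (w j) _ wP w0; first by rewrite VE.
case: (weight_lt_root (mu := mu + root_weight gam false *+ i) (gam := gam) i0).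
by move: H; rewrite root_weightN mulNrn subrK.
Qed.

(** The heights of the weights are bounded, and a weight vector of W that is not fixed is sent by
    some E^(i), i > 0, to a nonzero vector of W of larger height. *)
Lemma exists_upper_fixed W : submod r W -> W != 0%VS ->
  exists mu w, [/\ w \in W, w != 0, weight_vector r mu w & upper_fixed r w].
Proof.
move=> WG W0; have [S [_ S0 S1]] := wproj_sum rP.
have [B SB] : exists B : int, forall mu, mu \in S -> height mu <= B.
  elim: (S) => [|mu S' [B SB]]; first by exists 0.
  exists (Num.max (height mu) B) => nu; rewrite inE => /orP[/eqP ->|/SB]; lia.
have hB mu w : weight_vector r mu w -> w != 0 -> height mu <= B.
  move=> wP w0; apply: SB; apply: contraNT w0 => /S0 H.
  by rewrite -(proj1 (weight_vectorP rP _ _) wP) H mul0mx.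
have [mu [w [wW w0 wP]]] : exists mu w, [/\ w \in W, w != 0 & weight_vector r mu w].
  have := vpick0 W; rewrite (negbTE W0) => /negbT x0.
  apply: NNPP => H; case/eqP: x0; apply: (wproj_eq0 rP) => mu.
  apply: NNPP => /eqP ne; apply: H; exists mu, (wproj r mu *m vpick W).
  by split=> //; [apply: submod_wproj => //; exact: memv_pick | exact: wproj_weight].
have [d dE] : exists d : nat, B - height mu < d%:Z.
  by exists (`|B - height mu|%N).+1; lia.
elim: d mu w wW w0 wP dE => [|d IH] mu w wW w0 wP dE.
  by have := hB _ _ wP w0; lia.
apply: NNPP => H; case: (H); exists mu, w; split=> //; apply/upper_fixedP => // gam i i0.
apply: NNPP => /eqP ne; apply: H.
apply: (IH (mu + root_weight gam true *+ i) (E gam i *m w)) => //.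
- exact: submod_dpow.
- exact: dpow_weight.
- by rewrite height_root; lia.
Qed.

Lemma top_upper_fixed lam y :
  (forall mu x, x != 0 -> weight_vector r mu x -> weight_le mu lam) ->
  weight_vector r lam y -> upper_fixed r y.
Proof.
move=> top yP; apply/upper_fixedP => // gam i i0; apply: NNPP => /eqP ne.
by have := top _ _ ne (dpow_weight rP gam true i yP); exact: weight_lt_root.
Qed.

(** A fixed weight vector generates the whole module, so its weight bounds lam from above; it is
    also bounded by lam. Components of a fixed vector at other weights are therefore zero, and the
    weight space of lam is a line. *)
Lemma simple_upper_fixed lam : simple_submod r fullv -> highest_weight r lam ->
  exists v, [/\ v != 0, weight_vector r lam v, upper_fixed r v,
    forall x, upper_fixed r x -> exists c, x = c *: v &
    forall x, weight_vector r lam x -> exists c, x = c *: v].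
Proof.
move=> [_ _ simp] [[v v0 vP] top]; exists v.
have vU := top_upper_fixed top vP.
have key mu x : weight_vector r mu x -> upper_fixed r x -> x != 0 ->
    mu = lam /\ exists c, x = c *: v.
  move=> xP xU x0; have [V [VG xV _ Vw]] := highest_weight_span rP xP xU.
  have VE : V = fullv.
    have [V0|//] := simp V VG (subvf V).
    by move: xV x0; rewrite V0 memv0 => ->.
  have vV : v \in V by rewrite VE memvf.
  have [le1 eq1] := Vw lam v vV vP v0.
  have E1 : mu = lam by apply: weight_le_anti (top _ _ x0 xP) le1.
  split=> //; have [c vE] := eq1 (esym E1).
  exists c^-1; rewrite vE scalerA mulVf ?scale1r //.
  by apply: contraNneq v0 => c0; rewrite vE c0 scale0r.
have fixP x : upper_fixed r x -> exists c, x = c *: v.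
  move=> xU; have xl mu : mu != lam -> wproj r mu *m x = 0.
    move=> ne; apply: NNPP => /eqP x0.
    have [E1 _] := key _ _ (wproj_weight rP mu x) (upper_fixed_wproj rP mu xU) x0.
    by rewrite E1 eqxx in ne.
  have xE := esym (wproj_only rP xl).
  have [->|x0] := eqVneq x 0; first by exists 0; rewrite scale0r.
  have xP : weight_vector r lam x by rewrite xE; exact: wproj_weight.
  by have [] := key _ _ xP xU x0.
split=> // x xP; apply: fixP; exact: top_upper_fixed xP.
Qed.

Lemma rep_weylV gam : exists A, A *m r (weyl_rep gam) = 1%:M.
Proof.
exists (r (xroot gam true (-1)) *m r (xroot gam false 1) *m r (xroot gam true (-1))).
rewrite /weyl_rep !repM //; try (by apply: G2_xroot); last by apply: G2_M; exact: G2_xroot.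
rewrite -!mulmxA [r (xroot gam true (-1)) *m (r (xroot gam true 1) *m _)]mulmxA.
rewrite rep_xrootV // mul1mx [r (xroot gam false 1) *m (_ *m _)]mulmxA.
have H := rep_xrootV rP gam false (-1); rewrite opprK in H.
by rewrite H mul1mx rep_xrootV.
Qed.

Lemma refl_weight gam mu y : weight_vector r mu y -> y != 0 ->
  exists2 z, z != 0 & weight_vector r (refl gam mu) z.
Proof.
move=> yP y0; exists (r (weyl_rep gam) *m y).
  have [A AK] := rep_weylV gam; apply: contraNneq y0 => H.
  by rewrite -[y]mul1mx -AK -mulmxA H mulmx0.
have GW : G2 (weyl_rep gam : 'M[k]_7) by do !apply: G2_M; exact: G2_xroot.
move=> a b a0 b0; rewrite mulmxA -repM //; last exact: G2_torus.
case: gam GW => GW; [rewrite torus_weyl_rep_alpha // | rewrite torus_weyl_rep_beta //].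
  have c0 : a^-1 * b != 0 by rewrite mulf_neq0 ?invr_eq0.
  rewrite repM //; last exact: G2_torus.
  rewrite -mulmxA yP // -scalemxAr; congr (_ *: _); rewrite /wchar /=.
  by rewrite exprzMl ?unitfE ?invr_eq0 // exprz_inv expfzDr // mulrA.
have c0 : a * a * a * b^-1 != 0 by rewrite !mulf_neq0 ?invr_eq0.
rewrite repM //; last exact: G2_torus.
rewrite -mulmxA yP // -scalemxAr; congr (_ *: _); rewrite /wchar /=.
have -> : a * a * a = a ^+ 3 by rewrite !exprS expr0 mulr1 mulrA.
rewrite exprzMl ?unitfE ?expf_neq0 ?invr_eq0 // exprz_inv exprnP exprz_exp mulrA expfzDr //.
by congr (_ * _ ^ _ * _); rewrite int_mulrn mulrC.
Qed.

Inductive upper_group : 'M[k]_7 -> Prop :=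
| upper_group1 : upper_group 1%:M
| upper_groupX gam t g : upper_group g -> upper_group (g *m xroot gam true t).

Lemma upper_group_G2 g : upper_group g -> G2 g.
Proof.
by elim=> [|gam t h _ IH]; [exact: G2_1 | apply: G2_M => //; exact: G2_xroot].
Qed.

Lemma upper_group_torus g a b : a != 0 -> b != 0 -> upper_group g ->
  exists2 h, upper_group h & g *m torus a b = torus a b *m h.
Proof.
move=> a0 b0; elim=> [|gam t h _ [h' h'U hE]].
  by exists 1%:M; [exact: upper_group1 | rewrite mul1mx mulmx1].
pose c := wchar (root_weight gam true) a b.
have c0 : c != 0 by exact: wchar_neq0.
exists (h' *m xroot gam true (c^-1 * t)); first exact: upper_groupX.
by rewrite -mulmxA -{1}[t](mulVKf c0) -torus_xroot // mulmxA hE mulmxA.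
Qed.

(** All g^-1 e_gam g with g in U^+ kill x. Quantifying over g makes the condition pass from x to
    E_del^(i) x, as the coefficient of t^i in the condition for g x_del(t). *)
Definition lie_killed x := forall gam g, upper_group g -> E gam 1 *m (r g *m x) = 0.

(** The torus normalizes U^+ and multiplies e_gam by a scalar, so the condition holds for all torus
    translates of x, hence for its components. *)
Lemma lie_killed_wproj lam x : lie_killed x -> lie_killed (wproj r lam *m x).
Proof.
move=> xZ gam g gU; have [S [uS S0 S1]] := wproj_sum rP.
have [lS|/S0 ->] := boolP (lam \in S); last by rewrite mul0mx !mulmx0.
apply: (@wchar_coeff_eq0 k n 1 S (fun lam => E gam 1 *m (r g *m (wproj r lam *m x)))) => //.
move=> a b a0 b0; have Gg := upper_group_G2 gU; have Gt := G2_torus a0 b0.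
transitivity (E gam 1 *m (r g *m (r (torus a b) *m x))).
  rewrite (torus_decomp rP a0 b0 S1) mulmx_suml !mulmx_sumr; apply: eq_bigr => eta _.
  by rewrite -!scalemxAl -!scalemxAr.
have [h hU gE] := upper_group_torus a0 b0 gU.
rewrite [r g *m _]mulmxA -repM // gE repM //; last exact: upper_group_G2.
have chi0 := wchar_neq0 (root_weight gam true) a0 b0.
suff H : E gam 1 *m r (torus a b) =
    (wchar (root_weight gam true) a b)^-1 *: (r (torus a b) *m E gam 1).
  by rewrite -[r _ *m r h *m x]mulmxA mulmxA H -scalemxAl -mulmxA xZ // mulmx0 scaler0.
apply: (eq_on_weights rP) => eta y yP.
rewrite -scalemxAl -!mulmxA yP // (dpow_weight rP gam true 1 yP) // mulr1n wcharD //.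
by rewrite scalerA mulrCA mulVf // mulr1 scalemxAr.
Qed.

End SimpleModules.

(** * Restricted highest weights *)

Section Restricted.
Variables (k : closedFieldType) (p : nat).
Hypothesis pcharkp : p \in [pchar k].

Lemma pchar_fact_neq0 i : (i < p)%N -> i`!%:R != 0 :> k.
Proof.
elim: i => [|i IH] ip; first by rewrite oner_neq0.
rewrite factS natrM mulf_neq0 ?IH //; last exact: ltnW.
by rewrite -(dvdn_pcharf pcharkp) gtnNdvd.
Qed.

Lemma pth_root (t : k) : exists u, u ^+ p = t.
Proof.
have p0 := prime_gt0 (pcharf_prime pcharkp).
have /closed_rootP[u] : size ('X^p - t%:P : {poly k}) != 1%N.
  by rewrite size_XnsubC // -lt0n.
by rewrite rootE !hornerE subr_eq0 => /eqP; exists u.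
Qed.

(* If e_gam kills x and E_gam^(i) x is a nonzero highest weight vector, then
   reflecting the weight of x shows i <= <lam, gam^vee> < p, so that
   E_gam^(i) = e_gam^i / i! kills x. *)
Lemma lie_killed_upper_fixed n (r : 'M[k]_7 -> 'M[k]_n) lam x : rational r ->
  simple_submod r fullv -> highest_weight r lam ->
  (forall gam, pairing gam lam < p%:Z) -> lie_killed r x -> upper_fixed r x.
Proof.
move=> rP simp hw restr xZ.
have [v [v0 vP vU fixP _]] := simple_upper_fixed rP simp hw.
have [_ top] := hw.
(* Induction on the distance in height to lam. E_gam^(i) y is zero by induction, unless it has
   weight lam, where the reflection argument applies. So y is U^+-fixed of a weight other than lam,
   hence zero. *)
have key d mu y : weight_vector r mu y -> lie_killed r y -> mu != lam ->
    height lam - height mu < d%:Z -> y = 0.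
  elim: d mu y => [|d IH] mu y yP yZ ne hd; apply: NNPP => /eqP y0.
    have /weight_leP[i [j [H1 H2]]] := top _ _ y0 yP.
    by move: hd; rewrite /height; lia.
  have yU : upper_fixed r y.
    apply/upper_fixedP => // gam i i0.
    have E1y : dpow r gam true 1 *m y = 0.
      by have := yZ gam _ (upper_group1 _); rewrite rep1 // mul1mx.
    have [H|ne'] := eqVneq (mu + root_weight gam true *+ i) lam; last first.
      apply: (IH _ _ (dpow_weight rP gam true i yP)) => //; last by rewrite height_root; lia.
      move=> del g gU; have [N [DN XN]] := rep_xroot_wide rP gam true.
      have [iN|/DN ->] := ltnP i N; last by rewrite mul0mx !mulmx0.
      apply: (@mx_poly_eq0 k n 1 N
        (fun i => dpow r del true 1 *m (r g *m (dpow r gam true i *m y))) [::]) => // t _.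
      transitivity (dpow r del true 1 *m (r (g *m xroot gam true t) *m y)).
        rewrite repM //; [|exact: upper_group_G2|exact: G2_xroot].
        rewrite -(mulmxA (r g)) (XN N) // mulmx_suml !mulmx_sumr; apply: eq_bigr => l _.
        by rewrite -scalemxAl -!scalemxAr.
      by apply: yZ; exact: upper_groupX.
    have [z z0 zP] := refl_weight rP gam yP y0.
    have ip : (i < p)%N.
      have /weight_leP[a [b [H1 H2]]] := top _ _ z0 zP.
      have := restr gam; move: H H1 H2; rewrite weight_mulrn.
      by case: (gam) => <- /=; lia.
    have /eqP := dpow_fact rP E1y i0.
    by rewrite scaler_eq0 (negbTE (pchar_fact_neq0 ip)) => /eqP.
  have [c yE] := fixP _ yU.
  have : mu = lam by apply: (weight_unique rP yP _ y0); rewrite yE; exact: weight_vectorZ.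
  by move/eqP; rewrite (negbTE ne).
have proj0 mu : mu != lam -> wproj r mu *m x = 0.
  move=> ne; apply: (key (`|height lam - height mu|%N).+1 mu) => //; last by lia.
    exact: wproj_weight.
  exact: lie_killed_wproj.
by apply: (top_upper_fixed rP top); apply/weight_vectorP => //; exact: wproj_only.
Qed.

Lemma FrobE g : Frob p g = map_mx (pFrobenius_aut pcharkp) g.
Proof. by apply/matrixP => i j; rewrite !mxE. Qed.

Lemma FrobM (g h : 'M[k]_7) : Frob p (g *m h) = Frob p g *m Frob p h.
Proof. by rewrite !FrobE map_mxM. Qed.

Lemma Frob1 : Frob p (1%:M : 'M[k]_7) = 1%:M.
Proof. by rewrite FrobE map_mx1. Qed.

Lemma pchar_natX i : (i%:R : k) ^+ p = i%:R.
Proof. by rewrite -pFrobenius_autE pFrobenius_aut_nat. Qed.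

Lemma Frob_xroot gam s (t : k) : Frob p (xroot gam s t) = xroot gam s (t ^+ p).
Proof.
have p0 := prime_gt0 (pcharf_prime pcharkp).
apply/matrixP => -[i Hi] [j Hj]; rewrite !xroot_mat7 !mxE /=.
case: gam s => [] []; move: Hi Hj; case7 i; case7 j => _ _ //=.
all: by rewrite ?expr0n ?expr1n ?exprMn ?pchar_natX //; case: (p) p0.
Qed.

Lemma Frob_torus (a b : k) : Frob p (torus a b) = torus (a ^+ p) (b ^+ p).
Proof.
have p0 := prime_gt0 (pcharf_prime pcharkp).
apply/matrixP => i j; rewrite !mxE; case: (i == j); last first.
  by rewrite !mulr0n expr0n; case: (p) p0.
have X (x : k) (m : int) : (x ^ m) ^+ p = (x ^+ p) ^ m.
  by rewrite !exprnP !exprz_exp mulrC.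
by rewrite !mulr1n /wchar exprMn !X.
Qed.

End Restricted.

(** * The tensor product theorem *)

(** Writes a polynomial in t^p as one in t, in order to compare its coefficients with those of a
    family that depends on t itself. *)
Lemma sum_dvd (V : zmodType) p M (f : nat -> V) : (0 < p)%N ->
  \sum_(i < p * M) (if (p %| i)%N then f (i %/ p)%N else 0) = \sum_(j < M) f j.
Proof.
move=> p0.
rewrite -(big_mkord xpredT (fun i => if (p %| i)%N then f (i %/ p)%N else 0)).
rewrite -(big_mkord xpredT f); elim: M => [|M IH]; first by rewrite muln0 !big_geq.
rewrite mulnSr (big_cat_nat (n := (p * M)%N)) ?leq_addr //= IH big_nat_recr //=.
congr (_ + _); rewrite -{1}[(p * M)%N]add0n big_addn addKn.
rewrite -(prednK p0) big_nat_recl // prednK // add0n dvdn_mulr // mulKn //.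
rewrite big1_seq ?addr0 // => i; rewrite mem_index_iota /= => ip.
rewrite dvdn_addl ?dvdn_mulr // gtnNdvd //; lia.
Qed.

Section Tensors.
Variables (k : closedFieldType) (p : nat).
Hypothesis pcharkp : p \in [pchar k].

Lemma G2_Frob (g : 'M[k]_7) : G2 g -> G2 (Frob p g).
Proof.
elim=> [|g1 g2 _ IH1 _ IH2|gam s t].
- by rewrite (Frob1 pcharkp); exact: G2_1.
- by rewrite (FrobM pcharkp); exact: G2_M.
- by rewrite (Frob_xroot pcharkp); exact: G2_xroot.
Qed.

Lemma regular_Frob (f : 'M[k]_7 -> k) : regular f -> regular (fun g => f (Frob p g)).
Proof.
elim/regular_ind => {f} [f g fg H|c|f g Hf Hg|f g Hf Hg|i j].
- by apply: regular_ext H => x Gx; rewrite fg //; exact: G2_Frob.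
- exact: regular_const.
- exact: regularD.
- exact: regularM.
- apply: (@regular_ext _ (fun x => x i j ^+ p)) => [x _|]; first by rewrite mxE.
  by apply: regularX; exact: regular_entry.
Qed.

Lemma twist_rational n (r : 'M[k]_7 -> 'M[k]_n) : rational r -> rational (twist p r).
Proof.
move=> rP; split=> [|g h Gg Gh|i j].
- by rewrite /twist (Frob1 pcharkp) rep1.
- by rewrite /twist (FrobM pcharkp) repM //; exact: G2_Frob.
- by apply: (regular_Frob (f := fun g => r g i j)); exact: rep_regular.
Qed.

Lemma tensmx11 n1 n2 : (1%:M : 'M[k]_n1) *t (1%:M : 'M[k]_n2) = 1%:M.
Proof.
apply/matrixP => i j.
case: (mxtens_indexP i) => i1 i2; case: (mxtens_indexP j) => j1 j2.
rewrite tensmxE !mxE -natrM mulnb; congr (_ : bool)%:R.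
by rewrite (can_eq (@mxtens_indexK _ _)) xpair_eqE.
Qed.

Lemma tensor_rational n1 n2 (r1 : 'M[k]_7 -> 'M[k]_n1) (r2 : 'M[k]_7 -> 'M[k]_n2) :
  rational r1 -> rational r2 -> rational (tensor r1 r2).
Proof.
move=> r1P r2P; split=> [|g h Gg Gh|i j].
- by rewrite /tensor !rep1 // tensmx11.
- by rewrite /tensor !repM // tensmx_mul.
- case: (mxtens_indexP i) => i1 i2; case: (mxtens_indexP j) => j1 j2.
  apply: (@regular_ext _ (fun g => r1 g i1 j1 * r2 g i2 j2)) => [g _|].
    by rewrite /tensor tensmxE.
  by apply: regularM; exact: rep_regular.
Qed.

(** Identifies tensors with matrices: A *t B becomes X -> A X B^T, and pure tensors become matrices
    of rank at most one. *)
Definition unvec n1 n2 (w : 'cV[k]_(n1 * n2)) : 'M[k]_(n1, n2) :=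
  \matrix_(i, j) w (mxtens_index (i, j)) 0.

Lemma unvec_inj n1 n2 : injective (@unvec n1 n2).
Proof.
move=> w w' /matrixP H; apply/matrixP => i z; rewrite (ord1 z) {z}.
by case: (mxtens_indexP i) => i1 i2; have := H i1 i2; rewrite !mxE.
Qed.

Lemma unvec_tens m1 m2 n1 n2 (A : 'M[k]_(m1, n1)) (B : 'M[k]_(m2, n2)) w :
  unvec ((A *t B) *m w) = A *m unvec w *m B^T.
Proof.
apply/matrixP => i j; rewrite !mxE.
under [RHS]eq_bigr do rewrite !mxE mulr_suml.
rewrite exchange_big pair_big /=.
rewrite (reindex (fun ij => mxtens_index ij)) /=; last first.
  by exists (fun l => mxtens_unindex l) => l _; rewrite ?mxtens_indexK ?mxtens_unindexK.
apply: eq_bigr => -[i1 j1] _ /=; rewrite tensmxE mxE.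
by rewrite mulrAC.
Qed.

Definition tvec n1 n2 (x : 'cV[k]_n1) (y : 'cV[k]_n2) : 'cV[k]_(n1 * n2) := x *t y.

Lemma tvecE n1 n2 (x : 'cV[k]_n1) (y : 'cV[k]_n2) i j :
  tvec x y (mxtens_index (i, j)) 0 = x i 0 * y j 0.
Proof.
by rewrite /tvec /tensmx mxE mxtens_indexK /=; congr (x _ _ * y _ _); exact: ord1.
Qed.

Lemma unvec_tvec n1 n2 (x : 'cV[k]_n1) (y : 'cV[k]_n2) : unvec (tvec x y) = x *m y^T.
Proof.
by apply/matrixP => i j; rewrite mxE tvecE !mxE big_ord1 mxE.
Qed.

Lemma unvecZ n1 n2 c (w : 'cV[k]_(n1 * n2)) : unvec (c *: w) = c *: unvec w.
Proof. by apply/matrixP => i j; rewrite !mxE. Qed.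

Lemma tens_tvec m1 m2 n1 n2 (A : 'M[k]_(m1, n1)) (B : 'M[k]_(m2, n2)) x y :
  (A *t B) *m tvec x y = tvec (A *m x) (B *m y).
Proof. by apply: unvec_inj; rewrite unvec_tens !unvec_tvec trmx_mul !mulmxA. Qed.

Lemma tvec_neq0 n1 n2 (x : 'cV[k]_n1) (y : 'cV[k]_n2) : x != 0 -> y != 0 -> tvec x y != 0.
Proof.
have nz n (z : 'cV[k]_n) : z != 0 -> exists i, z i 0 != 0.
  move=> z0; apply: NNPP => H; case/eqP: z0; apply/matrixP => i j; rewrite (ord1 j) mxE.
  by apply: NNPP => /eqP ne; apply: H; exists i.
move=> /nz[i xi] /nz[j yj]; apply: contraNneq (mulf_neq0 xi yj) => H.
by rewrite -tvecE H mxE.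
Qed.

End Tensors.

Section Steinberg.
Variables (k : closedFieldType) (p : nat).
Hypothesis pcharkp : p \in [pchar k].
Variables (nL nM : nat) (L : 'M[k]_7 -> 'M[k]_nL) (M : 'M[k]_7 -> 'M[k]_nM).
Variables (lam mu : weight) (v : 'cV[k]_nL) (m : 'cV[k]_nM).
Hypotheses (LP : rational L) (MP : rational M).
Hypotheses (Lsimple : simple_submod L fullv) (Msimple : simple_submod M fullv).
Hypotheses (Lhw : highest_weight L lam) (Mhw : highest_weight M mu).
Hypothesis restr : forall gam, pairing gam lam < p%:Z.
Hypotheses (v0 : v != 0) (vP : weight_vector L lam v).
Hypotheses (m0 : m != 0) (mP : weight_vector M mu m).

(* A U^+-fixed vector sum_i x_i (x) m_i of L (x) M^[1], the m_i being linearly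
   independent, has all its x_i killed by the u e_gam u^-1 with u in U^+, since
   these act on the first factor only. *)
Lemma submod_tensor_twist W : submod (tensor L (twist p M)) W -> W != 0%VS ->
  tvec v m \in W.
Proof.
have pp := pcharf_prime pcharkp; have p0 := prime_gt0 pp.
have TP := tensor_rational LP (twist_rational pcharkp MP).
move=> WG W0; have [nu [w [wW w0 _ wU]]] := exists_upper_fixed TP WG W0.
pose X := unvec w.
have XU gam t : L (xroot gam true t) *m X *m (M (xroot gam true (t ^+ p)))^T = X.
  by rewrite /X -unvec_tens -(Frob_xroot pcharkp) -[RHS](congr1 _ (wU gam t)).
have XV gam t : L (xroot gam true t) *m X = X *m (M (xroot gam true (- t ^+ p)))^T.
  rewrite -[in RHS](XU gam t) -mulmxA -trmx_mul rep_xrootV // trmx1 mulmx1 //.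
(* By [XV], L(x_gam(t)) X is a polynomial in t^p, so its coefficient at t vanishes because p does
   not divide 1. *)
have eX gam : dpow L gam true 1 *m X = 0.
  have [N [DN XN]] := rep_xroot_wide LP gam true.
  have [N' [DN' XN']] := rep_xroot_wide MP gam true.
  have H := @mx_poly_inj k nL nM N (p * N') (fun i => dpow L gam true i *m X)
    (fun i => if (p %| i)%N then (-1) ^+ (i %/ p) *: (X *m (dpow M gam true (i %/ p))^T) else 0) [::].
  rewrite H => [|i|i|t _].
  - by rewrite dvdn1; case: eqP pp => [->|].
  - by move=> /DN ->; rewrite mul0mx.
  - case: ifP => // /dvdnP[j ->]; rewrite mulnC leq_pmul2r // mulnK // => /DN' ->.
    by rewrite trmx0 mulmx0 scaler0.
  transitivity (L (xroot gam true t) *m X).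
    by rewrite (XN N) // mulmx_suml; apply: eq_bigr => i _; rewrite scalemxAl.
  rewrite XV (XN' N') // linear_sum mulmx_sumr -(sum_dvd N' (fun j => X *m ((- t ^+ p) ^+ j *: dpow M gam true j)^T) p0); apply: eq_bigr => i _.
  case: ifP => [/dvdnP[j ->]|]; last by rewrite scaler0.
  rewrite mulnK // linearZ -scalemxAr scalerA; congr (_ *: _).
  by rewrite mulnC exprM mulrC -exprNn.
(* Left multiplication by L(g) amounts to right multiplication by some B, so e_gam L(g) X = e_gam X
   B = 0: the columns of X are [lie_killed], hence multiples of v, and X = v y^T. *)
have gX g : upper_group g -> exists B, L g *m X = X *m B.
  elim=> [|gam t h hU [B hX]]; first by exists 1%:M; rewrite rep1 // mul1mx mulmx1.
  exists (B *m (M (xroot gam true (- t ^+ p)))^T).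
  rewrite repM //; [|exact: upper_group_G2|exact: G2_xroot].
  by rewrite -mulmxA XV mulmxA hX mulmxA.
have [v1 [_ _ _ fixL wtL]] := simple_upper_fixed LP Lsimple Lhw.
have [m1 [_ _ _ fixM wtM]] := simple_upper_fixed MP Msimple Mhw.
have fixL' x : upper_fixed L x -> exists c, x = c *: v.
  move=> /fixL[c ->]; have [d vE] := wtL _ vP.
  exists (c / d); rewrite vE scalerA mulfVK //.
  by apply: contraNneq v0 => d0; rewrite vE d0 scale0r.
have fixM' x : upper_fixed M x -> exists c, x = c *: m.
  move=> /fixM[c ->]; have [d mE] := wtM _ mP.
  exists (c / d); rewrite mE scalerA mulfVK //.
  by apply: contraNneq m0 => d0; rewrite mE d0 scale0r.
have [c cE] : exists c : 'I_nM -> k, forall j, X *m (delta_mx j 0 : 'cV_nM) = c j *: v.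
  apply: (@fin_all_exists _ (fun=> k) (fun j c => X *m (delta_mx j 0 : 'cV_nM) = c *: v)) => j.
  apply: fixL'; apply: (lie_killed_upper_fixed pcharkp LP Lsimple Lhw restr) => gam g gU.
  have [B gXE] := gX g gU.
  by rewrite [L g *m _]mulmxA gXE -!mulmxA mulmxA eX mul0mx.
pose y : 'cV[k]_nM := \col_j c j.
have XE : X = v *m y^T.
  apply/matrixP => i j; have /matrixP/(_ i 0) := cE j.
  by rewrite -colE !mxE big_ord1 !mxE mulrC.
(* As t^p runs over all of k, y is fixed under M itself and not only under its twist. *)
have yU : upper_fixed M y.
  move=> gam u; have [t <-] := pth_root pcharkp u.
  have vU : upper_fixed L v by apply: top_upper_fixed vP => //; case: Lhw.
  have := XU gam t; rewrite XE mulmxA vU -mulmxA -trmx_mul => /(congr1 trmx).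
  rewrite !trmx_mul !trmxK => H; apply/eqP; rewrite -subr_eq0; apply/eqP.
  have : (M (xroot gam true (t ^+ p)) *m y - y) *m v^T = 0 by rewrite mulmxBl H subrr.
  move=> {}H; apply: NNPP => /eqP ne; have := tvec_neq0 ne v0.
  by move/eqP; apply; apply: unvec_inj; rewrite unvec_tvec H; apply/matrixP => i j; rewrite !mxE.
have [d yE] := fixM' _ yU.
have wE : w = d *: tvec v m.
  by apply: unvec_inj; rewrite -/X XE yE unvecZ unvec_tvec linearZ -scalemxAr.
have d0 : d != 0 by apply: contraNneq w0 => d0; rewrite wE d0 scale0r.
by rewrite -[tvec v m]scale1r -(mulVf d0) -scalerA -wE memvZ.
Qed.

End Steinberg.

(** * Contragredient modules *)

Section Duality.
Variable k : closedFieldType.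
Hypothesis two0 : 2%:R != 0 :> k.

Lemma transpK (g : 'M[k]_7) : transp (transp g) = g.
Proof.
apply/matrixP => i j; rewrite !transpE !mxE.
by case: (i == 3 :> nat); case: (j == 3 :> nat); field.
Qed.

Lemma G2_transp (g : 'M[k]_7) : G2 g -> G2 (transp g).
Proof.
elim=> [|g1 g2 _ IH1 _ IH2|gam s t].
- by rewrite transp1 //; exact: G2_1.
- by rewrite transpM //; exact: G2_M.
- by rewrite transp_xroot //; exact: G2_xroot.
Qed.

Lemma regular_transp (f : 'M[k]_7 -> k) : regular f -> regular (fun g => f (transp g)).
Proof.
elim/regular_ind => {f} [f g fg H|c|f g Hf Hg|f g Hf Hg|i j].
- by apply: regular_ext H => x Gx; rewrite fg //; exact: G2_transp.
- exact: regular_const.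
- exact: regularD.
- exact: regularM.
- apply: (@regular_ext _ (fun x => transp_diag k 0 i * x j i * transp_inv k 0 j)) => [x _|].
    by rewrite transpE.
  by apply: regularM; [apply: regularZ; exact: regular_entry | exact: regular_const].
Qed.

(** A nonzero row of the matrix of [projv W] - 1 is a linear form vanishing on W. *)
Lemma annihilator_neq0 n (W : {vspace 'cV[k]_n}) : W != fullv ->
  exists2 xi : 'cV[k]_n, xi != 0 & forall y, y \in W -> xi^T *m y = 0.
Proof.
move=> Wn; have [y yW] : exists y, y \notin W.
  apply: NNPP => H; case/eqP: Wn; apply/vspaceP => y; rewrite memvf.
  by apply: NNPP => /negP yW; apply: H; exists y.
have [i yi] : exists i, (projv W y - y) i 0 != 0.
  apply: NNPP => H; move: yW; rewrite memv_projE -subr_eq0 => /eqP[].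
  apply/matrixP => i j; rewrite (ord1 j) [RHS]mxE.
  by apply: NNPP => /eqP ne; apply: H; exists i.
pose xi : 'cV[k]_n := \col_j (projv W (delta_mx j 0) - delta_mx j 0) i 0.
have xiE z : xi^T *m z = ((projv W z - z) i 0)%:M.
  have zE : z = \sum_j z j 0 *: (delta_mx j 0 : 'cV_n).
    by rewrite {1}[z]matrix_sum_delta; apply: eq_bigr => j _; rewrite big_ord1.
  have -> : projv W z - z = \sum_j z j 0 *: (projv W (delta_mx j 0) - delta_mx j 0).
    rewrite {1 2}zE linear_sum -sumrB; apply: eq_bigr => j _.
    by rewrite linearZ scalerBr.
  apply/matrixP => a b; rewrite (ord1 a) (ord1 b) summxE !mxE eqxx mulr1n.
  apply: eq_bigr => j _; rewrite [RHS]mxE mulrC; congr (_ * _).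
  by rewrite 2![LHS]mxE.
exists xi; last first.
  by move=> z; rewrite memv_projE xiE => /eqP ->; rewrite subrr mxE raddf0.
apply: contraNneq yi => xi0; have /matrixP/(_ 0 0) := xiE y.
by rewrite xi0 trmx0 mul0mx !mxE mulr1n => <-.
Qed.

Lemma tvec_pairing n1 n2 (x z : 'cV[k]_n1) (y w : 'cV[k]_n2) :
  ((tvec x y)^T *m tvec z w) 0 0 = (x^T *m z) 0 0 * (y^T *m w) 0 0.
Proof.
transitivity ((x^T *t y^T *m (z *t w)) (0 : 'I_(1 * 1)) (0 : 'I_(1 * 1))).
  by rewrite -trmx_tens.
by rewrite tensmx_mul /tensmx mxE !ord1.
Qed.

(** The dual module made into a left module by [transp] in place of inversion; as [transp] fixes the
    torus, the weights stay the same instead of changing sign. *)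
Definition contragredient n (r : 'M[k]_7 -> 'M[k]_n) (g : 'M[k]_7) : 'M[k]_n :=
  (r (transp g))^T.

Lemma contragredient_rational n (r : 'M[k]_7 -> 'M[k]_n) :
  rational r -> rational (contragredient r).
Proof.
move=> rP; split=> [|g h Gg Gh|i j].
- by rewrite /contragredient transp1 // rep1 // trmx1.
- by rewrite /contragredient transpM // repM ?trmx_mul //; exact: G2_transp.
- apply: (@regular_ext _ (fun g => r (transp g) j i)) => [g _|].
    by rewrite /contragredient mxE.
  by apply: (regular_transp (f := fun g => r g j i)); exact: rep_regular.
Qed.

Definition annihilates n (W : {vspace 'cV[k]_n}) (xi : 'cV[k]_n) :=
  forall y, y \in W -> xi^T *m y = 0.

Lemma annihilator n (W : {vspace 'cV[k]_n}) :
  exists U : {vspace 'cV[k]_n}, forall xi, xi \in U <-> annihilates W xi.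
Proof.
have [U [UP PU]] := span_pred (annihilates W); exists U => xi; split; last exact: UP.
move=> /PU[s sP]; apply: span_ind => [y _|c x z xP zP y yW|//].
  by rewrite trmx0 mul0mx.
by rewrite linearD linearZ mulmxDl -scalemxAl xP // zP // scaler0 addr0.
Qed.

Lemma annihilator_submod n (r : 'M[k]_7 -> 'M[k]_n) (W U : {vspace 'cV[k]_n}) : submod r W ->
  (forall xi, xi \in U <-> annihilates W xi) -> submod (contragredient r) U.
Proof.
move=> WG UP g xi Gg /UP xiW; apply/UP => y yW.
rewrite /contragredient trmx_mul trmxK -mulmxA; apply: xiW.
by apply: WG => //; exact: G2_transp.
Qed.

Lemma contragredientK n (r : 'M[k]_7 -> 'M[k]_n) g :
  contragredient (contragredient r) g = r g.
Proof. by rewrite /contragredient transpK trmxK. Qed.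

Lemma mx_col_neq0 m n (A : 'M[k]_(m, n)) : A != 0 -> exists j, A *m (delta_mx j 0 : 'cV_n) != 0.
Proof.
move=> A0; apply: NNPP => H; case/eqP: A0; apply/matrixP => i j; rewrite mxE.
have : A *m (delta_mx j 0 : 'cV_n) = 0 by apply: NNPP => /eqP ne; apply: H; exists j.
by rewrite -colE => /matrixP/(_ i 0); rewrite !mxE.
Qed.

Lemma contragredient_simple n (r : 'M[k]_7 -> 'M[k]_n) :
  simple_submod r fullv -> simple_submod (contragredient r) fullv.
Proof.
move=> [_ full0 simp]; split=> // [g v _ _|U UG _]; first exact: memvf.
have [->|Un] := eqVneq U fullv; first by right.
left; have [y y0 yU] := annihilator_neq0 Un.
have [V VP] := annihilator U.
have VG : submod r V.
  move=> g x Gg xV; rewrite -contragredientK.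
  by apply: (annihilator_submod UG VP).
have [V0|VE] := simp V VG (subvf V).
  by have /VP : annihilates U y by []; rewrite V0 memv0 (negbTE y0).
apply/eqP; rewrite -subv0; apply/subvP => x xU; rewrite memv0; apply/eqP.
apply/matrixP => i j; rewrite (ord1 j) [RHS]mxE.
have /VP/(_ x xU)/matrixP/(_ 0 0) : (delta_mx i 0 : 'cV[k]_n) \in V by rewrite VE memvf.
by rewrite trmx_delta -rowE !mxE.
Qed.

Lemma contragredient_wproj n (r : 'M[k]_7 -> 'M[k]_n) lam : rational r ->
  wproj (contragredient r) lam = (wproj r lam)^T.
Proof.
move=> rP; apply/matrixP => i j; rewrite !mxE.
apply: wfun_T2 => [||g [a [b [a0 b0 ->]]]]; last by rewrite /contragredient transp_torus // mxE.
  exact: (rep_regular (contragredient_rational rP)).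
exact: rep_regular.
Qed.

Lemma wproj_neq0 n (r : 'M[k]_7 -> 'M[k]_n) lam : rational r ->
  (exists2 v, v != 0 & weight_vector r lam v) <-> wproj r lam != 0.
Proof.
move=> rP; split=> [[v v0 /weight_vectorP vP]|].
  by apply: contraNneq v0 => H; rewrite -(vP rP) H mul0mx.
move=> /mx_col_neq0[j H]; exists (wproj r lam *m delta_mx j 0) => //.
exact: wproj_weight.
Qed.

Lemma contragredient_highest n (r : 'M[k]_7 -> 'M[k]_n) lam : rational r ->
  highest_weight r lam -> highest_weight (contragredient r) lam.
Proof.
move=> rP [ex top]; have dP := contragredient_rational rP.
split=> [|mu v v0 vP].
  by apply/(wproj_neq0 _ dP); rewrite contragredient_wproj // trmx_eq0; apply/wproj_neq0.
have : wproj r mu != 0.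
  by rewrite -trmx_eq0 -contragredient_wproj //; apply/wproj_neq0 => //; exists v.
by move=> /(wproj_neq0 _ rP)[w w0 wP]; exact: top wP.
Qed.

(** The linear form xi factors through the projection onto the weight space of lam, which is the
    line spanned by v; so xi would be zero if it vanished at v. *)
Lemma contragredient_pairing n (r : 'M[k]_7 -> 'M[k]_n) lam v xi : rational r ->
  simple_submod r fullv -> highest_weight r lam -> v != 0 -> weight_vector r lam v ->
  xi != 0 -> weight_vector (contragredient r) lam xi -> (xi^T *m v) 0 0 != 0.
Proof.
move=> rP simp hw v0 vP xi0 xiP; apply: contraNneq xi0 => H.
have [v1 [_ _ _ _ wt]] := simple_upper_fixed rP simp hw.
have xiv : xi^T *m v = 0 by apply/matrixP => i j; rewrite (ord1 i) (ord1 j) H mxE.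
have /(weight_vectorP (contragredient_rational rP)) xiE := xiP.
rewrite contragredient_wproj // in xiE.
apply/eqP; apply: trmx_inj; apply/matrixP => i j; rewrite (ord1 i) -xiE trmx_mul trmxK.
have [c vE] := wt _ vP; have [d wE] := wt _ (wproj_weight rP lam (delta_mx j 0)).
have c0 : c != 0 by apply: contraNneq v0 => c0; rewrite vE c0 scale0r.
have : xi^T *m (wproj r lam *m (delta_mx j 0 : 'cV_n)) = 0.
  rewrite wE; have -> : v1 = c^-1 *: v by rewrite vE scalerA mulVf ?scale1r.
  by rewrite -!scalemxAr xiv !scaler0.
by rewrite mulmxA -colE => /matrixP/(_ 0 0); rewrite !mxE.
Qed.

End Duality.

Section SteinbergTheorem.
Variables (k : closedFieldType) (p : nat).
Hypotheses (pcharkp : p \in [pchar k]) (p3 : (3 <= p)%N).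

Lemma pchar_two_neq0 : 2%:R != 0 :> k.
Proof.
by rewrite -(dvdn_pcharf pcharkp) gtnNdvd.
Qed.

Lemma Frob_transp (g : 'M[k]_7) : Frob p (transp g) = transp (Frob p g).
Proof.
apply/matrixP => i j; rewrite [LHS]mxE !transpE !exprMn.
by congr (_ * _ * _); rewrite !mxE //; case: ifP => _; rewrite ?exprVn ?(pchar_natX pcharkp) ?expr1n.
Qed.

(* The submodules of the contragredient module are the annihilators, so that both
   a proper submodule and its annihilator contain the line of highest weight,
   although the pairing is nonzero there. *)
Theorem tensor_twist_simple nL nM (L : 'M[k]_7 -> 'M[k]_nL) (M : 'M[k]_7 -> 'M[k]_nM) lam mu :
  simple_of_weight L lam -> simple_of_weight M mu ->
  (forall gam, pairing gam lam < p%:Z) -> simple_module (tensor L (twist p M)).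
Proof.
move=> [[LP Ls] Lhw] [[MP Ms] Mhw] restr.
have TP := tensor_rational LP (twist_rational pcharkp MP).
have two0 := pchar_two_neq0.
have [v [v0 vP _ _ _]] := simple_upper_fixed LP Ls Lhw.
have [m [m0 mP _ _ _]] := simple_upper_fixed MP Ms Mhw.
have LP' := contragredient_rational two0 LP.
have MP' := contragredient_rational two0 MP.
have Ls' := contragredient_simple two0 Ls; have Ms' := contragredient_simple two0 Ms.
have Lhw' := contragredient_highest two0 LP Lhw.
have Mhw' := contragredient_highest two0 MP Mhw.
have [xi [xi0 xiP _ _ _]] := simple_upper_fixed LP' Ls' Lhw'.
have [ze [ze0 zeP _ _ _]] := simple_upper_fixed MP' Ms' Mhw'.
split=> //; split=> [g w _ _||W WG _]; first exact: memvf.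
  apply: contraNneq (tvec_neq0 v0 m0) => H; have := memvf (tvec v m).
  by rewrite H memv0.
have [->|W0] := eqVneq W 0%VS; [by left | right].
have vmW := submod_tensor_twist pcharkp LP MP Ls Ms Lhw Mhw restr v0 vP m0 mP WG W0.
apply/eqP; apply: contraT => Wn.
have [eta eta0 etaW] := annihilator_neq0 Wn.
have [U UP] := annihilator W.
have UG : submod (tensor (contragredient L) (twist p (contragredient M))) U.
  move=> g x Gg xU; have := annihilator_submod two0 WG UP Gg xU.
  by rewrite /contragredient /tensor trmx_tens /twist Frob_transp.
have U0 : U != 0%VS.
  by apply: contraNneq eta0 => H; have /UP : annihilates W eta by []; rewrite H memv0.
have /UP/(_ _ vmW) := submod_tensor_twist pcharkp LP' MP' Ls' Ms' Lhw' Mhw' restr xi0 xiP ze0 zeP UG U0.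
move=> /matrixP/(_ 0 0)/eqP; rewrite tvec_pairing [X in _ == X]mxE mulf_eq0.
rewrite (negbTE (contragredient_pairing two0 LP Ls Lhw v0 vP xi0 xiP)).
by rewrite (negbTE (contragredient_pairing two0 MP Ms Mhw m0 mP ze0 zeP)).
Qed.

End SteinbergTheorem.

(** * Distributions on the torus *)

Section TorusDistributions.
Variables (k : closedFieldType) (p : nat).
Hypothesis pcharkp : p \in [pchar k].
Implicit Types (mu nu : @functional k) (lam eta : weight) (m : weight -> k).

Lemma wfun_char m lam (f : 'M[k]_7 -> k) :
  (forall a b, a != 0 -> b != 0 -> f (torus a b) = wchar lam a b) -> wfun m f = m lam.
Proof.
move=> fE; rewrite (@wfunE _ _ _ [:: (1, lam)]); first by rewrite /lsum big_seq1 mul1r.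
by move=> a b a0 b0; rewrite big_seq1 mul1r fE.
Qed.

Lemma wfun_inj m m' : deq (wfun m) (wfun m') -> m =1 m'.
Proof.
move=> E lam; have [f [rf fE]] := regular_wchar k lam.
by have := E f rf; rewrite !(wfun_char _ fE).
Qed.

Lemma distT1_on_G2 mu : is_distT1 p mu -> linear_on_G2 mu.
Proof.
move=> [lin ext _]; split=> // f1 f2 r1 r2 E; apply: ext => // g /T2_G2; exact: E.
Qed.

Definition periodic m := forall lam eta, m (lam + eta *+ p) = m lam.

(** Take m lam to be the value of mu at a regular function extending the character lam. For f1
    extending eta - 1, which vanishes at 1, the composite of f1 with Frobenius restricts to p eta -
    1 on the torus, and mu kills its multiples. *)
Lemma distT1_wfun mu : is_distT1 p mu -> exists2 m, periodic m & deq mu (wfun m).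
Proof.
move=> muT; have muG := distT1_on_G2 muT; have [lin ext per] := muT.
have [chi chiP] : exists chi : weight -> 'M[k]_7 -> k, forall lam, regular (chi lam) /\
    forall a b, a != 0 -> b != 0 -> chi lam (torus a b) = wchar lam a b.
  exists (fun lam => proj1_sig (constructive_indefinite_description _ (regular_wchar k lam))).
  by move=> lam; case: constructive_indefinite_description.
have rchi lam : regular (chi lam) by have [] := chiP lam.
have chiE lam a b : a != 0 -> b != 0 -> chi lam (torus a b) = wchar lam a b.
  by have [_] := chiP lam; apply.
exists (fun lam => mu (chi lam)).
  move=> lam eta; pose f1 g := -1 + chi eta g : k.
  have rf1 : regular f1 by apply: regularD => //; exact: regular_const.
  have rF1 := regular_Frob pcharkp rf1.
  have f1E : f1 1%:M = 0.
    by rewrite /f1 -torus1 chiE ?oner_neq0 // /wchar !exp1rz mulr1 addNr.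
  have Z := per f1 (chi lam) rf1 (rchi lam) f1E.
  have := lin 1 _ _ (regularM rF1 (rchi lam)) (rchi lam).
  rewrite Z mulr0 add0r => <-; apply: ext => // [|g [a [b [a0 b0 ->]]]].
    by apply: regularD => //; apply: regularZ; exact: regularM.
  rewrite (Frob_torus pcharkp) /f1 !chiE ?expf_neq0 // wcharD // wcharMn; ring.
move=> f rf; have [l lP] := regular_torus rf; rewrite (wfunE _ lP).
transitivity (mu (fun g => \sum_(i < size l) (nth (0, 0) l i).1 * chi (nth (0, 0) l i).2 g)).
  apply: ext => // [|g [a [b [a0 b0 ->]]]].
    by apply: regular_sum => i; apply: regularZ.
  by rewrite lP // (big_nth (0, 0)) big_mkord; apply: eq_bigr => i _; rewrite chiE.
rewrite (linear_on_G2_sum (fun i : 'I_(size l) => (nth (0, 0) l i).1)) //.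
by rewrite /lsum (big_nth (0, 0)) big_mkord.
Qed.

Lemma wfun_distT1 m : periodic m -> is_distT1 p (wfun m).
Proof.
move=> per; split; [exact: wfun_linear | exact: wfun_T2 |].
move=> f1 f2 r1 r2 f10; have [l1 P1] := regular_torus r1; have [l2 P2] := regular_torus r2.
have P1' : laurent (fun a b => f1 (Frob p (torus a b))) [seq (x.1, x.2 *+ p) | x <- l1].
  move=> a b a0 b0; rewrite (Frob_torus pcharkp) P1 ?expf_neq0 // big_map.
  by apply: eq_bigr => x _; rewrite wcharMn.
rewrite (wfunE _ (laurentM P1' P2)) /lsum big_allpairs_dep big_map.
transitivity (\sum_(x <- l1) x.1 * \sum_(y <- l2) y.1 * m y.2).
  apply: eq_bigr => x _; rewrite mulr_sumr; apply: eq_bigr => y _ /=.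
  by rewrite mulrA addrC per.
suff S0 : \sum_(x <- l1) x.1 = 0 by rewrite -mulr_suml S0 mul0r.
rewrite -[RHS]f10 -torus1 P1 ?oner_neq0 //; apply: eq_bigr => x _.
by rewrite /wchar !exp1rz !mulr1.
Qed.

Lemma wfunM m m' : deq (dmul (wfun m) (wfun m')) (wfun (fun lam => m lam * m' lam)).
Proof.
move=> f /regular_torus[l lP]; rewrite (wfunE _ lP) /dmul.
rewrite (@wfunE _ _ _ [seq (x.1 * m' x.2, x.2) | x <- l]) => [|a b a0 b0].
  by rewrite /lsum big_map; apply: eq_bigr => x _ /=; rewrite -mulrA [m' _ * _]mulrC.
rewrite (@wfunE _ _ _ [seq (x.1 * wchar x.2 a b, x.2) | x <- l]) => [|c d c0 d0].
  by rewrite /lsum !big_map; apply: eq_bigr => x _ /=; rewrite mulrAC.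
rewrite torusM // lP ?mulf_neq0 // big_map; apply: eq_bigr => x _ /=.
by rewrite -mulrA; congr (_ * _); rewrite /wchar !exprzMl ?unitfE // mulrACA.
Qed.

Lemma regular_dmul nu (f : 'M[k]_7 -> k) : linear_on_G2 nu -> regular f ->
  regular (fun g => nu (fun h => f (g *m h))).
Proof.
move=> nuG rf; have [I [u [v [ru rv fE]]]] := regular_comul rf.
apply: (@regular_ext _ (fun g => \sum_i nu (v i) * u i g)) => [g Gg|]; last first.
  by apply: regular_sum => i; apply: regularZ.
transitivity (nu (fun h => \sum_i u i g * v i h)).
  by rewrite linear_on_G2_sum //; apply: eq_bigr => i _; rewrite mulrC.
apply: (proj2 nuG) => [||h Gh]; last by rewrite fE.
  by apply: regular_sum => i; apply: regularZ.
exact: regular_shift.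
Qed.

Lemma dmul_deq mu mu' nu nu' : linear_on_G2 mu -> linear_on_G2 nu -> linear_on_G2 nu' ->
  deq mu mu' -> deq nu nu' -> deq (dmul mu nu) (dmul mu' nu').
Proof.
move=> muG nuG nuG' Em En f rf; rewrite /dmul.
have r1 := regular_dmul nuG rf; have r2 := regular_dmul nuG' rf.
rewrite -(Em _ r2); apply: (proj2 muG _ _ r1 r2) => g Gg.
by apply: En; exact: regular_shift.
Qed.

Definition pmult lam : bool := (p %| lam.1)%Z && (p %| lam.2)%Z.

Lemma pmultP lam : reflect (exists eta, lam = eta *+ p) (pmult lam).
Proof.
apply: (iffP andP) => [[/dvdzP[a E1] /dvdzP[b E2]]|[eta ->]].
  by exists (a, b); rewrite weight_mulrn /= -E1 -E2; case: (lam).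
by rewrite weight_mulrn /= !dvdz_mull.
Qed.

Lemma pmult_periodic : periodic (fun lam => (pmult lam)%:R).
Proof.
move=> lam eta; congr (_ : bool)%:R; rewrite /pmult weight_mulrn /=.
by rewrite !rpredDr ?dvdz_mull.
Qed.

(* The idempotents of Dist(T_1) correspond to the subsets of Lambda / p Lambda. *)
Lemma mu0_wfun mu0 : is_mu0 p mu0 -> deq mu0 (wfun (fun lam => (pmult lam)%:R)).
Proof.
move=> [[[muT idem] nz prim] cu].
have [m per muE] := distT1_wfun muT; have muG := distT1_on_G2 muT.
have mm lam : m lam * m lam = m lam.
  apply: (@wfun_inj (fun lam => m lam * m lam)) => f rf.
  rewrite -wfunM // -muE // -idem //; symmetry; apply: dmul_deq => //; exact: wfun_on_G2.
pose m0 lam : k := (pmult lam)%:R.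
have m01 : m 0 = 1.
  have m00 : m 0 != 0.
    apply/eqP => H; apply: cu; rewrite /counit muE; last exact: regular_const.
    by rewrite -[RHS]H; apply: wfun_char => a b _ _; rewrite wchar0.
  by apply: (mulfI m00); rewrite mm mulr1.
have mp lam : pmult lam -> m lam = 1.
  by move=> /pmultP[eta ->]; rewrite -[eta *+ p]add0r per.
(* The counit of mu0 is m 0, so m = 1 on p Lambda, and m = m0 + m1 is a decomposition into
   orthogonal idempotents. Primitivity forces m1 = 0, as m0 is not zero. *)
pose m1 lam := m lam - m0 lam.
have m1m0 lam : m1 lam * m0 lam = 0.
  rewrite /m1 /m0; case: (boolP (pmult lam)) => [/mp ->|_]; by rewrite ?subrr ?mul0r ?mulr0.
have per1 : periodic m1 by move=> lam eta; rewrite /m1 per /m0 pmult_periodic.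
have idem_wfun m' : periodic m' -> (forall lam, m' lam * m' lam = m' lam) ->
    idempotentT1 p (wfun m').
  move=> per' mm'; split; first exact: wfun_distT1.
  move=> f rf; rewrite wfunM //; congr wfun.
  by apply: functional_extensionality => lam; rewrite mm'.
have prod0 m2 m3 : (forall lam, m2 lam * m3 lam = 0) -> deq (dmul (wfun m2) (wfun m3)) dzero.
  move=> H f rf; rewrite wfunM //; have [l lP] := regular_torus rf.
  by rewrite (wfunE _ lP) /lsum big1 // => x _; rewrite H mulr0.
have m1m1 lam : m1 lam * m1 lam = m1 lam.
  by rewrite {2}/m1 mulrBr m1m0 subr0 /m1 mulrBl mm /m0; case: (boolP (pmult lam)) => [/mp ->|_];
    rewrite ?mulr1 ?mul0r ?mulr0.
case: (prim (wfun m0) (wfun m1)).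
- apply: idem_wfun; first exact: pmult_periodic.
  by move=> lam; rewrite /m0; case: pmult; rewrite ?mulr1 ?mulr0.
- exact: idem_wfun.
- by apply: prod0 => lam; rewrite mulrC.
- exact: prod0.
- move=> f rf; rewrite muE // /dadd; have [l lP] := regular_torus rf.
  rewrite !(wfunE _ lP) /lsum -big_split; apply: eq_bigr => x _ /=.
  by rewrite /m1 -mulrDr addrC subrK.
- move=> /(_ (fun=> 1) (regular_const 1)); rewrite (@wfun_char _ 0) => [|a b _ _]; last by rewrite wchar0.
  by move/eqP; rewrite /m0 /= /pmult !dvdz0 oner_eq0.
- move=> E1 f rf; rewrite muE //; have [l lP] := regular_torus rf.
  have := E1 f rf; rewrite !(wfunE _ lP) /lsum => H; apply/eqP; rewrite -subr_eq0 -sumrB.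
  by rewrite -[X in _ == X]H; apply/eqP; apply: eq_bigr => x _; rewrite -mulrBr.
Qed.

End TorusDistributions.

(** * Binomial coefficients of integers modulo p *)

Lemma binz0 m : binz m 0 = 1.
Proof. by case: m => m; rewrite /binz ?bin0 // expr0 addn0 mul1r bin0. Qed.

Lemma binz_nat0 i : (0 < i)%N -> binz 0 i = 0.
Proof. by case: i. Qed.

Lemma binz_pascal m i : binz (m + 1) i.+1 = binz m i.+1 + binz m i.
Proof.
case: m => [m|[|m]].
- have -> : Posz m + 1 = Posz m.+1 by lia.
  by rewrite /binz binS PoszD.
- by rewrite /= !add0n !binn !mulr1 exprS mulN1r addNr.
have -> : Negz m.+1 + 1 = Negz m by lia.
have binE : 'C(m.+1 + i.+1, i.+1) = ('C((m + i).+1, i.+1) + 'C((m + i).+1, i))%N.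
  by rewrite addSn addnS binS.
by rewrite /binz binE addSn addnS exprS PoszD; ring.
Qed.

Section Binomials.
Variable k : closedFieldType.
Implicit Types (q : {poly k}).

Definition binzk (m : int) (i : nat) : k := (binz m i)%:~R.

Lemma binzk_pascal m i : binzk (m + 1) i.+1 = binzk m i.+1 + binzk m i.
Proof. by rewrite /binzk binz_pascal rmorphD. Qed.

(** The value of binom(h, i) at the Laurent polynomial t^-N q(t), as in [hbinom]. *)
Definition bin_sum (N : nat) q (i : nat) : k :=
  \sum_(j < size q) q`_j * binzk (j%:Z - N%:Z) i.

Lemma bin_sum_wide N q i K : (size q <= K)%N ->
  bin_sum N q i = \sum_(j < K) q`_j * binzk (j%:Z - N%:Z) i.
Proof.
move=> qK; rewrite /bin_sum -!(big_mkord xpredT (fun j => q`_j * binzk (j%:Z - N%:Z) i)).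
rewrite [RHS](big_cat_nat (n := size q)) //= [X in _ + X]big1_seq ?addr0 // => j.
by rewrite mem_index_iota => /andP[_ /andP[qj _]]; rewrite nth_default // mul0r.
Qed.

(** Pascal's rule read dually: the binom(h, i) are dual to the powers of t - 1, so multiplication by
    t - 1 lowers i by one. *)
Lemma bin_sum_XsubC N q i : bin_sum N (('X - 1) * q) i = if i is i'.+1 then bin_sum N q i' else 0.
Proof.
have sz : (size (('X - 1) * q)%R <= (size q).+1)%N.
  apply: leq_trans (size_polyMleq _ _) _.
  by rewrite -[1]/(1%:P) size_XsubC.
rewrite (bin_sum_wide _ _ sz).
have coE j : (('X - 1) * q)`_j = (if j is j'.+1 then q`_j' else 0) - q`_j.
  by rewrite mulrBl mul1r coefB coefXM; case: j.
transitivity (\sum_(j < size q) q`_j * (binzk (j%:Z + 1 - N%:Z) i - binzk (j%:Z - N%:Z) i)).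
  under eq_bigr do rewrite coE mulrBl.
  rewrite sumrB big_ord_recl mul0r add0r big_ord_recr /= [q`_(size q)]nth_default // mul0r addr0.
  rewrite -sumrB; apply: eq_bigr => j _; rewrite mulrBr; congr (_ * binzk _ _ - _).
  by rewrite /bump /=; lia.
case: i => [|i]; last first.
  apply: eq_bigr => j _; rewrite addrAC binzk_pascal; congr (_ * _).
  by rewrite [X in X - _]addrC addrK.
by rewrite big1 // => j _; rewrite /binzk !binz0 subrr mulr0.
Qed.

Lemma bin_sum_XsubC_exp N q i j :
  bin_sum N (('X - 1) ^+ j * q) i = if (j <= i)%N then bin_sum N q (i - j) else 0.
Proof.
elim: j i => [|j IH] i; first by rewrite mul1r subn0.
rewrite exprS -mulrA bin_sum_XsubC; case: i => [|i] //=; exact: IH.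
Qed.

Lemma bin_sumXn N j i : bin_sum N 'X^j i = binzk (j%:Z - N%:Z) i.
Proof.
rewrite /bin_sum size_polyXn (bigD1 ord_max) //= coefXn eqxx mul1r big1 ?addr0 // => l.
by rewrite -val_eqE /= coefXn => /negbTE ->; rewrite mul0r.
Qed.

Lemma bin_sumD N q q' i : bin_sum N (q + q') i = bin_sum N q i + bin_sum N q' i.
Proof.
pose K := maxn (size q) (size q').
have H0 : (size (q + q')%R <= K)%N by exact: size_polyD.
have [H1 H2] : (size q <= K)%N /\ (size q' <= K)%N by rewrite leq_maxl leq_maxr.
rewrite (bin_sum_wide _ _ H0) (bin_sum_wide _ _ H1) (bin_sum_wide _ _ H2) -big_split.
by apply: eq_bigr => j _; rewrite coefD mulrDl.
Qed.

(** Given the values at i and at one integer x0, Pascal's rule determines the values at i + 1 for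
    all larger and all smaller integers. *)
Lemma pascal_unique (f g : int -> nat -> k) :
  (forall x i, f (x + 1) i.+1 = f x i.+1 + f x i) ->
  (forall x i, g (x + 1) i.+1 = g x i.+1 + g x i) ->
  (forall x, f x 0%N = g x 0%N) -> (exists x0, forall i, f x0 i = g x0 i) ->
  forall x i, f x i = g x i.
Proof.
move=> fP gP f0 [x0 fg0] x i; elim: i x => [|i IH] x; first exact: f0.
have up (n : nat) : f (x0 + n%:Z) i.+1 = g (x0 + n%:Z) i.+1.
  elim: n => [|n IHn]; first by rewrite addr0 fg0.
  have -> : x0 + n.+1%:Z = x0 + n%:Z + 1 by lia.
  by rewrite fP gP IHn IH.
have down (n : nat) : f (x0 - n%:Z) i.+1 = g (x0 - n%:Z) i.+1.
  elim: n => [|n IHn]; first by rewrite subr0 fg0.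
  have E : x0 - n%:Z = x0 - n.+1%:Z + 1 by lia.
  by move: IHn; rewrite E fP gP IH => /addIr.
have [d dE] : exists d : nat, x = x0 + d%:Z \/ x = x0 - d%:Z.
  by exists (absz (x - x0)); lia.
by case: dE => ->.
Qed.

(** The binomials separate integers even in characteristic p. By [pascal_unique] equality is
    preserved by translations, which reduces to d > 0 against 0, distinguished by i = d. *)
Lemma binzk_inj (x y : int) : (forall i, binzk x i = binzk y i) -> x = y.
Proof.
move=> xy.
have shift z i : binzk (z + x) i = binzk (z + y) i.
  apply: (@pascal_unique (fun z i => binzk (z + x) i) (fun z i => binzk (z + y) i)) => {z i} [z i|z i|z|].
  - by rewrite addrAC binzk_pascal.
  - by rewrite addrAC binzk_pascal.
  - by rewrite /binzk !binz0.
  - by exists 0 => i; rewrite !add0r xy.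
have pos (d : nat) : (0 < d)%N -> ~ forall i, binzk d%:Z i = binzk 0 i.
  move=> d0 /(_ d); rewrite /binzk [binz 0 d]binz_nat0 // /binz binn => /eqP.
  by rewrite oner_eq0.
apply: NNPP => ne; have [d [d0 dE]] : exists d : nat, (0 < d)%N /\ (x - y = d%:Z \/ y - x = d%:Z).
  by exists (absz (x - y)); lia.
case: dE => dE; apply: (pos d d0) => i; rewrite -dE.
  by rewrite addrC shift addNr.
by rewrite addrC -shift addNr.
Qed.

Variable p : nat.
Hypothesis pcharkp : p \in [pchar k].

(** Pascal's rule iterated p times: (X - 1)^p = X^p - 1 in characteristic p. *)
Lemma binzk_pascal_p (x : int) i : binzk (x + p%:Z) (i + p) = binzk x (i + p) + binzk x i.
Proof.
pose N := absz x; pose j := absz (x + N%:Z).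
have xE : x = j%:Z - N%:Z by rewrite /j /N; lia.
have := bin_sum_XsubC_exp N 'X^j (i + p) p; rewrite leq_addl addnK.
have -> : ('X - 1) ^+ p = 'X^p - 1 :> {poly k}.
  have pX : p \in [pchar {poly k}] by rewrite pchar_poly.
  by rewrite -!(pFrobenius_autE pX) rmorphB rmorph1.
rewrite mulrBl mul1r -exprD => H.
have : bin_sum N 'X^(p + j) (i + p) = bin_sum N ('X^(p + j) - 'X^j) (i + p) + bin_sum N 'X^j (i + p).
  by rewrite -bin_sumD subrK.
rewrite H !bin_sumXn -xE => E; rewrite [RHS]addrC -E; congr binzk.
by rewrite xE; lia.
Qed.

(** The left side satisfies Pascal's rule too, by [binzk_pascal_p], so [pascal_unique] applies. *)
Lemma binzk_Lucas (x : int) i : binzk (x *+ p) (p * i) = binzk x i.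
Proof.
have p0 := prime_gt0 (pcharf_prime pcharkp).
apply: (@pascal_unique (fun x i => binzk (x *+ p) (p * i)) binzk) => {x i} [x i|x i|x|].
- have -> : (x + 1) *+ p = x *+ p + p%:Z by rewrite mulrnDl int_mulrn [1 *+ p]int_mulrn mul1r.
  by rewrite mulnS addnC; exact: binzk_pascal_p.
- exact: binzk_pascal.
- by rewrite muln0 /binzk !binz0.
- exists 0 => i; rewrite mul0rn; case: i => [|i]; first by rewrite muln0.
  by rewrite /binzk !binz_nat0 ?muln_gt0 ?p0.
Qed.

End Binomials.

(** * The distributions binom(h_gam, n) *)

Section Hbinom.
Variable k : closedFieldType.
Implicit Types (q : {poly k}) (gam : sroot) (f : 'M[k]_7 -> k).

Lemma bin_sum_shift N M q i : bin_sum (N + M) ('X^M * q) i = bin_sum N q i.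
Proof.
have sz : (size ('X^M * q)%R <= M + size q)%N.
  have [->|q0] := eqVneq q 0; first by rewrite mulr0 size_poly0.
  by rewrite mulrC size_mulXn.
rewrite (bin_sum_wide _ _ sz) big_split_ord /= big1 ?add0r => [|j _].
  apply: eq_bigr => j _; rewrite coefXnM ltnNge leq_addr /= addKn; congr (_ * binzk _ _ _).
  by rewrite !PoszD; lia.
by rewrite coefXnM ltn_ord mul0r.
Qed.

Lemma bin_sumZ N c q i : bin_sum N (c *: q) i = c * bin_sum N q i.
Proof.
rewrite (bin_sum_wide _ _ (size_scale_leq c q)) mulr_sumr.
by apply: eq_bigr => j _; rewrite coefZ mulrA.
Qed.

Lemma hbinomE gam n f N q : (forall t, t != 0 -> f (coroot gam t) = t ^- N * q.[t]) ->
  hbinom gam n f = bin_sum N q n.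
Proof.
move=> fq; rewrite /hbinom /laurent_of.
have ex : exists Nq : nat * {poly k}, forall t, t != 0 ->
    f (coroot gam t) = t ^- Nq.1 * Nq.2.[t] by exists (N, q).
have := epsilon_spec (inhabits (0%N, 0)) _ ex.
case: (epsilon _ _) => [N' q'] /= fq'; rewrite -/(bin_sum N' q' n).
rewrite -(bin_sum_shift N' N) -(bin_sum_shift N N') [(N + N')%N]addnC; congr bin_sum.
apply/eqP; rewrite -subr_eq0; apply/eqP; apply: (@poly_eq0_cofinite _ _ [:: 0]) => t.
rewrite inE => t0; rewrite hornerD hornerN !hornerM !hornerXn.
have tN M : t ^+ M != 0 by rewrite expf_neq0.
have := fq' t t0; rewrite fq // => E; apply/eqP; rewrite subr_eq0; apply/eqP.
by rewrite -[q.[t]](mulVKf (tN N)) E mulrCA mulVKf.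
Qed.

Lemma hbinom_rep gam l : exists N q,
  (forall t : k, t != 0 -> \sum_(x <- l) x.1 * t ^ pairing gam x.2 = t ^- N * q.[t]) /\
  forall n, bin_sum N q n = lsum (fun lam => binzk k (pairing gam lam) n) l.
Proof.
elim: l => [|x l [N [q [qE sE]]]].
  exists 0%N, 0; split=> [t t0|n]; first by rewrite big_nil horner0 mulr0.
  by rewrite /bin_sum size_poly0 big_ord0 /lsum big_nil.
pose M := absz (pairing gam x.2); pose j := absz (pairing gam x.2 + (N + M)%:Z).
have jE : j%:Z - (N + M)%N%:Z = pairing gam x.2 by rewrite /j /M; lia.
exists (N + M)%N, (x.1 *: 'X^j + 'X^M * q); split=> [t t0|n].
  rewrite big_cons qE // hornerD hornerZ hornerM !hornerXn -jE mulrDr expfzDr //.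
  rewrite -exprnN -exprnP; congr (_ + _); first by rewrite mulrA mulrC.
  by rewrite exprD invfM -mulrA mulKf // expf_neq0.
by rewrite bin_sumD bin_sumZ bin_sumXn bin_sum_shift jE sE /lsum big_cons.
Qed.

Lemma coroot_laurent gam f l : laurent (fun a b => f (torus a b)) l ->
  forall t, t != 0 -> f (coroot gam t) = \sum_(x <- l) x.1 * t ^ pairing gam x.2.
Proof.
move=> lP t t0; rewrite /coroot /pairing; case: gam; rewrite lP ?oner_neq0 //.
  by apply: eq_bigr => x _; rewrite /wchar exp1rz mulr1.
by apply: eq_bigr => x _; rewrite /wchar exp1rz mul1r.
Qed.

Lemma hbinom_wfun gam n :
  deq (hbinom gam n) (wfun (fun lam => binzk k (pairing gam lam) n)).
Proof.
move=> f /regular_torus[l lP]; have [N [q [qE sE]]] := hbinom_rep gam l.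
rewrite (@hbinomE _ _ _ N q) => [|t t0]; last by rewrite (coroot_laurent gam lP) // qE.
by rewrite sE (wfunE _ lP).
Qed.

(** Functions vanishing at 1 restrict along the coroot to multiples of t - 1, and binom(h, n) kills
    multiples of (t - 1)^(n+1). *)
Lemma hbinom_dist gam n : is_dist (@hbinom k gam n).
Proof.
have HW := hbinom_wfun gam n.
have [lin ext] := wfun_on_G2 (fun lam => binzk k (pairing gam lam) n).
split=> [a f1 f2 r1 r2|f1 f2 r1 r2 E|].
- rewrite !HW //; [exact: lin|exact: regularD (regularZ _ r1) r2].
- by rewrite !HW //; exact: ext.
exists n => f fP.
have [Nq NqP] : exists Nq : 'I_n.+1 -> nat * {poly k}, forall i t, t != 0 ->
    f i (coroot gam t) = t ^- (Nq i).1 * (('X - 1) * (Nq i).2).[t].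
  apply: (@fin_all_exists _ (fun=> (nat * {poly k})%type) (fun i Nq => forall t, t != 0 ->
    f i (coroot gam t) = t ^- Nq.1 * (('X - 1) * Nq.2).[t])) => i.
  have [ri fi1] := fP i; have [l lP] := regular_torus ri.
  have [N [q [qE _]]] := hbinom_rep gam l.
  have fE t : t != 0 -> f i (coroot gam t) = t ^- N * q.[t].
    by move=> t0; rewrite (coroot_laurent gam lP) // qE.
  have /factor_theorem[q' q'E] : root q 1.
    have := fE 1 (oner_neq0 _); rewrite expr1n invr1 mul1r rootE => <-.
    by rewrite /coroot; case: gam {HW lin ext qE fE}; rewrite torus1 fi1.
  by exists (N, q') => t t0; rewrite fE // q'E [q' * _]mulrC.
rewrite (@hbinomE _ _ _ (\sum_i (Nq i).1) (('X - 1) ^+ n.+1 * \prod_i (Nq i).2)) => [|t t0].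
  by rewrite bin_sum_XsubC_exp ltnn.
under eq_bigr do rewrite NqP //.
rewrite big_split /=; congr (_ * _).
  by rewrite expr_sum prodfV.
by rewrite -horner_prod big_split /= prodr_const card_ord.
Qed.

End Hbinom.

(** * Operators and weights of a contraction *)

Section Contraction.
Variables (k : closedFieldType) (p : nat).
Hypothesis pcharkp : p \in [pchar k].
Variables (mu0 : @functional k) (phi : @functional k -> @functional k).
Hypotheses (mu0P : is_mu0 p mu0) (phiP : contraction_hom p mu0 phi).

Lemma wactM n (r : 'M[k]_7 -> 'M[k]_n) m m' : rational r ->
  wact r m *m wact r m' = wact r (fun lam => m lam * m' lam).
Proof.
move=> rP; apply: (eq_on_weights rP) => lam y yP.
by rewrite -mulmxA !(wact_weight rP _ yP) -scalemxAr (wact_weight rP _ yP) scalerA mulrC.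
Qed.

Lemma mulrpI : injective (fun lam : weight => lam *+ p).
Proof.
have p0 := prime_gt0 (pcharf_prime pcharkp).
move=> lam eta; rewrite !weight_mulrn => -[]; case: lam eta => [l1 l2] [e1 e2] /=.
have pz : p%:Z != 0 by rewrite eqz_nat -lt0n.
by move=> /(mulIf pz) -> /(mulIf pz) ->.
Qed.

Definition mu0_act n (r : 'M[k]_7 -> 'M[k]_n) : 'M[k]_n := wact r (fun lam => (pmult p lam)%:R).

Lemma dact_mu0 n (r : 'M[k]_7 -> 'M[k]_n) : rational r -> dact mu0 r = mu0_act r.
Proof. by move=> rP; apply: (dact_deq rP); exact: mu0_wfun. Qed.

Lemma mu0_act_idem n (r : 'M[k]_7 -> 'M[k]_n) : rational r -> mu0_act r *m mu0_act r = mu0_act r.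
Proof.
move=> rP; rewrite /mu0_act wactM //; congr wact; apply: functional_extensionality => lam.
by case: pmult; rewrite ?mulr1 ?mulr0.
Qed.

Lemma mu0_linear : linear_on_G2 mu0.
Proof. by case: mu0P => [[[/distT1_on_G2 H _] _ _] _]. Qed.

Lemma dact_mu0_corner n (r : 'M[k]_7 -> 'M[k]_n) nu : rational r -> is_dist nu ->
  dact (dmul mu0 (dmul nu mu0)) r = mu0_act r *m (dact nu r *m mu0_act r).
Proof.
move=> rP nuD; apply: (acts_byE rP).
have A0 : acts_by r mu0 (mu0_act r).
  by rewrite -dact_mu0 //; apply: (acts_by_dact rP); exact: mu0_linear.
apply: (acts_by_dmul rP) => //; first exact: mu0_linear.
apply: (acts_by_dmul rP) => //; first exact: dist_on_G2.
by apply: (acts_by_dact rP); exact: dist_on_G2.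
Qed.

(** Translates the definition by distributions into matrix identities, the form in which
    contractions are handled below; J is a left inverse of iota, so iota J is the identity on mu0
    M. *)
Lemma contraction_spec nM nN (M : 'M[k]_7 -> 'M[k]_nM) (N : 'M[k]_7 -> 'M[k]_nN) :
  rational M -> contraction mu0 phi M N ->
  exists (iota : 'M[k]_(nM, nN)) (J : 'M[k]_(nN, nM)),
  [/\ J *m iota = 1%:M, iota *m J *m mu0_act M = mu0_act M, mu0_act M *m iota = iota,
      forall gam s i, iota *m dpow N gam s i = mu0_act M *m (dpow M gam s (p * i) *m iota) &
      forall lam, iota *m wproj N lam = wproj M (lam *+ p) *m iota].
Proof.
move=> MP [NP [iota [inj im act]]]; rewrite dact_mu0 // in im.
have /row_fullP[J JK] : row_full iota.
  rewrite -cokermx_eq0; apply/eqP/matrixP => i j.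
  have : iota *m (cokermx iota *m delta_mx j 0) = iota *m (0 : 'cV_nN).
    by rewrite mulmxA mulmx_coker mul0mx mulmx0.
  by move=> /inj; rewrite -colE => /matrixP/(_ i 0); rewrite !mxE.
have eqv a b (A B : 'M[k]_(a, b)) : (forall w : 'cV_b, A *m w = B *m w) -> A = B.
  move=> AB; apply/matrixP => i j; have := AB (delta_mx j 0).
  by rewrite -!colE => /matrixP/(_ i 0); rewrite !mxE.
have A0J : iota *m J *m mu0_act M = mu0_act M.
  apply: eqv => w; rewrite -mulmxA.
  have [v ->] : exists v, mu0_act M *m w = iota *m v by apply/im; exists w.
  by rewrite -mulmxA (mulmxA J) JK mul1mx.
have A0i : mu0_act M *m iota = iota.
  apply: eqv => v; rewrite -mulmxA.
  have [w ->] : exists w, iota *m v = mu0_act M *m w by apply/im; exists v.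
  by rewrite mulmxA mu0_act_idem.
have actD gam s i : iota *m dpow N gam s i = mu0_act M *m (dpow M gam s (p * i) *m iota).
  rewrite /dpow act; last exact: divpow_dist.
  rewrite (dact_deq MP (phi_divpow phiP gam s i)) dact_mu0_corner //; last exact: divpow_dist.
  by rewrite -!mulmxA A0i.
have actH gam i : iota *m wact N (fun lam => binzk k (pairing gam lam) i) =
    mu0_act M *m (wact M (fun lam => binzk k (pairing gam lam) (p * i)) *m iota).
  rewrite /wact -(dact_deq NP (@hbinom_wfun k gam i)) act; last exact: hbinom_dist.
  rewrite (dact_deq MP (phi_hbinom phiP gam i)) dact_mu0_corner //; last exact: hbinom_dist.
  by rewrite (dact_deq MP (@hbinom_wfun k gam (p * i))) -!mulmxA A0i.
(* By Lucas' congruence binom(h_gam, i) acts on z by binom(<lam, gam^vee>, i). A nonzero component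
   of z at eta must have the same eigenvalues, so [binzk_inj] for both simple coroots gives eta =
   lam. *)
have wt lam z : weight_vector M (lam *+ p) (iota *m z) -> weight_vector N lam z.
  move=> zP; apply/weight_vectorP => //; apply: wproj_only => // eta; apply: contraNeq => ez.
  have Hn gam i : binzk k (pairing gam eta) i = binzk k (pairing gam lam) i.
    have : wact N (fun lam => binzk k (pairing gam lam) i) *m z = binzk k (pairing gam lam) i *: z.
      rewrite -[LHS]mul1mx -JK -mulmxA (mulmxA iota) actH -!mulmxA.
      rewrite (wact_weight MP _ zP) -!scalemxAr (mulmxA _ iota) A0i mulmxA JK mul1mx.
      congr (_ *: _); rewrite -[RHS](binzk_Lucas pcharkp); congr (binzk _ _ _).
      by rewrite [RHS]int_mulrn weight_mulrn; case: (gam).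
    move=> /(congr1 (mulmx (wproj N eta))); rewrite mulmxA -scalemxAr.
    rewrite /wproj (wactM _ _ NP) -/(wproj N eta).
    have -> : wact N (fun lam0 => (lam0 == eta)%:R * binzk k (pairing gam lam0) i) =
        binzk k (pairing gam eta) i *: wproj N eta.
      apply: (eq_on_weights NP) => nu y yP; rewrite -scalemxAl !(wact_weight NP _ yP) scalerA.
      by rewrite mulrC; case: eqP => [->|]; rewrite ?mulr0.
    rewrite -scalemxAl => /eqP; rewrite -subr_eq0 -scalerBl scaler_eq0 (negbTE ez) orbF subr_eq0.
    by move/eqP.
  have Hp gam : pairing gam eta = pairing gam lam.
    by apply: (@binzk_inj k) => i; exact: Hn.
  by case: lam eta Hp {zP ez Hn} => [l1 l2] [e1 e2] Hp; rewrite (Hp Ralpha : e1 = l1) (Hp Rbeta : e2 = l2).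
exists iota, J; split=> // lam; have [S [_ _ S1]] := wproj_sum MP.
(* The two sides are compared on the weight components of M: those at nu outside p Lambda do not
   meet the image of iota, and the others come from weight vectors of N by [wt]. *)
transitivity (\sum_(nu <- S) iota *m wproj N lam *m (J *m (wproj M nu *m iota))).
  by rewrite -!mulmx_sumr -mulmx_suml S1 mul1mx JK mulmx1.
transitivity (\sum_(nu <- S) wproj M (lam *+ p) *m (wproj M nu *m iota)); last first.
  by rewrite -mulmx_sumr -mulmx_suml S1 mul1mx.
apply: eq_bigr => nu _; apply: eqv => z.
have [/pmultP[eta nuE]|nup] := boolP (pmult p nu); last first.
  have -> : wproj M nu *m iota = 0.
    rewrite -A0i mulmxA; suff -> : wproj M nu *m mu0_act M = 0 by rewrite mul0mx.
    rewrite /wproj /mu0_act (wactM _ _ MP); apply: (eq_on_weights MP) => mu y yP.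
    rewrite (wact_weight MP _ yP) mul0mx; case: eqP => [->|_]; last by rewrite mul0r scale0r.
    by rewrite (negbTE nup) mulr0 scale0r.
  by rewrite !mulmx0 !mul0mx.
pose zz := J *m (wproj M nu *m (iota *m z)).
have iz : iota *m zz = wproj M nu *m (iota *m z).
  have comm : wproj M nu *m mu0_act M = mu0_act M *m wproj M nu.
    by rewrite /wproj /mu0_act !(wactM _ _ MP); congr wact; apply: functional_extensionality => ?; rewrite mulrC.
  have H : wproj M nu *m iota = mu0_act M *m (wproj M nu *m iota).
    by rewrite -{1}A0i mulmxA comm -mulmxA.
  have H2 : iota *m J *m (wproj M nu *m iota) = wproj M nu *m iota by rewrite H mulmxA A0J.
  by rewrite /zz; have := congr1 (mulmx^~ z) H2; rewrite /= -!mulmxA.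
have zzP : weight_vector N eta zz by apply: wt; rewrite iz -nuE; exact: wproj_weight.
have -> : iota *m wproj N lam *m (J *m (wproj M nu *m iota)) *m z = iota *m (wproj N lam *m zz).
  by rewrite /zz -!mulmxA.
have -> : wproj M (lam *+ p) *m (wproj M nu *m iota) *m z = wproj M (lam *+ p) *m (iota *m zz).
  by rewrite iz -!mulmxA.
have iP : weight_vector M (eta *+ p) (iota *m zz) by rewrite iz -nuE; exact: wproj_weight.
have [<-|ne] := eqVneq eta lam.
  by rewrite (proj1 (weight_vectorP NP _ _) zzP) (proj1 (weight_vectorP MP _ _) iP).
rewrite (wproj_diff NP zzP) // mulmx0 (wproj_diff MP iP) //.
by apply: contra ne => /eqP/mulrpI ->.
Qed.

End Contraction.

(** * Frobenius contraction *)

Section PrimitiveVectors.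
Variables (k : closedFieldType) (n : nat) (r : 'M[k]_7 -> 'M[k]_n).
Hypothesis rP : rational r.

Lemma dpow_EF_primitive gam mu y (a b e : nat) : weight_vector r mu y ->
  (forall i, (0 < i <= a)%N -> dpow r gam true i *m y = 0) ->
  pairing gam mu + a%:Z = e%:Z + b%:Z ->
  dpow r gam true a *m (dpow r gam false b *m y) =
  if (a <= b)%N then 'C(e, a)%:R *: (dpow r gam false (b - a) *m y) else 0.
Proof.
move=> yP y0 eE; rewrite (dpow_EF rP yP eE) big_ord_recr /= subnn dpow0 // mul1mx.
rewrite big1 ?add0r => [|j _]; first by case: ifP; rewrite ?scaler0.
by case: ifP; rewrite ?scaler0 // y0 ?mulmx0 ?scaler0 // subn_gt0 ltn_ord leq_subr.
Qed.

Lemma dpow_E1F1 gam mu y (m : nat) : weight_vector r mu y ->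
  dpow r gam true 1 *m y = 0 -> pairing gam mu = m%:Z ->
  dpow r gam true 1 *m (dpow r gam false 1 *m y) = m%:R *: y.
Proof.
move=> yP y0 mE; rewrite (@dpow_EF_primitive gam mu y 1 1 m) ?mE //; last first.
  by case=> [|[|i]] //.
by rewrite /= subnn dpow0 // mul1mx bin1.
Qed.

Lemma wproj_torus lam a b : a != 0 -> b != 0 ->
  wproj r lam *m r (torus a b) = wchar lam a b *: wproj r lam.
Proof.
move=> a0 b0; apply: (eq_on_weights rP) => eta y yP.
rewrite -mulmxA yP // -scalemxAr -scalemxAl !(wact_weight rP _ yP) !scalerA.
by case: eqP => [->|_]; rewrite ?mulr0 // mulrC.
Qed.

Lemma torus_wproj lam a b : a != 0 -> b != 0 ->
  r (torus a b) *m wproj r lam = wchar lam a b *: wproj r lam.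
Proof.
move=> a0 b0; rewrite -wproj_torus //; apply: (eq_on_weights rP) => eta y yP.
rewrite -!mulmxA (wact_weight rP _ yP) -scalemxAr (yP a b) // -scalemxAr (wact_weight rP _ yP).
by rewrite !scalerA mulrC.
Qed.

End PrimitiveVectors.

Section ContractionConsequences.
Variables (k : closedFieldType) (p : nat).
Hypothesis pcharkp : p \in [pchar k].
Variables (mu0 : @functional k) (phi : @functional k -> @functional k).
Hypotheses (mu0P : is_mu0 p mu0) (phiP : contraction_hom p mu0 phi).

Lemma mu0_act_weight n (r : 'M[k]_7 -> 'M[k]_n) lam y : rational r ->
  weight_vector r (lam *+ p) y -> mu0_act p r *m y = y.
Proof.
move=> rP yP; rewrite /mu0_act (wact_weight rP _ yP).
by case: pmultP => [_|[]]; [rewrite scale1r | exists lam].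
Qed.

(** The simple roots are indivisible in the weight lattice; the witnesses express i as a Bezout
    combination of the coordinates. *)
Lemma pmult_root gam s i : pmult p (root_weight gam s *+ i) -> (p %| i)%N.
Proof.
rewrite /pmult weight_mulrn => /andP[/dvdzP[a Ha] /dvdzP[b Hb]].
have : (p %| i%:Z)%Z.
  apply/dvdzP; case: gam s Ha Hb => [] [] /= Ha Hb.
  - by exists (- b); lia.
  - by exists b; lia.
  - by exists (- a - b); lia.
  - by exists (a + b); lia.
by rewrite dvdzE.
Qed.

Lemma mu0_act_dpow n (r : 'M[k]_7 -> 'M[k]_n) gam s i : rational r -> ~~ (p %| i)%N ->
  mu0_act p r *m dpow r gam s i *m mu0_act p r = 0.
Proof.
move=> rP pi; apply: (eq_on_weights rP) => lam y yP.
rewrite mul0mx -!mulmxA (wact_weight rP _ yP) -!scalemxAr.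
rewrite (wact_weight rP _ (dpow_weight rP gam s i yP)) scalerA -natrM mulnb.
case: andP => [[d1 d2]|]; last by rewrite scale0r.
case/negP: pi; apply: (@pmult_root gam s).
have := d2; move: d1; rewrite /pmult /= => /andP[a1 a2] /andP[b1 b2].
by rewrite -(rpredDr _ a1) addrC b1 -(rpredDr _ a2) addrC b2.
Qed.

Section Spec.
Variables (nM nN : nat) (M : 'M[k]_7 -> 'M[k]_nM) (N : 'M[k]_7 -> 'M[k]_nN).
Hypotheses (MP : rational M) (NP : rational N).
Variables (iota : 'M[k]_(nM, nN)) (J : 'M[k]_(nN, nM)).
Hypotheses (JK : J *m iota = 1%:M) (iJ : iota *m J *m mu0_act p M = mu0_act p M).
Hypothesis A0i : mu0_act p M *m iota = iota.
Hypothesis iD : forall gam s i,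
  iota *m dpow N gam s i = mu0_act p M *m (dpow M gam s (p * i) *m iota).
Hypothesis iW : forall lam, iota *m wproj N lam = wproj M (lam *+ p) *m iota.

Lemma iota_inj (y : 'cV[k]_nN) : iota *m y = 0 -> y = 0.
Proof. by move=> H; rewrite -[y]mul1mx -JK -mulmxA H mulmx0. Qed.

Lemma contraction_weight lam (y : 'cV[k]_nN) :
  weight_vector N lam y <-> weight_vector M (lam *+ p) (iota *m y).
Proof.
split=> [/(weight_vectorP NP) yE|/(weight_vectorP MP) yE]; first rewrite -yE.
  by rewrite mulmxA iW -mulmxA; exact: wproj_weight.
apply/weight_vectorP => //; apply/eqP; rewrite -subr_eq0; apply/eqP; apply: iota_inj.
by rewrite mulmxBr mulmxA iW -mulmxA yE subrr.
Qed.

Lemma contraction_lift lam z : weight_vector M (lam *+ p) z ->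
  iota *m (J *m z) = z /\ weight_vector N lam (J *m z).
Proof.
move=> zP; have iz : iota *m (J *m z) = z.
  by rewrite mulmxA -{2}(mu0_act_weight MP zP) -iJ -!mulmxA (mu0_act_weight MP zP).
by split=> //; apply/contraction_weight; rewrite iz.
Qed.

Lemma contraction_dpow gam s i lam (y : 'cV[k]_nN) : weight_vector N lam y ->
  iota *m (dpow N gam s i *m y) = dpow M gam s (p * i) *m (iota *m y).
Proof.
move=> yP; rewrite mulmxA iD -!mulmxA.
apply: (mu0_act_weight (lam := lam + root_weight gam s *+ i)) => //.
rewrite mulrnDl -mulrnA mulnC; apply: dpow_weight => //.
by apply/contraction_weight.
Qed.

(** Between two copies of mu0 only the divided powers of order p j survive, and these are the
    divided powers of order j on N. Since k has p-th roots, this describes all root elements on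
    N. *)
Lemma contraction_xroot gam s t :
  iota *m N (xroot gam s (t ^+ p)) = mu0_act p M *m (M (xroot gam s t) *m iota).
Proof.
have p0 := prime_gt0 (pcharf_prime pcharkp).
have [K [DN XN]] := rep_xroot_wide NP gam s.
have [K' [DM XM]] := rep_xroot_wide MP gam s.
have Z i : ~~ (p %| i)%N -> mu0_act p M *m (dpow M gam s i *m iota) = 0.
  by move=> pi; rewrite -A0i !mulmxA mu0_act_dpow // mul0mx.
pose B := (K + K')%N.
rewrite (XN B) ?leq_addr // mulmx_sumr.
rewrite (XM (p * B)%N); last by rewrite (leq_trans (leq_addl K K')) // leq_pmull.
rewrite mulmx_suml mulmx_sumr.
rewrite -(sum_dvd B (fun j => iota *m ((t ^+ p) ^+ j *: dpow N gam s j)) p0).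
apply: eq_bigr => i _; case: ifP => [/dvdnP[j ->]|/negbT pi].
  by rewrite mulnK // -!scalemxAr -!scalemxAl -scalemxAr iD [(j * p)%N]mulnC exprM.
by rewrite -scalemxAl -scalemxAr Z ?scaler0.
Qed.

End Spec.
End ContractionConsequences.

(** * Contraction of L tensored with a Frobenius twist *)

Section TensorContraction.
Variables (k : closedFieldType) (p : nat).
Hypothesis pcharkp : p \in [pchar k].
Variables (mu0 : @functional k) (phi : @functional k -> @functional k).
Hypotheses (mu0P : is_mu0 p mu0) (phiP : contraction_hom p mu0 phi).
Variables (nL nS : nat) (L : 'M[k]_7 -> 'M[k]_nL) (St : 'M[k]_7 -> 'M[k]_nS).
Hypotheses (LP : rational L) (SP : rational St).

Local Notation T := (tensor L (twist p St)).

Lemma tensor_twistP : rational T.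
Proof. exact: tensor_rational LP (twist_rational pcharkp SP). Qed.

(** T_1 acts trivially on a twist: the entries of St minus those of the identity vanish at 1, so mu0
    kills the multiples of their composites with Frobenius. *)
Lemma mu0_act_tensor : mu0_act p T = mu0_act p L *t 1%:M.
Proof.
have TP := tensor_twistP; have muG := mu0_linear mu0P.
rewrite -(dact_mu0 pcharkp mu0P TP) -(dact_mu0 pcharkp mu0P LP).
have [[[[lin ext per] _] _ _] _] := mu0P.
apply/matrixP => i j; case: (mxtens_indexP i) => i1 i2; case: (mxtens_indexP j) => j1 j2.
rewrite tensmxE mxE [dact _ _ _ _]mxE [1%:M _ _]mxE.
pose d : k := (i2 == j2)%:R; pose f1 g := - d + St g i2 j2.
have rS : regular (fun g => St g i2 j2) by exact: rep_regular.
have rL : regular (fun g => L g i1 j1) by exact: rep_regular.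
have r1 : regular f1 by apply: regularD => //; exact: regular_const.
have f10 : f1 1%:M = 0 by rewrite /f1 rep1 // mxE addNr.
have := per f1 _ r1 rL f10.
have rF := regularM (regular_Frob pcharkp r1) rL.
have := lin d _ _ rL rF => /[swap] -> ; rewrite addr0 mulrC => <-.
apply: (proj2 muG) => [||g Gg].
- exact: (rep_regular TP).
- by apply: regularD => //; exact: regularZ.
by rewrite /tensor tensmxE /twist /f1; ring.
Qed.

(** Both iota and iota' *t 1 are injective with image mu0 T, and P is the resulting comparison
    map. *)
Lemma contraction_tensor nN nN' (N : 'M[k]_7 -> 'M[k]_nN) (N' : 'M[k]_7 -> 'M[k]_nN') :
  contraction mu0 phi T N -> contraction mu0 phi L N' -> isomorphic N (tensor N' St).
Proof.
move=> cN cN'; have NP := proj1 cN; have NP' := proj1 cN'.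
have TP := tensor_twistP.
have [iota [J [JK iJ A0i iD iW]]] := contraction_spec pcharkp mu0P phiP TP cN.
have [iota' [J' [JK' iJ' A0i' iD' iW']]] := contraction_spec pcharkp mu0P phiP LP cN'.
have A0T : mu0_act p T *m (iota' *t 1%:M) = iota' *t 1%:M.
  by rewrite mu0_act_tensor tensmx_mul A0i' mulmx1.
have iJT : iota *m J *m (iota' *t 1%:M) = iota' *t 1%:M by rewrite -A0T mulmxA iJ.
have iotaE : ((iota' *m J') *t 1%:M) *m iota = iota.
  by rewrite -A0i mulmxA mu0_act_tensor tensmx_mul iJ' mulmx1.
pose P := (J' *t 1%:M) *m iota; pose Q := J *m (iota' *t 1%:M).
exists P, Q; split=> [||g].
- by rewrite /P /Q -mulmxA (mulmxA iota) iJT tensmx_mul JK' mulmx1 tensmx11.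
- by rewrite /P /Q -mulmxA (mulmxA (iota' *t _)) tensmx_mul mulmx1 iotaE JK.
elim=> [|g1 g2 G1 IH1 G2' IH2|gam s u].
- by rewrite /tensor !rep1 // tensmx11 mulmx1 mul1mx.
- have TN : rational (tensor N' St) by exact: tensor_rational.
  by rewrite (repM NP) // (repM TN) // mulmxA IH1 -mulmxA IH2 mulmxA.
(* With u = t^p, [contraction_xroot] describes x_gam(u) on N and on N', while x_gam(t) acts on the
   twisted factor as x_gam(u) on St. *)
have [t tu] := pth_root pcharkp u.
have TX : T (xroot gam s t) = L (xroot gam s t) *t St (xroot gam s u).
  by rewrite /tensor /twist (Frob_xroot pcharkp) tu.
have iX := contraction_xroot pcharkp TP NP A0i iD gam s t; rewrite tu in iX.
have iX' := contraction_xroot pcharkp LP NP' A0i' iD' gam s t; rewrite tu in iX'.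
rewrite /P -mulmxA iX TX -{1}iotaE !mulmxA mu0_act_tensor !tensmx_mul.
rewrite !mulmx1 !mul1mx -(mulmxA J') -(mulmxA J') -!mulmxA (mulmxA (L _)).
by rewrite (mulmxA (mu0_act p L)) -iX' !mulmxA JK' mul1mx.
Qed.

Lemma tensor_twist_weight ka z : z != 0 -> weight_vector T ka z ->
  exists lam eta, [/\ ka = lam + eta *+ p,
    (exists2 x, x != 0 & weight_vector L lam x) &
    (exists2 y, y != 0 & weight_vector St eta y)].
Proof.
move=> z0 zP; have TP := tensor_twistP.
have [SL [_ _ SL1]] := wproj_sum LP; have [SS [_ _ SS1]] := wproj_sum SP.
have [lam [eta ne]] : exists lam eta, (wproj L lam *t wproj St eta) *m z != 0.
  apply: NNPP => H; case/eqP: z0; apply: unvec_inj.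
  have E lam eta : wproj L lam *m unvec z *m (wproj St eta)^T = 0.
    rewrite -unvec_tens; have -> : (wproj L lam *t wproj St eta) *m z = 0.
      by apply: NNPP => /eqP ne; apply: H; exists lam, eta.
    by apply/matrixP => i j; rewrite !mxE.
  have -> : unvec z = \sum_(lam <- SL) wproj L lam *m unvec z *m (\sum_(eta <- SS) wproj St eta)^T.
    by rewrite SS1 trmx1 -mulmx_suml mulmx1 -mulmx_suml SL1 mul1mx.
  rewrite big1 => [|lam _]; first by apply/matrixP => i j; rewrite !mxE.
  by rewrite linear_sum mulmx_sumr big1 // => eta _; exact: E.
exists lam, eta; split; last first.
- apply/(wproj_neq0 _ SP); apply: contraNneq ne => ->; by rewrite tensmx0 mul0mx.
- apply/(wproj_neq0 _ LP); apply: contraNneq ne => ->; by rewrite tens0mx mul0mx.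
set w := (_ *m z) in ne.
have wP : weight_vector T (lam + eta *+ p) w.
  move=> a b a0 b0; rewrite /w /tensor /twist (Frob_torus pcharkp) mulmxA tensmx_mul.
  rewrite (torus_wproj LP) // (torus_wproj SP) ?expf_neq0 // wcharD // wcharMn.
  apply: unvec_inj; rewrite unvec_tens unvecZ unvec_tens linearZ -!scalemxAl -!scalemxAr.
  by rewrite scalerA.
have wP' : weight_vector T ka w.
  move=> a b a0 b0; rewrite wP //.
  have Tab := zP a b a0 b0; rewrite /w [in RHS]scalemxAr -Tab mulmxA /tensor /twist (Frob_torus pcharkp) tensmx_mul.
  rewrite (wproj_torus LP) // (wproj_torus SP) ?expf_neq0 // wcharD // wcharMn.
  apply: unvec_inj; rewrite unvecZ !unvec_tens linearZ -!scalemxAl -!scalemxAr.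
  by rewrite scalerA.
exact: (weight_unique TP wP' wP ne).
Qed.

End TensorContraction.

(* If pka = zeta + p eta with zeta <= p varpi_alpha + beta and
   eta <= (p - 1) rho, then ka <= varpi_alpha + (p - 1) rho. *)
Lemma tensor_weight_bound (p i j i' j' : nat) (z1 z2 k1 k2 e1 e2 : int) : (3 <= p)%N ->
  p%:Z - 3%:Z = z1 + 2%:Z * i%:Z - 3%:Z * j%:Z -> 2%:Z = z2 - i%:Z + 2%:Z * j%:Z ->
  k1 * p%:Z = z1 + e1 * p%:Z -> k2 * p%:Z = z2 + e2 * p%:Z ->
  p%:Z - 1 = e1 + 2%:Z * i'%:Z - 3%:Z * j'%:Z -> p%:Z - 1 = e2 - i'%:Z + 2%:Z * j'%:Z ->
  exists a b : nat, p%:Z = k1 + 2%:Z * a%:Z - 3%:Z * b%:Z /\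
                    p%:Z - 1 = k2 - a%:Z + 2%:Z * b%:Z.
Proof.
move=> p3 H1 H2 E1 E2 H3 H4.
have Z1 : z1 = p%:Z * (k1 - e1) by rewrite mulrBr ![p%:Z * _]mulrC E1 addrK.
have Z2 : z2 = p%:Z * (k2 - e2) by rewrite mulrBr ![p%:Z * _]mulrC E2 addrK.
(* A and B are the coordinates of varpi_alpha - (ka - eta) in the simple roots. As lam = p
   varpi_alpha + beta, they satisfy i = p A and j = p B + 1, and so are nonnegative because p >
   1. *)
pose A := 2%:Z - 2%:Z * (k1 - e1) - 3%:Z * (k2 - e2).
pose B := 1 - (k1 - e1) - 2%:Z * (k2 - e2).
have F1 : i%:Z = p%:Z * A.
  have -> : i%:Z = 2%:Z * (p%:Z - 3%:Z - z1) + 3%:Z * (2%:Z - z2) by lia.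
  by rewrite Z1 Z2 /A; ring.
have F2 : j%:Z = p%:Z * B + 1.
  have -> : j%:Z = (p%:Z - 3%:Z - z1) + 2%:Z * (2%:Z - z2) by lia.
  by rewrite Z1 Z2 /B; ring.
have A0 : 0 <= A by clear -p3 F1; nia.
have B0 : 0 <= B by clear -p3 F2; nia.
exists (absz A + i')%N, (absz B + j')%N; rewrite !PoszD !gez0_abs //.
by clear -H3 H4; split; rewrite /A /B; lia.
Qed.

(** * The two contractions that are not semisimple *)

Section NonSemisimple.
Variables (k : closedFieldType) (p : nat).
Hypothesis pcharkp : p \in [pchar k].
Variables (mu0 : @functional k) (phi : @functional k -> @functional k).
Hypotheses (mu0P : is_mu0 p mu0) (phiP : contraction_hom p mu0 phi).

Lemma tvecZr n1 n2 (x : 'cV[k]_n1) c (y : 'cV[k]_n2) : tvec x (c *: y) = c *: tvec x y.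
Proof. by apply: unvec_inj; rewrite unvecZ !unvec_tvec linearZ -scalemxAr. Qed.

Lemma tvec_sumr n1 n2 (x : 'cV[k]_n1) m (F : 'I_m -> 'cV[k]_n2) :
  tvec x (\sum_i F i) = \sum_i tvec x (F i).
Proof.
apply/matrixP => i z; rewrite (ord1 z) summxE; case: (mxtens_indexP i) => i1 i2.
by rewrite tvecE summxE mulr_sumr; apply: eq_bigr => j _; rewrite tvecE.
Qed.

Lemma highest_weight_top n (r : 'M[k]_7 -> 'M[k]_n) lam : rational r -> highest_weight r lam ->
  exists v, [/\ v != 0, weight_vector r lam v, upper_fixed r v &
    forall gam i, (0 < i)%N -> dpow r gam true i *m v = 0].
Proof.
move=> rP [[v v0 vP] top]; exists v; have vU := top_upper_fixed rP top vP.
by split=> //; apply/upper_fixedP.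
Qed.

(* The vector y = x_(-beta) v (x) v_St has weight p varpi_alpha + p (p - 1) rho, the
   largest one of the module which lies in p Lambda; in the contraction it has
   weight varpi_alpha + (p - 1) rho, hence x_alpha x_(-alpha) y = p y = 0, while
   x_(-alpha) y is nonzero because x_(-alpha) v_St is. *)
Lemma contraction_tensor_not_semisimple nL nS (L : 'M[k]_7 -> 'M[k]_nL)
    (St : 'M[k]_7 -> 'M[k]_nS) nN (N : 'M[k]_7 -> 'M[k]_nN) : (3 <= p)%N ->
  rational L -> highest_weight L (varpi_alpha *+ (p - 3) + varpi_beta *+ 2) ->
  rational St -> highest_weight St (rho *+ (p - 1)) ->
  contraction mu0 phi (tensor L (twist p St)) N -> ~ semisimple_module N.
Proof.
move=> p3 LP Lhw SP Shw cN Nss.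
have p0 : (0 < p)%N by apply: leq_trans p3.
have NP := proj1 cN; have TP := tensor_twistP pcharkp LP SP.
have [iota [J [JK iJ A0i iD iW]]] := contraction_spec pcharkp mu0P phiP TP cN.
set lam := varpi_alpha *+ (p - 3) + varpi_beta *+ 2 in Lhw.
have lamE : lam = (p%:Z - 3%:Z, 2%:Z).
  by rewrite /lam !weight_mulrn; congr (_, _); rewrite /=; lia.
have rhoE' : rho *+ (p - 1) = (p%:Z - 1, p%:Z - 1).
  by rewrite weight_mulrn; congr (_, _); rewrite /=; lia.
have [v [v0 vP vU vE]] := highest_weight_top LP Lhw.
have [sv [sv0 svP svU svE]] := highest_weight_top SP Shw.
have [_ Ltop] := Lhw; have [_ Stop] := Shw.
have two0 := pchar_two_neq0 pcharkp p3.
pose x := dpow L Rbeta false 1 *m v.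
have xP : weight_vector L (varpi_alpha *+ p) x.
  have -> : varpi_alpha *+ p = lam + root_weight Rbeta false *+ 1.
    by rewrite lamE !weight_mulrn; congr (_, _); rewrite /=; lia.
  exact: dpow_weight.
have x0 : x != 0.
  have := dpow_E1F1 (gam := Rbeta) (m := 2) LP vP (vE _ 1%N isT).
  rewrite lamE => /(_ erefl) H; apply: contraNneq v0 => x0.
  by move: H; rewrite -/x x0 mulmx0 => /esym/eqP; rewrite scaler_eq0 (negbTE two0).
pose s1 := dpow St Ralpha false 1 *m sv.
have s10 : s1 != 0.
  have := dpow_E1F1 (gam := Ralpha) (m := (p - 1)%N) SP svP (svE _ 1%N isT).
  rewrite rhoE' /= => /(_ _) H; apply: contraNneq sv0 => s10.
  have {}H : (p - 1)%:R *: sv = 0 by rewrite -H ?mulmx0 // -/s1 ?s10 ?mulmx0 //; lia.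
  move/eqP: H; rewrite scaler_eq0 -(dvdn_pcharf pcharkp) gtnNdvd //; lia.
pose nu := varpi_alpha + rho *+ (p - 1).
have nuE : nu = (p%:Z, p%:Z - 1) by rewrite /nu rhoE'; congr (_, _); rewrite /=; lia.
pose z := tvec x sv.
have zP : weight_vector (tensor L (twist p St)) (nu *+ p) z.
  move=> a b a0 b0; rewrite /tensor /twist (Frob_torus pcharkp) tens_tvec xP // svP ?expf_neq0 //.
  have -> : nu *+ p = varpi_alpha *+ p + (rho *+ (p - 1)) *+ p by exact: mulrnDl.
  rewrite wcharD // (wcharMn (rho *+ (p - 1)) p).
  by apply: unvec_inj; rewrite unvecZ !unvec_tvec linearZ -scalemxAl -scalemxAr scalerA.
have [iz yP] := contraction_lift TP NP JK iJ iW zP.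
set y := J *m z in iz yP.
have Ntop ka w : w != 0 -> weight_vector N ka w -> weight_le ka nu.
  move=> w0 /(contraction_weight TP NP JK iW) wP.
  have iw0 : iota *m w != 0 by apply: contraNneq w0 => /(iota_inj JK) ->.
  have [ze [eta [E [x' x'0 x'P] [y' y'0 y'P]]]] := tensor_twist_weight pcharkp LP SP iw0 wP.
  have /weight_leP[i [j [H1 H2]]] := Ltop _ _ x'0 x'P.
  have /weight_leP[i' [j' [H3 H4]]] := Stop _ _ y'0 y'P.
  move: E; rewrite !weight_mulrn; case: ze H1 H2 {x'P} => [z1 z2]; rewrite lamE /= => H1 H2 [E1 E2].
  rewrite rhoE' /= in H3 H4.
  have [a [b [F1 F2]]] := tensor_weight_bound p3 H1 H2 E1 E2 H3 H4.
  by apply/weight_leP; rewrite nuE; exists a, b.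
have yE gam i : (0 < i)%N -> dpow N gam true i *m y = 0.
  have /upper_fixedP H := top_upper_fixed NP Ntop yP; exact: H.
pose u := dpow N Ralpha false 1 *m y.
have uP : weight_vector N (nu + root_weight Ralpha false *+ 1) u by exact: dpow_weight.
have uU : upper_fixed N u.
  apply/upper_fixedP => // gam i i0; apply: NNPP => /eqP ne.
  have := Ntop _ _ ne (dpow_weight NP gam true i uP).
  (* The weight nu - alpha + i gam is not below nu if gam = beta, and only for i = 1 if gam = alpha,
     where the coefficient <nu, alpha^vee> = p is zero in k. *)
  case: gam ne => ne /weight_leP[a [b]]; rewrite !weight_mulrn nuE /= => -[H1 H2]; last by clear -H1 H2 i0; lia.
  have i1 : i = 1%N by clear -H1 H2 i0; lia.
  have nu_p : pairing Ralpha nu = p%:Z by rewrite nuE.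
  move: ne; rewrite i1 /u (dpow_E1F1 NP yP (yE Ralpha 1%N isT) nu_p).
  by rewrite (pcharf0 pcharkp) scale0r eqxx.
have := semisimple_descent NP Nss yP (isT : (0 < 1)%N) uU; rewrite -/u => u0.
have Dz : dpow (tensor L (twist p St)) Ralpha false p *m z = 0.
  by have := contraction_dpow TP NP JK iD iW Ralpha false 1 yP; rewrite iz -/u u0 mulmx0 muln1.
have [K [DT XT]] := rep_xroot_wide TP Ralpha false.
have [K' [DS XS]] := rep_xroot_wide SP Ralpha false.
have [K2 [DL XL]] := rep_xroot_wide LP Ralpha false.
(* [W] restores x in the first factor, so that x_(-alpha)(t) z becomes x tensored with
   x_(-alpha)(t^p) v_St, whose coefficient at t^p is x tensored with [s1]. *)
pose W : 'M[k]_(nL * nS) := wproj L (varpi_alpha *+ p) *t 1%:M.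
have Lx t : wproj L (varpi_alpha *+ p) *m (L (xroot Ralpha false t) *m x) = x.
  rewrite (XL K2.+1) // mulmx_suml mulmx_sumr big_ord_recl expr0 scale1r dpow0 // mul1mx.
  rewrite (proj1 (weight_vectorP LP _ _) xP) big1 ?addr0 // => i _.
  rewrite -scalemxAl -scalemxAr (wproj_diff LP (dpow_weight LP _ _ _ xP)) ?scaler0 //.
  apply/eqP => H; have := H; rewrite -[RHS]addr0 => /addrI.
  by move/(@root_weight_inj _ _ _ 0).
have coef := @mx_poly_inj k _ 1 K (p * K') (fun i => W *m (dpow (tensor L (twist p St)) Ralpha false i *m z))
  (fun i => if (p %| i)%N then tvec x (dpow St Ralpha false (i %/ p) *m sv) else 0) [::].
have : 0 = tvec x s1.
  have /(_ _ _ _ p) := coef; rewrite Dz mulmx0 dvdnn divnn p0; apply=> [i /DT ->|i|t _].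
  - by rewrite mul0mx mulmx0.
  - case: ifP => // /dvdnP[j ->]; rewrite mulnC leq_pmul2r // mulnK // => /DS ->.
    by rewrite mul0mx -[0](scale0r sv) tvecZr scale0r.
  transitivity (W *m (tensor L (twist p St) (xroot Ralpha false t) *m z)).
    rewrite (XT K) // mulmx_suml mulmx_sumr; apply: eq_bigr => i _.
    by rewrite -scalemxAl -scalemxAr.
  rewrite /tensor /twist (Frob_xroot pcharkp) !tens_tvec mul1mx Lx (XS K') // mulmx_suml tvec_sumr.
  rewrite -(sum_dvd K' (fun j => tvec x ((t ^+ p) ^+ j *: dpow St Ralpha false j *m sv)) p0).
  apply: eq_bigr => i _; case: ifP => [/dvdnP[j ->]|]; last by rewrite scaler0.
  by rewrite mulnK // -scalemxAl tvecZr -exprM [(p * j)%N]mulnC.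
by move/esym/eqP; apply/negP; exact: tvec_neq0.
Qed.

(* With y = F_beta^(2) F_alpha^(3) F_beta v, of weight 2 alpha, the vector
   F_alpha^(2) y is nonzero since E_alpha E_beta^(2) E_alpha^(4) E_beta maps it to
   9 v. In the contraction y has weight alpha, and F_alpha y is fixed by U^+. *)
Lemma contraction_steinberg_not_semisimple nL (L : 'M[k]_7 -> 'M[k]_nL)
    nN (N : 'M[k]_7 -> 'M[k]_nN) : p = 2%N ->
  rational L -> highest_weight L rho -> contraction mu0 phi L N -> ~ semisimple_module N.
Proof.
move=> p2 LP Lhw cN Nss; have NP := proj1 cN.
have [iota [J [JK iJ A0i iD iW]]] := contraction_spec pcharkp mu0P phiP LP cN.
have [v [v0 vP vU vE]] := highest_weight_top LP Lhw.
have [_ Ltop] := Lhw.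
have two0 : 2%:R = 0 :> k by rewrite -p2 (pcharf0 pcharkp).
pose E gam i := dpow L gam true i; pose F gam i := dpow L gam false i.
have comm gam i j (w : 'cV[k]_nL) : E gam i *m (F (other_root gam) j *m w) = F (other_root gam) j *m (E gam i *m w).
  by rewrite !mulmxA /E /F dpow_comm.
have Fwt gam i mu ka w : weight_vector L mu w -> mu + root_weight gam false *+ i = ka ->
    weight_vector L ka (F gam i *m w) by move=> wP <-; exact: dpow_weight.
pose wt (a b : int) : weight := (a, b).
have wtE (a b a' b' : int) i gam : a + (root_weight gam false).1 * i%:Z = a' ->
    b + (root_weight gam false).2 * i%:Z = b' -> wt a b + root_weight gam false *+ i = wt a' b'.
  by move=> <- <-; rewrite weight_mulrn.
pose v1 := F Rbeta 1%N *m v; pose v2 := F Ralpha 3 *m v1; pose v3 := F Rbeta 2 *m v2.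
have v1P : weight_vector L (wt 4 (-1)) v1 by apply: (Fwt _ _ _ _ _ vP); exact: (@wtE 1 1).
have v2P : weight_vector L (wt (-2) 2) v2 by apply: (Fwt _ _ _ _ _ v1P); exact: wtE.
have v3P : weight_vector L (wt 4 (-2)) v3 by apply: (Fwt _ _ _ _ _ v2P); exact: wtE.
have v1E i : (0 < i)%N -> E Ralpha i *m v1 = 0.
  by move=> i0; rewrite /v1 (comm Ralpha) vE // mulmx0.
(* The reflection s_alpha takes rho - 3 alpha to rho + 2 alpha, which is not below rho. *)
have F3v : F Ralpha 3 *m v = 0.
  apply: NNPP => /eqP ne; have wP : weight_vector L (wt (-5) 4) (F Ralpha 3 *m v).
    by apply: (Fwt _ _ _ _ _ vP); exact: (@wtE 1 1).
  have [z z0 zP] := refl_weight LP Ralpha wP ne.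
  have /weight_leP[i [j []]] := Ltop _ _ z0 zP.
  by clear; rewrite /=; lia.
have v2E : E Rbeta 1%N *m v2 = 0.
  rewrite /v2 (comm Rbeta) /v1 /E /F (dpow_E1F1 (m := 1) LP vP (vE _ 1%N isT)) //.
  by rewrite scale1r.
pose z := F Rbeta 1%N *m v2.
have zP : weight_vector L (wt 1 0) z by apply: (Fwt _ _ _ _ _ v2P); exact: wtE.
have Ev3 : E Rbeta 1%N *m v3 = z.
  rewrite /v3 /E /F (dpow_EF_primitive (e := 1) LP v2P) //=; first by rewrite bin1 scale1r.
  by case=> [|[|i]].
(* Since <wt v1, alpha^vee> = 4, the exponent is e = 4 + i - 3 = i + 1, with coefficient binom(i +
   1, i) = i + 1: this is 3 for i = 2 and 4 = 0 for i = 3. *)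
have Ez (i : nat) : (0 < i <= 4)%N -> E Ralpha i *m z =
    F Rbeta 1%N *m (if (i <= 3)%N then i.+1%:R *: (F Ralpha (3 - i)%N *m v1) else 0).
  move=> /andP[i0 i4]; rewrite /z (comm Ralpha) /v2 /E /F.
  rewrite (dpow_EF_primitive (e := i.+1) LP v1P) => [|j /andP[j0 _]|]; first by rewrite binSn.
    exact: v1E.
  by rewrite /=; clear; lia.
have Ez2 : E Ralpha 2 *m z = 3%:R *: (F Rbeta 1%N *m (F Ralpha 1%N *m v1)) by rewrite Ez //= -scalemxAr.
have Ez3 : E Ralpha 3 *m z = 0.
  rewrite Ez //=; have -> : 4%:R = 0 :> k by rewrite (natrM _ 2 2) two0 mulr0.
  by rewrite scale0r mulmx0.
have Ez4 : E Ralpha 4 *m z = 0 by rewrite Ez // mulmx0.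
(* Here e = 1 + 4 - 2 = 3, and only the term j = 2 survives, with coefficient binom(3, 2) * 3 =
   9. *)
have E4F2z : E Ralpha 4 *m (F Ralpha 2 *m z) = 9%:R *: (F Rbeta 1%N *m (F Ralpha 1%N *m v1)).
  rewrite /E /F (dpow_EF (e := 3) LP zP) // !big_ord_recl big_ord0 /=.
  rewrite -!/(E _ _) -!/(F _ _) Ez4 Ez3 Ez2 !mulmx0 !scaler0 !add0r !addr0 /F dpow0 // mul1mx.
  by rewrite scalerA -natrM.
have E2 : E Rbeta 2 *m (F Rbeta 1%N *m (F Ralpha 1%N *m v1)) = F Ralpha 1%N *m v.
  have w1P : weight_vector L (wt 2 0) (F Ralpha 1%N *m v1).
    by apply: (Fwt _ _ _ _ _ v1P); exact: wtE.
  have Ew2 : E Rbeta 2 *m (F Ralpha 1%N *m v1) = 0.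
    rewrite (comm Rbeta) /v1 /E /F (dpow_EF_primitive (e := 2) LP vP) ?mulmx0 //.
    by move=> i /andP[i0 _]; exact: vE.
  have Ew1 : E Rbeta 1%N *m (F Ralpha 1%N *m v1) = F Ralpha 1%N *m v.
    by rewrite (comm Rbeta) /v1 /E /F (dpow_E1F1 (m := 1) LP vP (vE _ 1%N isT)) // scale1r.
  rewrite /E /F (dpow_EF (e := 1) LP w1P) // !big_ord_recl big_ord0 /=.
  rewrite -!/(E _ _) -!/(F _ _) Ew2 Ew1 mulmx0 !scaler0 !add0r !addr0 /F dpow0 // mul1mx.
  by rewrite binn scale1r.
pose v4 := F Ralpha 2 *m v3.
have v40 : v4 != 0.
  have H : E Ralpha 1%N *m (E Rbeta 2 *m (E Ralpha 4 *m (E Rbeta 1%N *m v4))) = 9%:R *: v.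
    rewrite /v4 (comm Rbeta) Ev3 E4F2z -!scalemxAr E2 /E /F.
    by rewrite (dpow_E1F1 (m := 1) LP vP (vE _ 1%N isT)) // scale1r.
  apply: contraNneq v0 => H4; move: H; rewrite H4 !mulmx0 => /esym/eqP.
  rewrite scaler_eq0; have -> : 9%:R = 1 :> k.
    by rewrite (natrD _ 1 8) (natrM _ 2 4) two0 mul0r addr0.
  by rewrite oner_eq0.
have v3P' : weight_vector L (alpha *+ p) v3 by rewrite p2.
have [iy yP] := contraction_lift LP NP JK iJ iW v3P'.
set y := J *m v3 in iy yP.
pose u := dpow N Ralpha false 1 *m y.
have iu : iota *m u = v4.
  by rewrite (contraction_dpow LP NP JK iD iW _ _ _ yP) iy p2.
have uP : weight_vector N 0 u.
  have := dpow_weight NP Ralpha false 1 yP.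
  by rewrite mulr1n -[alpha]/(root_weight Ralpha true) root_weightN addrN.
have Nwt ka w : w != 0 -> weight_vector N ka w ->
    exists2 x, x != 0 & weight_vector L (ka *+ 2) x.
  move=> w0 /(contraction_weight LP NP JK iW); rewrite p2 => wP; exists (iota *m w) => //.
  by apply: contraNneq w0 => /(iota_inj JK) ->.
(* In L the weight is 2 i alpha, taken by s_alpha s_beta to 2 i varpi_alpha = 4 i alpha + 2 i beta;
   for i >= 2 this is not below rho = 5 alpha + 3 beta. *)
have alpha_bound (i : nat) w : (2 <= i)%N -> weight_vector N (alpha *+ i) w -> w = 0.
  move=> i2 wP; apply: NNPP => /eqP w0; have [x x0 xP] := Nwt _ _ w0 wP.
  have [x1 x10 x1P] := refl_weight LP Rbeta xP x0.
  have [x2 x20 x2P] := refl_weight LP Ralpha x1P x10.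
  have /weight_leP[a [b []]] := Ltop _ _ x20 x2P.
  by rewrite !weight_mulrn /refl /= !int_mulrn; clear -i2; lia.
have Ey : dpow N Ralpha true 1 *m y = 0.
  apply: (alpha_bound 2) => //; have := dpow_weight NP Ralpha true 1 yP.
  by rewrite mulr1n.
have uU : upper_fixed N u.
  apply/upper_fixedP => // -[] i i0.
    have wP := dpow_weight NP Ralpha true i uP; rewrite add0r in wP.
    have [i2|i2] := leqP 2 i; first exact: (alpha_bound i).
    have -> : i = 1%N by clear -i0 i2; lia.
    have alpha_p : pairing Ralpha alpha = 2 by [].
    by rewrite /u (dpow_E1F1 NP yP Ey alpha_p) two0 scale0r.
  (* Likewise s_beta s_alpha takes 2 i beta to 2 i varpi_beta = 6 i alpha + 4 i beta, not below rho
     for i >= 1. *)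
  have wP := dpow_weight NP Rbeta true i uP; rewrite add0r in wP.
  apply: NNPP => /eqP w0; have [x x0 xP] := Nwt _ _ w0 wP.
  have [x1 x10 x1P] := refl_weight LP Ralpha xP x0.
  have [x2 x20 x2P] := refl_weight LP Rbeta x1P x10.
  have /weight_leP[a [b []]] := Ltop _ _ x20 x2P.
  by rewrite !weight_mulrn /refl /= !int_mulrn; clear -i0; lia.
have u0 := semisimple_descent NP Nss yP (isT : (0 < 1)%N) uU.
by move: v40; rewrite -iu /u u0 mulmx0 eqxx.
Qed.

End NonSemisimple.

Theorem mainTheorem4 (k : closedFieldType) (p : nat)
    (pcharkp : p \in [pchar k])
    (mu0 : @functional k) (mu0P : is_mu0 p mu0)
    (phi : @functional k -> @functional k) (phiP : contraction_hom p mu0 phi) :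
  (p = 2%N ->
   forall (nL : nat) (L : 'M[k]_7 -> 'M[k]_nL),
     simple_of_weight L rho ->
   forall (n : nat) (N : 'M[k]_7 -> 'M[k]_n),
     contraction mu0 phi L N -> ~ semisimple_module N)
  /\
  ((3 <= p)%N ->
   forall (nL nS : nat) (L : 'M[k]_7 -> 'M[k]_nL) (St : 'M[k]_7 -> 'M[k]_nS),
     simple_of_weight L (varpi_alpha *+ (p - 3) + varpi_beta *+ 2) ->
     simple_of_weight St (rho *+ (p - 1)) ->
     [/\ simple_module (tensor L (twist p St)),
         forall (n n' : nat) (N : 'M[k]_7 -> 'M[k]_n)
                (N' : 'M[k]_7 -> 'M[k]_n'),
           contraction mu0 phi (tensor L (twist p St)) N ->
           contraction mu0 phi L N' ->
           isomorphic N (tensor N' St) &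
         forall (n : nat) (N : 'M[k]_7 -> 'M[k]_n),
           contraction mu0 phi (tensor L (twist p St)) N ->
           ~ semisimple_module N]).
Proof.
split=> [p2 nL L [[LP _] Lhw] n N|p3 nL nS L St Lw Sw].
  exact: (contraction_steinberg_not_semisimple pcharkp mu0P phiP p2 LP Lhw).
have [[[LP _] Lhw] [[SP _] Shw]] := (Lw, Sw).
split=> [|n n' N N'|n N].
- apply: (tensor_twist_simple pcharkp p3 Lw Sw) => gam.
  by rewrite !weight_mulrn; case: gam => /=; clear -p3; lia.
- exact: (contraction_tensor pcharkp mu0P phiP LP SP).
- exact: (contraction_tensor_not_semisimple pcharkp mu0P phiP p3 LP Lhw SP Shw).
Qed.
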